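(* For the metaplectic spinors on $\mathbb CP^1=SU(2)/U(1)$ and every $l\ge0$, the spectrum of $P|_{E_l}$ is $$\left\{\lambda_{l,j}:=\tfrac18\left(4(l+j+1)^2-3(2l+1)^2-1\right): j=0,1,\dots\right\},$$ and the $\lambda_{l,j}$ eigenspace is isomorphic, as an $SU(2)$ representation, to $V_{2(l+j)+1}$. In particular, the multiplicity of the eigenvalue $\lambda_{l,j}$ is $2(l+j+1)$.
   Context: $V_k$ denotes the irreducible complex representation of $SU(2)$ of dimension $k+1$. $G=SU(2)$, $T=U(1)$ the diagonal torus with Lie algebra $\mathfrak t$, $\alpha$ the positive root. $g_0$ is minus the Killing form, and $\{E,F\}$ is a $g_0$-orthonormal basis of $\mathfrak t^\perp$ such that $Z=\frac12(E-iF)$, $\bar Z=\frac12(E+iF)$ are root vectors for $\alpha$ and $-\alpha$. $JE=F$, $JF=-E$ and $\omega_0(X,Y)=g_0(JX,Y)$ define the Kähler structure on $\mathbb CP^1=G/T$. Canonical quantization: $\sigma(E)=ix$, $\sigma(F)=d/dx$ on functions on $\mathbb R$, extended complex-linearly. $E_l^0$ is the line spanned by the Hermite function $h_l(x)=e^{x^2/2}\frac{d^l}{dx^l}e^{-x^2}$. $T$ acts on $E_l^0$, through the metaplectic representation composed with the lift of the adjoint action to the double cover of $U(\mathfrak t^\perp)$, with weight $(2l+1)\varpi$, where $\varpi=\alpha/2$ is the fundamental weight. The metaplectic spinor bundle is $\bigoplus_{l\ge0}E_l$ with $E_l=G\times_TE_l^0$; sections of $E_l$ are smooth $\phi:G\to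 E_l^0$ with $\phi(gt)=t^{-1}\cdot\phi(g)$ for $t\in T$. $G$ acts on sections by left translation. The symplectic Dolbeault operators are $\mathscr D\phi=4i\,\sigma(\bar Z)\,Z\cdot\phi:\Gamma(E_l)\to\Gamma(E_{l-1})$ and $\bar{\mathscr D}\phi=-4i\,\sigma(Z)\,\bar Z\cdot\phi:\Gamma(E_l)\to\Gamma(E_{l+1})$, where $X\cdot\phi$ is differentiation along the left-invariant vector field $X$ (extended complex-linearly); $P=\frac12[\mathscr D,\bar{\mathscr D}]$, which preserves each $\Gamma(E_l)$. *)

(* Defs.v *)
From HB Require Import structures.
From mathcomp Require Import all_boot all_order all_algebra.
From mathcomp Require Import complex ring zify.
From mathcomp Require Import all_classical all_reals all_analysis.

Set Implicit Arguments.
Unset Strict Implicit.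
Unset Printing Implicit Defensive.
Import Order.TTheory GRing.Theory Num.Theory.
Import numFieldNormedType.Exports.
Local Open Scope classical_set_scope.
Local Open Scope ring_scope.
Local Open Scope complex_scope.
Local Open Scope sesquilinear_scope.

(** * Operators, representations and dimensions on subspaces [W] of a
    vector space [U] *)

(* [T - lam] is not invertible as an operator on [W]; in particular every
   eigenvalue of [T] on [W] belongs to the spectrum. *)
Definition spectrum (K : fieldType) (U : lmodType K) (W : set U) (T : U -> U) :
    set K :=
  [set lam | ~ set_bij W W (fun u => T u - lam *: u)].

Definition eigenspace_in (K : fieldType) (U : lmodType K) (W : set U)
    (T : U -> U) (lam : K) : set U :=
  [set u | W u /\ T u = lam *: u].

Definition has_dim (K : fieldType) (U : lmodType K) (n : nat) (W : set U) :
    Prop :=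
  exists b : 'I_n -> U,
    set_bij [set: 'rV[K]_n] W (fun c => \sum_(i < n) c 0 i *: b i).

Definition invariant_under (G U : Type) (act : G -> U -> U) (W : set U) : Prop :=
  forall g u, W u -> W (act g u).

Definition rep_iso (K : fieldType) (G : Type) (U1 U2 : lmodType K)
    (act1 : G -> U1 -> U1) (W1 : set U1)
    (act2 : G -> U2 -> U2) (W2 : set U2) : Prop :=
  [/\ invariant_under act1 W1, invariant_under act2 W2 &
   exists f : U1 -> U2,
   [/\ forall a u v, W1 u -> W1 v -> f (a *: u + v) = a *: f u + f v,
       set_bij W1 W2 f &
       forall g u, W1 u -> f (act1 g u) = act2 g (f u)]].

Definition is_subspace (K : fieldType) (U : lmodType K) (W : set U) : Prop :=
  W 0 /\ forall a u v, W u -> W v -> W (a *: u + v).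

Definition irreducible_rep (K : fieldType) (G : Type) (U : lmodType K)
    (act : G -> U -> U) (W : set U) : Prop :=
  [/\ is_subspace W, invariant_under act W, W <> [set 0] &
   forall W', is_subspace W' -> invariant_under act W' -> W' `<=` W ->
     W' = [set 0] \/ W' = W].

(** * Smooth functions *)

(* On a finite-dimensional [V], this is the usual notion of a function of
   class C^n on the open set [A]: all iterated directional derivatives of
   order at most [n] exist and are continuous. *)
Fixpoint Cn_on (R : realType) (V : normedModType R) (A : set V) (n : nat)
    (f : V -> R) : Prop :=
  (forall x, A x -> {for x, continuous f}) /\
  (if n is m.+1 then
     forall v, (forall x, A x -> derivable f x v) /\ Cn_on A m ('D_v f)
   else True).

Definition smooth_on (R : realType) (V : normedModType R) (A : set V)
    (f : V -> R) : Prop :=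
  forall n, Cn_on A n f.

Definition derive1C (R : realType) (f : R -> R[i]) (t : R) : R[i] :=
  derive1 (fun s => complex.Re (f s)) t +i* derive1 (fun s => complex.Im (f s)) t.

(** * The group SU(2) *)

Record SU2 (R : realType) := MkSU2 {
  su2val :> 'M[R[i]]_2;
  su2valP : (su2val \is unitarymx) && (\det su2val == 1) }.

HB.instance Definition _ (R : realType) := [isSub for @su2val R].
HB.instance Definition _ (R : realType) := [Choice of SU2 R by <:].

Section SU2Group.
Variable R : realType.
Implicit Types g h : SU2 R.

Lemma su2_unitary g : su2val g \is unitarymx.
Proof. by case/andP: (su2valP g). Qed.

Lemma su2_det g : \det (su2val g) = 1.
Proof. by case/andP: (su2valP g) => _ /eqP. Qed.

Fact su2_one_subproof :
  ((1%:M : 'M[R[i]]_2) \is unitarymx) && (\det (1%:M : 'M[R[i]]_2) == 1).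
Proof.
rewrite det1 eqxx andbT; apply/unitarymxP.
by rewrite trmx1 map_mx1 mulmx1.
Qed.
Definition su2_one := MkSU2 su2_one_subproof.

Fact su2_mul_subproof g h :
  ((su2val g *m su2val h) \is unitarymx) && (\det (su2val g *m su2val h) == 1).
Proof.
rewrite mul_unitarymx ?su2_unitary //=.
by rewrite det_mulmx !su2_det mulr1.
Qed.
Definition su2_mul g h := MkSU2 (su2_mul_subproof g h).

Fact su2_inv_subproof g :
  ((su2val g ^t*) \is unitarymx) && (\det (su2val g ^t*) == 1).
Proof.
by rewrite trmxC_unitary su2_unitary /= det_map_mx det_tr su2_det rmorph1.
Qed.
Definition su2_inv g := MkSU2 (su2_inv_subproof g).

Fact su2_mulA : associative su2_mul.
Proof. by move=> a b c; apply/val_inj; rewrite /= mulmxA. Qed.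
Fact su2_mul1 : left_id su2_one su2_mul.
Proof. by move=> a; apply/val_inj; rewrite /= mul1mx. Qed.
Fact su2_1mul : right_id su2_one su2_mul.
Proof. by move=> a; apply/val_inj; rewrite /= mulmx1. Qed.
Fact su2_mulV : right_inverse su2_one su2_inv su2_mul.
Proof.
by move=> a; apply/val_inj; rewrite /=; apply/unitarymxP; exact: su2_unitary.
Qed.
Fact su2_Vmul : left_inverse su2_one su2_inv su2_mul.
Proof.
by move=> a; apply/val_inj; apply: mulmx1C; exact: (congr1 val (su2_mulV a)).
Qed.

End SU2Group.

HB.instance Definition _ (R : realType) := isGroup.Build (SU2 R)
  (@su2_mulA R) (@su2_mul1 R) (@su2_1mul R) (@su2_Vmul R) (@su2_mulV R).

(* SU(2) as a submanifold of the real vector space underlying the 2 x 2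
   complex matrices: a function is smooth iff it extends to a smooth function
   on an open neighbourhood. *)
Definition su2_embed (R : realType) (g : SU2 R) : 'M[R]_2 * 'M[R]_2 :=
  (map_mx (@complex.Re R) g, map_mx (@complex.Im R) g).

Definition su2_smooth (R : realType) (c : SU2 R -> R[i]) : Prop :=
  exists (A : set ('M[R]_2 * 'M[R]_2)) (F : 'M[R]_2 * 'M[R]_2 -> R[i]),
    [/\ open A,
        smooth_on A (fun x => complex.Re (F x)),
        smooth_on A (fun x => complex.Im (F x)) &
        forall g, A (su2_embed g) /\ F (su2_embed g) = c g].

(** * The Lie algebra su(2) *)

Definition mx22 (K : nzRingType) (a b c d : K) : 'M[K]_2 :=
  \matrix_(i, j) nth 0 (nth [::] [:: [:: a; b]; [:: c; d]] i) j.

Definition lie_su2 (R : realType) : set 'M[R[i]]_2 :=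
  [set X | X ^t* = - X /\ \tr X = 0].

Definition lie_bracket (R : realType) (X Y : 'M[R[i]]_2) : 'M[R[i]]_2 :=
  X *m Y - Y *m X.

(* The trace of [ad X \o ad Y] on the real Lie algebra su(2), computed in the
   basis [[i, 0; 0, -i]], [[0, 1; -1, 0]], [[0, i; i, 0]], whose dual
   coordinates are [Im (X 0 0)], [Re (X 0 1)] and [Im (X 0 1)]. *)
Definition killing (R : realType) (X Y : 'M[R[i]]_2) : R :=
  let adad W := lie_bracket X (lie_bracket Y W) in
  complex.Re (adad (mx22 0 1 (-1) 0) 0 1)
  + complex.Im (adad (mx22 'i 0 0 (- 'i)) 0 0)
  + complex.Im (adad (mx22 0 'i 'i 0) 0 1).

Definition g0 (R : realType) (X Y : 'M[R[i]]_2) : R := - killing X Y.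

(* [T] is the diagonal torus; [alpha] is the root with root space spanned by
   the upper triangular nilpotent matrices. *)
Definition lie_torus (R : realType) : set 'M[R[i]]_2 :=
  [set H | lie_su2 H /\ is_diag_mx H].

Definition alpha (R : realType) (H : 'M[R[i]]_2) : R[i] := H 0 0 - H 1 1.

Definition root_vector (R : realType) (a : 'M[R[i]]_2 -> R[i])
    (X : 'M[R[i]]_2) : Prop :=
  X != 0 /\ forall H, lie_torus H -> lie_bracket H X = a H *: X.

(* Vectors of the complexification of the orthogonal complement of the torus
   are given by their coordinates [(a, b)] in the basis [E], [F]. *)
Definition frame_vec (R : realType) (E F : 'M[R[i]]_2) (w : R[i] * R[i]) :
    'M[R[i]]_2 :=
  w.1 *: E + w.2 *: F.

Definition Zvec (R : realType) : R[i] * R[i] := (2^-1, - ('i / 2)).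
Definition Zbar (R : realType) : R[i] * R[i] := (2^-1, 'i / 2).

Record adapted_frame (R : realType) (E F : 'M[R[i]]_2) : Prop := {
  frame_su2 : lie_su2 E /\ lie_su2 F;
  frame_perp : forall H, lie_torus H -> g0 E H = 0 /\ g0 F H = 0;
  frame_orthonormal : [/\ g0 E E = 1, g0 F F = 1 & g0 E F = 0];
  frame_Z : root_vector (@alpha R) (frame_vec E F (Zvec R));
  frame_Zbar : root_vector (fun H => - alpha H) (frame_vec E F (Zbar R)) }.

Definition expmx (R : realType) (X : 'M[R[i]]_2) : 'M[R[i]]_2 :=
  let S (n : nat) := \sum_(k < n) (k`!%:R)^-1 *: X ^+ k in
  \matrix_(i, j) (lim ((fun n => complex.Re (S n i j)) @ \oo)
                  +i* lim ((fun n => complex.Im (S n i j)) @ \oo)).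

Section ExpSU2.
Variable R : realType.
Implicit Types X Y : 'M[R[i]]_2.

Lemma lie_su2_entries X : lie_su2 X ->
  [/\ complex.Re (X 0 0) = 0, X 1 1 = - X 0 0 & X 1 0 = - (X 0 1)^*].
Proof.
move=> [/matrixP hX htr].
have h00 := hX 0 0; have h10 := hX 1 0; rewrite !mxE in h00 h10.
split.
- move: h00; case: (X 0 0) => a b /= h.
  have ha : a = - a := congr1 (@complex.Re R) h.
  have : a + a = 0 by rewrite {1}ha addNr.
  by rewrite -mulr2n => /eqP; rewrite mulrn_eq0 /= => /eqP.
- move: htr; rewrite /mxtrace !big_ord_recl big_ord0 addr0 /= => /eqP.
  rewrite addrC addr_eq0 => /eqP e.
  by rewrite (_ : (1 : 'I_2) = lift ord0 ord0) //; exact: val_inj.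
- by rewrite -[LHS]opprK -h10.
Qed.

Lemma lie_su2Z (t : R) X : lie_su2 X -> lie_su2 (t%:C *: X).
Proof.
move=> [hX htr]; split; last by rewrite mxtraceZ htr mulr0.
apply/matrixP => i j; move/matrixP/(_ i j): hX; rewrite !mxE => hX.
rewrite rmorphM /= hX -mulrN; congr (_ * _).
by rewrite -[RHS]conjc_real.
Qed.


Definition nsq X : R :=
  complex.Im (X 0 0) ^+ 2 + complex.Re (X 0 1) ^+ 2 + complex.Im (X 0 1) ^+ 2.

Lemma ord2P (P : 'I_2 -> Prop) : P 0 -> P 1 -> forall i, P i.
Proof.
move=> h0 h1 [[|[|//]] hi].
- by rewrite (_ : Ordinal hi = 0) //; exact: val_inj.
- by rewrite (_ : Ordinal hi = 1) //; exact: val_inj.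
Qed.

Lemma sum_ord2 (V : zmodType) (F : 'I_2 -> V) : \sum_i F i = F 0 + F 1.
Proof.
rewrite !big_ord_recl big_ord0 addr0; congr (F _ + F _); exact: val_inj.
Qed.

Lemma lie_su2_sqr X : lie_su2 X -> X ^+ 2 = - (nsq X)%:C *: 1.
Proof.
move=> /lie_su2_entries [h0 h1 h2].
apply/matrixP; apply: ord2P => j; move: j; apply: ord2P;
  rewrite expr2 [X * X]/(X *m X) !mxE sum_ord2 ?h1 ?h2 /nsq /=;
  move: h0; case: (X 0 0) => a b /= ->; case: (X 0 1) => c d /=.
all: apply/eqP; rewrite eq_complex /=.
all: rewrite ?mulr0n ?mulr1n /=.
all: apply/andP; split; apply/eqP.
all: ring.
Qed.

Lemma lie_su2_nsq0 X : lie_su2 X -> nsq X = 0 -> X = 0.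
Proof.
move=> /lie_su2_entries [h0 h1 h2] /eqP.
rewrite /nsq paddr_eq0 ?addr_ge0 ?sqr_ge0 // paddr_eq0 ?sqr_ge0 //.
rewrite !sqrf_eq0 => /andP [/andP [/eqP i0 /eqP r1] /eqP i1].
have e0 : X 0 0 = 0 by apply/eqP; rewrite eq_complex h0 i0 /= !eqxx.
have e1 : X 0 1 = 0 by apply/eqP; rewrite eq_complex r1 i1 /= !eqxx.
apply/matrixP; apply: ord2P => j; move: j; apply: ord2P;
  rewrite [RHS]mxE ?h1 ?h2 ?e0 ?e1;
  by apply/eqP; rewrite eq_complex /= ?oppr0 ?eqxx.
Qed.

Let rr X := Num.sqrt (nsq X).

Lemma nsq_ge0 X : 0 <= nsq X.
Proof. by rewrite !addr_ge0 ?sqr_ge0. Qed.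

Lemma natVC n : (n%:R : R[i])^-1 = (n%:R^-1)%:C.
Proof. by rewrite -[RHS]/(real_complex R _) fmorphV rmorph_nat. Qed.

Lemma expmx_term X k : lie_su2 X ->
  (k`!%:R)^-1 *: X ^+ k =
  (cos_coeff (rr X) k)%:C *: 1 + (sin_coeff (rr X) k / rr X)%:C *: X.
Proof.
move=> hX; have [r0|r0] := eqVneq (rr X) 0.
  have X0 : X = 0.
    apply: lie_su2_nsq0 => //; apply/eqP; rewrite eq_le nsq_ge0 andbT.
    by rewrite -sqrtr_eq0; apply/eqP.
  rewrite r0 X0 scaler0 addr0 /cos_coeff /=; case: k => [|k].
    rewrite expr0 natVC; congr (_%:C *: _).
    by rewrite fact0 !mulr1 mul1r.
  by rewrite exprS mul0r scaler0 exprS mul0r mulr0 mul0r scale0r.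
have X2 m : X ^+ m.*2 = ((-1) ^+ m * rr X ^+ m.*2)%:C *: 1.
  rewrite -mul2n exprM lie_su2_sqr // exprZn expr1n exprM sqr_sqrtr ?nsq_ge0 //.
  by rewrite -exprMn mulN1r rmorphXn /= rmorphN.
rewrite -[k]odd_double_half /cos_coeff /sin_coeff /=.
set m := k./2; case: (odd k) => /=.
- rewrite !add0n odd_double /= mul0r mul0r mul0r scale0r add0r.
  rewrite exprS X2 natVC -scalerAr mulr1 scalerA -rmorphM /= doubleK mul1r.
  congr (_%:C *: _); rewrite exprS; field.
  by rewrite r0 pnatr_eq0 -lt0n fact_gt0.
- rewrite !add0n odd_double /= mul1r !mul0r scale0r addr0.
  rewrite X2 natVC scalerA -rmorphM /= doubleK.
  by congr (_%:C *: _); rewrite mulrC.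
Qed.

Lemma lie_su2_expmx X : lie_su2 X ->
  expmx X = (cos (rr X))%:C *: 1 + (sin (rr X) / rr X)%:C *: X.
Proof.
move=> hX; apply/matrixP => i j; rewrite !mxE.
have S_E n : (\sum_(k < n) (k`!%:R)^-1 *: X ^+ k) i j =
    (series (cos_coeff (rr X)) n)%:C * (i == j)%:R +
    (series (sin_coeff (rr X)) n / rr X)%:C * X i j.
  under eq_bigr do rewrite expmx_term //.
  rewrite big_split /= -!scaler_suml !mxE !seriesEnat /= !big_mkord.
  rewrite [X in _ = _ + X%:C * _]mulr_suml.
  by congr (_ * _ + _ * _); exact/esym/(rmorph_sum (real_complex R)). 
have cc : series (cos_coeff (rr X)) @ \oo --> cos (rr X).
  by rewrite cos.unlock; exact: is_cvg_series_cos_coeff.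
have cs : series (sin_coeff (rr X)) @ \oo --> sin (rr X).
  by rewrite sin.unlock; exact: is_cvg_series_sin_coeff.
have ReE n : complex.Re ((\sum_(k < n) (k`!%:R)^-1 *: X ^+ k) i j) =
    series (cos_coeff (rr X)) n * (i == j)%:R +
    series (sin_coeff (rr X)) n / rr X * complex.Re (X i j).
  by rewrite S_E; case: (i == j); case: (X i j) => a b /=; ring.
have ImE n : complex.Im ((\sum_(k < n) (k`!%:R)^-1 *: X ^+ k) i j) =
    series (sin_coeff (rr X)) n / rr X * complex.Im (X i j).
  by rewrite S_E; case: (i == j); case: (X i j) => a b /=; ring.
under eq_fun do rewrite ReE.
under [X in _ +i* lim (X @ _)]eq_fun do rewrite ImE.
have -> : lim ((fun n => series (cos_coeff (rr X)) n * (i == j)%:R +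
    series (sin_coeff (rr X)) n / rr X * complex.Re (X i j)) @ \oo) =
    cos (rr X) * (i == j)%:R + sin (rr X) / rr X * complex.Re (X i j).
  apply/cvg_lim => //; apply: cvgD; first by apply: cvgMl.
  by apply: cvgMl; apply: cvgMl.
have -> : lim ((fun n =>
    series (sin_coeff (rr X)) n / rr X * complex.Im (X i j)) @ \oo) =
    sin (rr X) / rr X * complex.Im (X i j).
  by apply/cvg_lim => //; apply: cvgMl; apply: cvgMl.
apply/eqP; rewrite eq_complex /=.
by case: (i == j); case: (X i j) => a b /=; apply/andP; split; apply/eqP; ring.
Qed.

Lemma det2 X : \det X = X 0 0 * X 1 1 - X 0 1 * X 1 0.
Proof.
rewrite (expand_det_row _ 0) sum_ord2 /cofactor !det_mx11 !mxE /=.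
rewrite expr0 expr1 mul1r mulN1r mulrN.
by congr (_ * X _ _ - _ * X _ _); exact: val_inj.
Qed.

Lemma lie_su2_expmx_SU2 X : lie_su2 X ->
  (expmx X \is unitarymx) && (\det (expmx X) == 1).
Proof.
move=> hX; have [hXs _] := hX; have hX2 := lie_su2_sqr hX.
rewrite lie_su2_expmx //; set c := cos _; set s := sin _ / _.
have e : c ^+ 2 + s ^+ 2 * nsq X = 1.
  have -> : s ^+ 2 * nsq X = sin (rr X) ^+ 2.
    have [r0|r0] := eqVneq (rr X) 0; last first.
      by rewrite /s exprMn exprVn -[nsq X]sqr_sqrtr ?nsq_ge0 // mulfVK // sqrf_eq0.
    by rewrite /s r0 sin0 mul0r expr0n /= mul0r.
  exact: cos2Dsin2.
move: c s e => c s e.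
have [h0 h1 h2] := lie_su2_entries hX.
apply/andP; split.
  apply/unitarymxP.
  have -> : (c%:C *: 1 + s%:C *: X) ^t* = c%:C *: 1 - s%:C *: X.
    apply/matrixP => i j; move/matrixP/(_ i j): hXs; rewrite !mxE => hij.
    rewrite rmorphD !rmorphM /= hij rmorph_nat eq_sym mulrN.
    by congr (_ * _ - _ * _); exact: conjc_real.
  rewrite -[LHS]/((_ : 'M[R[i]]_2) * _) mulrDl !mulrBr -!scalerAl !mul1r -!scalerAr !mulr1.
  rewrite -expr2 hX2 !scalerA [s%:C * c%:C]mulrC subrKA -scalerBl.
  rewrite [X in X *: _](_ : _ = 1) ?scale1r //.
  apply/eqP; rewrite eq_complex /=; apply/andP; split; apply/eqP; last by ring.
  by rewrite -e; ring.
rewrite det2 !mxE h1 h2 eq_complex.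
move: e h0; rewrite /nsq; case: (X 0 0) => a b /=; case: (X 0 1) => u v /= e h0.
rewrite {}h0 /=; apply/andP; split; apply/eqP; last by ring.
by apply: etrans e; ring.
Qed.

End ExpSU2.

(* The exponential map su(2) -> SU(2); the default value is only used outside
   of su(2), see [su2_expE]. *)
Definition su2_exp (R : realType) (X : 'M[R[i]]_2) : SU2 R :=
  insubd (1%g : SU2 R) (expmx X).

Lemma su2_expE (R : realType) (X : 'M[R[i]]_2) :
  lie_su2 X -> su2val (su2_exp X) = expmx X.
Proof.
move=> hX; rewrite /su2_exp /insubd; case: insubP => [g _ <- //|].
by move/negP; case; exact: lie_su2_expmx_SU2.
Qed.

Lemma adapted_frame_exists (R : realType) :
  exists E F : 'M[R[i]]_2, adapted_frame E F.
Proof.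
pose s : R := (Num.sqrt 8)^-1.
have s8 : 8 * s ^+ 2 = 1 by rewrite exprVn sqr_sqrtr // mulfV.
have s0 : s != 0 by rewrite invr_eq0 sqrtr_eq0 -ltNge.
have ext2 (X Y : 'M[R[i]]_2) : X 0 0 = Y 0 0 -> X 0 1 = Y 0 1 ->
    X 1 0 = Y 1 0 -> X 1 1 = Y 1 1 -> X = Y.
  move=> h0 h1 h2 h3.
  by apply/matrixP; apply: ord2P => j; move: j; apply: ord2P.
have lieP (x u v : R) :
    lie_su2 (mx22 (0 +i* x) (u +i* v) ((- u) +i* v) (0 +i* - x)).
  split; last by rewrite /mxtrace sum_ord2 !mxE /=; apply/eqP;
    rewrite eq_complex /= addr0 subrr !eqxx.
  by apply: ext2; rewrite !mxE /=; apply/eqP;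
    rewrite eq_complex /= ?oppr0 ?opprK !eqxx.
have mulE (a b c d a' b' c' d' : R[i]) :
    mx22 a b c d *m mx22 a' b' c' d' =
    mx22 (a * a' + b * c') (a * b' + b * d') (c * a' + d * c') (c * b' + d * d').
  by apply: ext2; rewrite [LHS]mxE sum_ord2 !mxE.
have subE (a b c d a' b' c' d' : R[i]) :
    mx22 a b c d - mx22 a' b' c' d' = mx22 (a - a') (b - b') (c - c') (d - d').
  by apply: ext2; rewrite [LHS]mxE [X in _ + X]mxE !mxE.
have brE (a b c d a' b' c' d' : R[i]) :
    lie_bracket (mx22 a b c d) (mx22 a' b' c' d') =
    mx22 (b * c' - b' * c) (a * b' + b * d' - (a' * b + b' * d))
         (c * a' + d * c' - (c' * a + d' * c)) (c * b' - c' * b).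
  by rewrite /lie_bracket !mulE subE; congr mx22; ring.
have nE (x : R) : 0 -i* x = - (0 +i* x).
  by apply/eqP; rewrite eq_complex /= oppr0 !eqxx.
have scE (k a b c d : R[i]) :
    k *: mx22 a b c d = mx22 (k * a) (k * b) (k * c) (k * d).
  by apply: ext2; rewrite !mxE.
have adE (a b c d a' b' c' d' : R[i]) :
    mx22 a b c d + mx22 a' b' c' d' = mx22 (a + a') (b + b') (c + c') (d + d').
  by apply: ext2; rewrite [LHS]mxE !mxE.
have iiE : 'i * 'i = -1 :> R[i] by rewrite -expr2 sqr_i.
have isE : 0 +i* s = 'i * s%:C.
  by apply/eqP; rewrite eq_complex /=; apply/andP; split; apply/eqP; ring.
have n2 : (2 : R[i]) != 0 by rewrite pnatr_eq0.
have halfE : s%:C = (1 - 'i * 'i) / 2 * s%:C by rewrite iiE; field.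
have halfE0 : 0 = (1 + 'i * 'i) / 2 * s%:C by rewrite iiE; field.
pose E := mx22 0 s%:C (- s%:C) 0; pose F := mx22 0 (0 +i* s) (0 +i* s) 0.
have ZE : frame_vec E F (Zvec R) = mx22 0 s%:C 0 0.
  rewrite /frame_vec /Zvec /E /F !scE adE /= isE; congr mx22; try by ring.
    by rewrite [RHS]halfE; ring.
  by rewrite -[RHS]oppr0 [in RHS]halfE0; ring.
have ZbarE : frame_vec E F (Zbar R) = mx22 0 0 (- s%:C) 0.
  rewrite /frame_vec /Zbar /E /F !scE adE /= isE; congr mx22; try by ring.
    by rewrite [RHS]halfE0; ring.
  by rewrite [in RHS]halfE; ring.
have torusP (H : 'M[R[i]]_2) : lie_torus H ->
    exists x : R, H = mx22 (0 +i* x) 0 0 (0 +i* - x).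
  move=> [hH /is_diag_mxP dH]; exists (complex.Im (H 0 0)).
  have [h0 h1 h2] := lie_su2_entries hH.
  have h01 : H 0 1 = 0 by apply: dH.
  apply: ext2; rewrite !mxE /= ?h1 ?h2 ?h01; move: h0; case: (H 0 0) => y z /= y0;
    by apply/eqP; rewrite eq_complex /= ?y0 ?oppr0 !eqxx.
exists E, F.
have gE (X Y : 'M[R[i]]_2) (v : R) : killing X Y = - v -> g0 X Y = v.
  by move=> h; rewrite /g0 h opprK.
split.
- split.
    have := lieP 0 s 0; congr (lie_su2 _); apply: ext2; rewrite !mxE //=;
      by apply/eqP; rewrite eq_complex /= ?oppr0 !eqxx.
  have := lieP 0 0 s; congr (lie_su2 _); apply: ext2; rewrite !mxE //=;
    by apply/eqP; rewrite eq_complex /= ?oppr0 !eqxx.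
- move=> H /torusP [x ->]; split; apply: gE; rewrite /killing !brE !mxE /=; ring.
- split; apply: gE; rewrite /killing !brE !mxE /=; last by ring.
    by transitivity (- (8 * s ^+ 2)); [ring | rewrite s8].
  by transitivity (- (8 * s ^+ 2)); [ring | rewrite s8].
- rewrite ZE; split.
    apply/negP => /eqP/matrixP /(_ 0 1); rewrite !mxE /= => /eqP.
    by rewrite eq_complex /= (negbTE s0).
  move=> H /torusP [x ->]; rewrite brE scE /alpha !mxE /=.
  by rewrite (_ : 0 -i* x = - (0 +i* x)) ?nE //; congr mx22; ring.
- rewrite ZbarE; split.
    apply/negP => /eqP/matrixP /(_ 1 0); rewrite !mxE /= => /eqP.
    by rewrite eq_complex /= oppr_eq0 (negbTE s0).
  move=> H /torusP [x ->]; rewrite brE scE /alpha !mxE /=.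
  by rewrite (_ : 0 -i* x = - (0 +i* x)) ?nE //; congr mx22; ring.
Qed.

(** * Metaplectic spinors on SU(2)/U(1) *)

Section Spinors.
Variable R : realType.

(* Spinor fields are functions on SU(2) with values in the functions on the
   real line. *)
Local Notation spinor := (SU2 R -> R -> R[i]).

Definition hermite (l : nat) (x : R) : R :=
  expR (x ^+ 2 / 2) * derive1n l (fun y : R => expR (- y ^+ 2)) x.

Definition hermiteC (l : nat) : R -> R[i] := fun x => (hermite l x)%:C.

(* [ (2l+1) varpi ] integrates to the [2l+1]-st power of the upper left entry
   of a diagonal matrix, since [alpha] integrates to its square. *)
Definition torus_act (l : nat) (t : SU2 R) (h : R -> R[i]) : R -> R[i] :=
  su2val t 0 0 ^+ (2 * l + 1) *: h.

(* Smooth sections of [E_l]; smoothness of a function with values in the line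
   spanned by [hermiteC l] is that of its coordinate [c]. *)
Definition Gamma (l : nat) : set spinor :=
  [set phi |
    (exists2 c : SU2 R -> R[i], su2_smooth c &
       phi = fun g => c g *: hermiteC l) /\
    (forall g t : SU2 R, is_diag_mx (su2val t) ->
       phi (g * t)%g = torus_act l t^-1%g (phi g))].

Variables E F : 'M[R[i]]_2.

Definition sigma (w : R[i] * R[i]) (f : R -> R[i]) : R -> R[i] :=
  fun x => w.1 * ('i * x%:C * f x) + w.2 * derive1C f x.

(* Derivative along the left-invariant vector field of [X] in su(2). *)
Definition lderiv (X : 'M[R[i]]_2) (phi : spinor) : spinor :=
  fun g x => derive1C (fun t => phi (g * su2_exp (t%:C *: X))%g x) 0.

Definition lderivC (w : R[i] * R[i]) (phi : spinor) : spinor :=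
  w.1 *: lderiv E phi + w.2 *: lderiv F phi.

Definition Dolb (phi : spinor) : spinor :=
  fun g => (4 * 'i) *: sigma (Zbar R) (lderivC (Zvec R) phi g).

Definition Dolbbar (phi : spinor) : spinor :=
  fun g => - (4 * 'i) *: sigma (Zvec R) (lderivC (Zbar R) phi g).

Definition Pop (phi : spinor) : spinor :=
  2^-1 *: (Dolb (Dolbbar phi) - Dolbbar (Dolb phi)).

End Spinors.

Definition left_translation (R : realType) (g : SU2 R) (phi : SU2 R -> R -> R[i]) :
    SU2 R -> R -> R[i] :=
  fun h => phi (g^-1 * h)%g.

(** * Irreducible representations of SU(2) *)

(* The irreducible representation of dimension [k+1] is modelled by the binary
   forms of degree [k], viewed as functions on C^2; see [Virr_irreducible] and
   [Virr_dim]. *)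
Definition Virr (R : realType) (k : nat) : set ('cV[R[i]]_2 -> R[i]) :=
  [set p | exists c : 'I_k.+1 -> R[i],
     p = fun z : 'cV[R[i]]_2 =>
           \sum_(j < k.+1) c j * z 0 0 ^+ j * z 1 0 ^+ (k - j)].

Definition Vact (R : realType) (g : SU2 R) (p : 'cV[R[i]]_2 -> R[i]) :
    'cV[R[i]]_2 -> R[i] :=
  fun z => p (su2val g^-1%g *m z).

Section Irreducibility.
Variable R : realType.
Local Notation C := R[i].
Local Notation fn := ('cV[C]_2 -> C).

Let mono (k j : nat) : fn := fun z => z 0 0 ^+ j * z 1 0 ^+ (k - j).

Let scalefE (a : C) (p : fn) z : (a *: p) z = a * p z. Proof. by []. Qed.
Let addfE (p q : fn) z : (p + q) z = p z + q z. Proof. by []. Qed.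

Lemma VirrP k (p : fn) :
  Virr k p <-> exists c : 'I_k.+1 -> C, p = \sum_(j < k.+1) c j *: mono k j.
Proof.
have e (c : 'I_k.+1 -> C) : (\sum_(j < k.+1) c j *: mono k j) =
    fun z : 'cV[C]_2 => \sum_(j < k.+1) c j * z 0 0 ^+ j * z 1 0 ^+ (k - j).
  apply/funext => z; rewrite fct_sumE; apply: eq_bigr => j _.
  by rewrite /mono -mulrA.
by split=> -[c ->]; exists c; rewrite e.
Qed.

Lemma Virr0 k : Virr k (0 : fn).
Proof.
by apply/VirrP; exists (fun=> 0); rewrite big1 // => j _; rewrite scale0r.
Qed.

Lemma VirrD k (a : C) (p q : fn) : Virr k p -> Virr k q -> Virr k (a *: p + q).
Proof.
move=> /VirrP [c ->] /VirrP [d ->]; apply/VirrP.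
exists (fun j => a * c j + d j).
rewrite scaler_sumr -big_split /=; apply: eq_bigr => j _.
by rewrite scalerDl scalerA.
Qed.

Lemma Virr_sum k (I : Type) (r : seq I) (P : pred I) (f : I -> fn) :
  (forall i, P i -> Virr k (f i)) -> Virr k (\sum_(i <- r | P i) f i).
Proof.
move=> h; elim/big_ind: _ => //; first exact: Virr0.
by move=> p q hp hq; rewrite -[p]scale1r; exact: VirrD.
Qed.

Lemma Virr_mono k j : (j <= k)%N -> Virr k (mono k j).
Proof.
move=> jk; apply/VirrP; exists (fun i => ((i : nat) == j)%:R).
have jk1 : (j < k.+1)%N by [].
rewrite (bigD1 (Ordinal jk1)) //= eqxx scale1r big1 ?addr0 // => i hi.
by rewrite (_ : (i : nat) == j = false) ?scale0r //; exact/negbTE.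
Qed.

Lemma Virr_mull k (a b : C) (p : fn) : Virr k p ->
  Virr k.+1 (fun z => (a * z 0 0 + b * z 1 0) * p z).
Proof.
move=> /VirrP [c ->].
have -> : (fun z : 'cV[C]_2 => (a * z 0 0 + b * z 1 0) *
      (\sum_(j < k.+1) c j *: mono k j) z) =
    \sum_(j < k.+1) ((a * c j) *: mono k.+1 j.+1 +
                     (b * c j) *: mono k.+1 j).
  apply/funext => z; rewrite !fct_sumE mulr_sumr; apply: eq_bigr => j _.
  rewrite [RHS]addfE. idtac.
  rewrite !scalefE.
  rewrite /mono.
  have jk : (j <= k)%N by rewrite -ltnS.
  rewrite subSS (subSn jk).
  rewrite !exprS.
  set u := z 0 0; set v := z 1 0; set s1 := u ^+ j; set s2 := v ^+ _.
  ring.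
apply: Virr_sum => j _; have jk : (j <= k)%N by rewrite -ltnS.
apply: VirrD; first exact: Virr_mono.
rewrite -[X in Virr _ X]addr0; apply: VirrD; last exact: Virr0.
by apply: Virr_mono; exact: leqW.
Qed.

Lemma Virr_pow (m n : nat) (a b c d : C) :
  Virr (m + n) (fun z : 'cV[C]_2 =>
    (a * z 0 0 + b * z 1 0) ^+ m * (c * z 0 0 + d * z 1 0) ^+ n).
Proof.
elim: m => [|m IH]; last first.
  have -> : (fun z : 'cV[C]_2 => (a * z 0 0 + b * z 1 0) ^+ m.+1 *
      (c * z 0 0 + d * z 1 0) ^+ n) =
    (fun z : 'cV[C]_2 => (a * z 0 0 + b * z 1 0) * ((a * z 0 0 + b * z 1 0) ^+ m *
      (c * z 0 0 + d * z 1 0) ^+ n)).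
    by apply/funext => z; rewrite exprS mulrA.
  exact: Virr_mull.
elim: n => [|n IH].
  have := @Virr_mono 0 0 (leqnn _); congr Virr.
have -> : (fun z : 'cV[C]_2 => (a * z 0 0 + b * z 1 0) ^+ 0 *
      (c * z 0 0 + d * z 1 0) ^+ n.+1) =
    (fun z : 'cV[C]_2 => (c * z 0 0 + d * z 1 0) * ((a * z 0 0 + b * z 1 0) ^+ 0 *
      (c * z 0 0 + d * z 1 0) ^+ n)).
  by apply/funext => z; rewrite exprS !mul1r.
exact: Virr_mull.
Qed.

Lemma Vact_lin g (a : C) (p q : fn) :
  Vact g (a *: p + q) = a *: Vact g p + Vact g q.
Proof. by []. Qed.

Lemma Vact_sum g (I : Type) (r : seq I) (P : pred I) (f : I -> fn) :
  Vact g (\sum_(i <- r | P i) f i) = \sum_(i <- r | P i) Vact g (f i).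
Proof. by apply/funext => z; rewrite /Vact !fct_sumE. Qed.

Lemma Vact_mono g k j : Vact g (mono k j) = fun z : 'cV[C]_2 =>
  (su2val g^-1%g 0 0 * z 0 0 + su2val g^-1%g 0 1 * z 1 0) ^+ j *
  (su2val g^-1%g 1 0 * z 0 0 + su2val g^-1%g 1 1 * z 1 0) ^+ (k - j).
Proof.
apply/funext => z; rewrite /Vact /mono; move: (su2val _) => A.
by rewrite !mxE !sum_ord2.
Qed.

Lemma Virr_invariant k : invariant_under (@Vact R) (Virr k).
Proof.
move=> g p /VirrP [c ->]; rewrite Vact_sum; apply: Virr_sum => j _.
rewrite -[X in Virr _ X]addr0.
rewrite -[Vact _ _]/(c j *: Vact g (mono k j)).
apply: VirrD; last exact: Virr0.
have jk : (j <= k)%N by rewrite -ltnS.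
by rewrite Vact_mono -{1}(subnKC jk); exact: Virr_pow.
Qed.

Fact su2_mk_subproof (x y u v : R) :
  x ^+ 2 + y ^+ 2 + u ^+ 2 + v ^+ 2 = 1 ->
  let M := mx22 (x +i* y) (u +i* v) ((- u) +i* v) (x -i* y) in
  (M \is unitarymx) && (\det M == 1).
Proof.
move=> e; cbv zeta; apply/andP; split; last first.
  rewrite det2 !mxE /= eq_complex /=; apply/andP; split; apply/eqP; last by ring.
  by apply: etrans e; ring.
apply/unitarymxP/matrixP; apply: ord2P => j; move: j; apply: ord2P;
  rewrite [LHS]mxE sum_ord2 !mxE /=; apply/eqP; rewrite eq_complex /=;
  apply/andP; split; apply/eqP; (try by ring); by apply: etrans e; ring.
Qed.
Definition su2_mk (x y u v : R) (e : x ^+ 2 + y ^+ 2 + u ^+ 2 + v ^+ 2 = 1) :=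
  MkSU2 (su2_mk_subproof e).

Lemma Vact_mk (x y u v : R) (e : x ^+ 2 + y ^+ 2 + u ^+ 2 + v ^+ 2 = 1) k j :
  Vact (su2_mk e)^-1%g (mono k j) = fun z : 'cV[C]_2 =>
  ((x +i* y) * z 0 0 + (u +i* v) * z 1 0) ^+ j *
  (((- u) +i* v) * z 0 0 + (x -i* y) * z 1 0) ^+ (k - j).
Proof. by rewrite Vact_mono invgK /= !mxE. Qed.

Lemma cos_sin_pow (t : R) n :
  (cos t +i* sin t) ^+ n = cos (t *+ n) +i* sin (t *+ n).
Proof.
elim: n => [|n IH]; first by rewrite expr0 mulr0n cos0 sin0.
rewrite exprS IH mulrS cosD sinD.
by apply/eqP; rewrite eq_complex /= eqxx [cos t * _ + _]addrC /= eqxx.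
Qed.

Lemma Virr_isolate k (W : set fn) (c : 'I_k.+1 -> C) :
  is_subspace W -> invariant_under (@Vact R) W ->
  W (\sum_(j < k.+1) c j *: mono k j) -> forall j, W (c j *: mono k j).
Proof.
move=> [W0 WD] Wi Wc j0.
have WZ a p : W p -> W (a *: p) by move=> hp; rewrite -[_ *: _]addr0; exact: WD.
pose t : R := pi / (2 * k.+1)%:R.
have e : cos t ^+ 2 + sin t ^+ 2 + 0 ^+ 2 + 0 ^+ 2 = 1.
  by rewrite cos2Dsin2 expr0n /= !addr0.
pose w := cos t +i* sin t.
pose mu j : C := w ^+ j * (cos t -i* sin t) ^+ (k - j).
have muE j : Vact (su2_mk e)^-1%g (mono k j) = mu j *: mono k j.
  rewrite Vact_mk; apply/funext => z; rewrite scalefE /mono /mu /w.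
  have -> : 0 +i* 0 = 0 :> C by [].
  have -> : (- 0) +i* 0 = 0 :> C by rewrite oppr0.
  by rewrite !mul0r addr0 add0r !exprMn mulrACA.
have wmu j : (j <= k)%N -> w ^+ k * mu j = w ^+ (2 * j).
  move=> jk; rewrite /mu mulrA -exprD.
  rewrite (_ : k + j = 2 * j + (k - j))%N; last by lia.
  rewrite exprD -mulrA -exprMn (_ : w * _ = 1) ?expr1n ?mulr1 //.
  apply/eqP; rewrite eq_complex /=; apply/andP; split; apply/eqP; last by ring.
  by rewrite -(cos2Dsin2 t); ring.
have wU : w != 0.
  apply/eqP => w0; have := cos2Dsin2 t; have [-> ->] : cos t = 0 /\ sin t = 0.
    by case: w0.
  by rewrite expr0n /= addr0 => /esym/eqP; rewrite oner_eq0.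
have mu_lt i j : (i < j)%N -> (j <= k)%N -> mu i != mu j.
  move=> ij jk; apply/eqP => eij.
  have : w ^+ (2 * i) = w ^+ (2 * j).
    by rewrite -!wmu ?eij //; lia.
  rewrite (_ : 2 * j = 2 * i + 2 * (j - i))%N; last by lia.
  rewrite exprD -[LHS]mulr1 => /(mulfI (expf_neq0 _ wU)).
  rewrite cos_sin_pow => -[_ s0].
  suff : 0 < sin (t *+ (2 * (j - i))) by rewrite -s0 ltxx.
  have d0 : 0 < (2 * k.+1)%:R :> R by rewrite ltr0n.
  apply: sin_gt0_pi; rewrite -mulr_natr; apply/andP; split.
    by rewrite !mulr_gt0 ?pi_gt0 ?invr_gt0 // ltr0n; lia.
  rewrite /t mulrAC ltr_pdivrMr // ltr_pM2l ?pi_gt0 // ltr_nat; lia.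
have muI (i j : 'I_k.+1) : i != j -> mu j - mu i != 0.
  move=> ij; rewrite subr_eq0.
  case: (ltngtP i j) => [lt|lt|/val_inj eij]; last by rewrite eij eqxx in ij.
    by rewrite eq_sym; apply: mu_lt => //; rewrite -ltnS.
  by apply: mu_lt => //; rewrite -ltnS.
have step (s : seq 'I_k.+1) :
    W (\sum_(j < k.+1) ((\prod_(i <- s) (mu j - mu i)) * c j) *: mono k j).
  elim: s => [|i s IH].
    by under eq_bigr do rewrite big_nil mul1r.
  have := WD (- mu i) _ _ IH (Wi (su2_mk e)^-1%g _ IH).
  rewrite Vact_sum scaler_sumr -big_split /=; congr W; apply: eq_bigr => j _.
  rewrite -[Vact _ _]/(_ *: Vact (su2_mk e)^-1%g (mono k j)) muE !scalerA -scalerDl.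
  by rewrite big_cons; congr (_ *: _); ring.
have := step (enum (predC1 j0)); rewrite (bigD1 j0) //= [X in _ + X]big1 ?addr0; last first.
  move=> j hj; rewrite (_ : \prod_(i <- _) _ = 0) ?mul0r ?scale0r //.
  apply/eqP; rewrite prodf_seq_eq0; apply/hasP; exists j.
    by rewrite mem_enum.
  by rewrite subrr eqxx.
set P := \prod_(i <- _) _; have P0 : P != 0.
  rewrite prodf_seq_neq0; apply/allP => i; rewrite mem_enum /= => hi.
  exact: muI.
by move/(WZ P^-1); rewrite scalerA mulrA mulVf // mul1r.
Qed.

Lemma mono_neq0 k j : mono k j <> 0.
Proof.
move=> /(congr1 (fun p : fn => p (const_mx 1))).
by rewrite /mono !mxE !expr1n mulr1 => /eqP; rewrite oner_eq0.
Qed.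

Lemma Virr_coef0 k (c : 'I_k.+1 -> C) :
  \sum_(j < k.+1) c j *: mono k j = 0 -> forall j, c j = 0.
Proof.
move=> c0 j.
have S0 : is_subspace [set (0 : fn)].
  by split=> // a u v -> ->; rewrite scaler0 addr0.
have I0 : invariant_under (@Vact R) [set (0 : fn)] by move=> g u ->.
have /eqP := Virr_isolate S0 I0 c0 j.
rewrite scaler_eq0 => /orP [/eqP //|/eqP].
by move/mono_neq0.
Qed.

Lemma Virr_dim k : has_dim k.+1 (@Virr R k).
Proof.
exists (fun j => mono k j); split.
- by move=> c _; apply/VirrP; exists (fun j => c 0 j).
- move=> c d _ _ /eqP; rewrite -subr_eq0 -sumrB => /eqP h.
  apply/rowP => j; apply/eqP; rewrite -subr_eq0; apply/eqP.
  apply: (@Virr_coef0 k (fun j => c 0 j - d 0 j)).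
  by rewrite -[RHS]h; apply: eq_bigr => i _; rewrite scalerBl.
- move=> p /VirrP [c ->]; exists (\row_j c j) => //.
  by apply: eq_bigr => j _; rewrite mxE.
Qed.

Lemma binom_mono k (a b : C) :
  (fun z : 'cV[C]_2 => (a * z 0 0 + b * z 1 0) ^+ k) =
  \sum_(j < k.+1) (a ^+ j * b ^+ (k - j) * 'C(k, j)%:R) *: mono k j.
Proof.
apply/funext => z; rewrite fct_sumE addrC exprDn.
apply: eq_bigr => j _; rewrite scalefE /mono.
set u := z 0 0; set v := z 1 0.
rewrite (exprMn (k - j) b v) (exprMn j a u) -[LHS]mulr_natr.
move: (a ^+ j) (b ^+ (k - j)) (u ^+ j) (v ^+ (k - j)) ('C(k, j)%:R) => *.
ring.
Qed.

Lemma Virr_irreducible k : irreducible_rep (@Vact R) (@Virr R k).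
Proof.
split; [by split; [exact: Virr0|exact: VirrD]|exact: Virr_invariant| |].
  move=> h; have : [set (0 : fn)] (mono k 0) by rewrite -h; exact: Virr_mono.
  exact: mono_neq0.
move=> W Ws Wi WV; have [W0 WD] := Ws.
have [h|/existsNP [p /not_implyP [Wp p0]]] :=
  pselect (forall p, W p -> p = 0).
  by left; apply/seteqP; split=> [p /h //|_ ->].
right; apply/seteqP; split=> // q /VirrP [c ->].
have WZ a r : W r -> W (a *: r) by move=> hr; rewrite -[_ *: _]addr0; exact: WD.
have Wmono (d : 'I_k.+1 -> C) j : W (\sum_(j < k.+1) d j *: mono k j) ->
    d j != 0 -> W (mono k j).
  move=> /(Virr_isolate Ws Wi) /(_ j) /(WZ (d j)^-1).
  by rewrite scalerA => + dj; rewrite mulVf // scale1r.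
have [j Wj] : exists j : 'I_k.+1, W (mono k j).
  have /VirrP [d pE] := WV _ Wp.
  have [d0|/existsNP [j /eqP dj]] := pselect (forall j, d j = 0).
    by case: p0; rewrite pE big1 // => i _; rewrite d0 scale0r.
  by exists j; apply: (@Wmono d) => //; rewrite -pE.
have e : (3 / 5) ^+ 2 + 0 ^+ 2 + (4 / 5) ^+ 2 + 0 ^+ 2 = 1 :> R by field.
have Wk : W (mono k k).
  have := Wi (su2_mk e)^-1%g _ Wj; set r := Vact _ _ => Wr.
  have /VirrP [d rE] := WV _ Wr.
  have r1 : r (\col_i (i == 0)%:R) = d ord_max.
    rewrite rE fct_sumE (bigD1 ord_max) //= big1 ?addr0.
      by rewrite scalefE /mono !mxE /= expr1n subnn expr0 !mulr1.
    move=> i hi; rewrite scalefE /mono !mxE /= expr0n.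
    rewrite (_ : (k - i == 0)%N = false) ?mulr0 //.
    apply/negbTE; rewrite subn_eq0 -ltnNge.
    by move: (ltn_ord i) hi; rewrite -val_eqE /=; lia.
  have : d ord_max != 0.
    rewrite -r1 /r Vact_mk !mxE /= !mulr1 !mulr0 !addr0.
    by rewrite mulf_neq0 // expf_neq0 // eq_complex /= negb_and;
       apply/orP; left; rewrite ?oppr_eq0 mulf_neq0 ?invr_eq0 ?pnatr_eq0.
  by move=> dk; apply: (@Wmono d ord_max) => //; rewrite -rE.
have Wall i : W (mono k (i : 'I_k.+1)).
  have := Wi (su2_mk e)^-1%g _ Wk.
  rewrite Vact_mk subnn.
  under eq_fun do rewrite expr0 mulr1.
  rewrite binom_mono.
  move=> h; apply: Wmono h _.
  have ik : (i <= k)%N by rewrite -ltnS.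
  have nz (x : R) : x != 0 -> x +i* 0 != 0.
    by move=> x0; rewrite eq_complex /= negb_and x0.
  have h5 n : (n.+1%:R / 5 : R) != 0.
    by rewrite mulf_neq0 ?invr_eq0 ?pnatr_eq0.
  apply: mulf_neq0; last by rewrite pnatr_eq0 -lt0n bin_gt0.
  by apply: mulf_neq0; apply: expf_neq0; apply: nz; exact: h5.
elim/big_ind: _ => // [u v hu hv|i _]; last exact/WZ.
by rewrite -[u]scale1r; exact: WD.
Qed.

End Irreducibility.


Definition lam (R : realType) (l j : nat) : R[i] :=
  (4 * (l + j + 1)%:R ^+ 2 - 3 * (2 * l + 1)%:R ^+ 2 - 1) / 8.

(* Main.v *)
From HB Require Import structures.
Require Import Defs.
From mathcomp Require Import all_boot all_order all_algebra.
From mathcomp Require Import complex ring lra zify.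
From mathcomp Require Import all_classical all_reals all_analysis.
Set Implicit Arguments.
Unset Strict Implicit.
Unset Printing Implicit Defensive.
Import Order.TTheory GRing.Theory Num.Theory.
Import numFieldNormedType.Exports.
Local Open Scope classical_set_scope.
Local Open Scope ring_scope.

(** The line bundle [E_l] has fibre spanned by a Hermite function [h_l], so a
    section is [c h_l] for a smooth function [c] on SU(2), and equivariance
    under the torus says that [c] has weight [-n], where [n = 2l+1]
    ([Gamma_spi]).  Differentiation along the two root vectors of sl(2) raises
    and lowers weights; write [rz] and [lw] for it.  Because [sigma] shifts the
    index of Hermite functions ([sigma_Zvec], [sigma_Zbar]), both Dolbeault
    operators become scalar: up to a phase of the frame, which cancels in [P],
    [D (c h_l)] is a multiple of [(rz c) h_(l-1)] and [Dbar (c h_l)] one of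
    [(lw c) h_(l+1)].  The commutation relation of sl(2) then gives
    [P (c h_l) = (rz lw c - l n c) h_l / 2] ([Pop_weight]), and the theorem is a
    statement on [rz lw] acting on functions of weight [-n]: its spectrum is
    [{ j (j+n+1) }], which is what [lam] becomes ([lam_rho]), and the
    eigenspaces are the binary forms of degree [m = n+2j].

    Eigenfunctions.  On SU(2), which is compact, [|c|^2] has a maximum, and
    there the second derivatives [L_j^2 + L_k^2 = -2 (rz lw + lw rz)] are
    nonpositive.  Hence an eigenfunction of [rz lw] vanishes when its weight is
    too large compared to its eigenvalue ([max_principle]).  Lowering an
    eigenfunction of weight [-n] and eigenvalue [rho] changes the eigenvalue to
    [rho - k (k+n+1)] after [k] steps, so the principle applies for large [k];
    as raising undoes lowering up to these factors, the eigenfunction is [0]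
    unless some factor vanishes ([weight_eigen_eq0]).  If [rho = j (j+n+1)],
    the [j]-th lowering is killed by the next one: it is a lowest weight
    function [v] of weight [-m].  Contracting the string [rz^k v] with suitable
    powers of matrix entries gives a function killed by all of sl(2), hence
    constant, and comparing its values at [g] and at [1] shows that [v g] is a
    binary form in the second column of [g] ([lowest_form]).  So
    [p |-> rz^j (p o col1)] maps the forms of degree [m] onto the eigenspace
    ([eigen_coord_surj]); it commutes with left translations, and it is
    injective since its kernel is an invariant subspace of an irreducible
    representation ([eigen_coord_inj]).

    No other spectrum.  If [rho] is not of the form [j (j+n+1)], the operator
    [rz lw - rho] must be shown to be onto ([rz_lw_surj]).  On weight [-n] it
    is, up to a factor, [Delta - 1 + nu^2] for the Laplace operator [Delta] of
    the 3-sphere and [nu^2 = (n+1)^2 + 4 rho] ([Lap_weight]), and this has an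
    explicit resolvent.  Let [M] be the integral of [h |-> f (h g)] over
    the sphere of radius [theta] around [1]; the angular part of [Delta]
    integrates to zero, so [w = sin theta M] satisfies [w'' + w = sin theta
    M_(Delta f)] ([Mean_Lap], [spherical_ode]).  Integrating [w] against a
    function [k] with [k'' + nu^2 k = 0] over [[0, pi]] therefore produces
    [u] such that [(Delta - 1 + nu^2) u] is a combination of [f g] and
    [f (-g) = - f g], namely [4 pi (k pi - k 0) f] ([Avg_resolvent]).  The
    choice [k = exp (i nu theta)] works if [exp (i nu pi) <> 1]; otherwise the
    average with this [k] is an eigenfunction with eigenvalue [rho], thus [0],
    and [k = theta exp (i nu theta)] works.  That [u] is smooth, and that
    averaging commutes with left-invariant derivatives, is differentiation
    under the integral sign ([Avg_Lie]). *)

(** * Directional derivatives and the chain rule *)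

Section Calculus.
Variable R : realType.

Lemma is_derive1P (W : normedModType R) (f : R -> W) (t : R) (l : W) :
  is_derive t (1 : R) f l <-> h^-1 *: (f (t + h) - f t) @[h --> 0^'] --> l.
Proof.
have E : (fun h => h^-1 *: ((f \o shift t) (h *: 1) - f t)) =
         (fun h => h^-1 *: (f (t + h) - f t)).
  by apply/funext => h /=; rewrite [h *: 1]mulr1 [h + t]addrC.
split=> [[d <-]|c].
  by move: d; rewrite /derivable /derive E => d.
have c' : cvg (h^-1 *: (f (t + h) - f t) @[h --> 0^']) by apply/cvg_ex; exists l.
split; first by rewrite /derivable E.
by rewrite /derive E; apply: cvg_lim.
Qed.

Lemma is_derive_affine (a b t : R) :
  is_derive t (1 : R) (fun r => a + r * b) b.
Proof.
apply/is_derive1P; apply: cvg_near_cst; near=> h.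
rewrite opprD addrACA subrr add0r -mulrBl addrAC subrr add0r.
rewrite [LHS]mulrA mulVf ?mul1r //; near: h; exact: nbhs_dnbhs_neq.
Unshelve. all: by end_near. Qed.

Lemma derivable_line (V W : normedModType R) (f : V -> W) (y e : V) (r : R) :
  derivable f (y + r *: e) e ->
  is_derive r 1 (fun s => f (y + s *: e)) ('D_e f (y + r *: e)).
Proof.
move=> d; apply/is_derive1P.
have -> : (fun h => h^-1 *: (f (y + (r + h) *: e) - f (y + r *: e))) =
  (fun h => h^-1 *: ((f \o shift (y + r *: e)) (h *: e) - f (y + r *: e))).
  apply/funext => h /=; congr (_ *: (f _ - _)).
  by rewrite scalerDl addrA addrC.
exact: d.
Qed.

(** Increments of either sign are allowed, so that difference quotients need
    no case distinction. *)
Lemma MVT_abs (f df : R -> R) (s : R) :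
  (forall r : R, `|r| <= `|s| -> is_derive r (1 : R) f (df r)) ->
  exists2 xi, `|xi| <= `|s| & f s - f 0 = s * df xi.
Proof.
move=> h.
have ctn (r : R) : `|r| <= `|s| -> {for r, continuous f}.
  move=> /h hr; apply: differentiable_continuous.
  by apply/derivable1_diffP.
have [s0|s0] := leP 0 s.
- have B r : r \in `[0, s] -> `|r| <= `|s|.
    by rewrite in_itv /= => /andP[r0 rs]; rewrite !ger0_norm.
  have [| |c cI E] := @MVT_segment R f df 0 s s0.
  + by move=> x xI; apply/h/B; exact: subset_itv_oo_cc.
  + by apply: continuous_in_subspaceT => x; rewrite inE => xI; apply/ctn/B.
  by exists c; [exact: B|rewrite E subr0 mulrC].
- have B r : r \in `[s, 0] -> `|r| <= `|s|.
    rewrite in_itv /= => /andP[r0 rs]; rewrite !ler0_norm ?(ltW s0) //.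
    by rewrite lerN2.
  have [| |c cI E] := @MVT_segment R f df s 0 (ltW s0).
  + by move=> x xI; apply/h/B; exact: subset_itv_oo_cc.
  + by apply: continuous_in_subspaceT => x; rewrite inE => xI; apply/ctn/B.
  exists c; first exact: B.
  by rewrite -opprB E sub0r mulrN opprK mulrC.
Qed.

(** Extending the difference quotient by the derivative makes it jointly
    continuous in the base point and the increment; all differentiations
    under a limit below rest on this. *)
Definition slope (V : normedModType R) (f : V -> R) (e : V) (z : V * R) : R :=
  if z.2 == 0 then 'D_e f z.1 else z.2^-1 * (f (z.1 + z.2 *: e) - f z.1).

Lemma slope_continuous (V : normedModType R) (f : V -> R) (e x : V) :
  (\forall y \near x, derivable f y e) -> {for x, continuous ('D_e f)} ->
  {for (x, 0), continuous (slope f e)}.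
Proof.
move=> dn Dc.
have E0 : slope f e (x, 0) = 'D_e f x by rewrite /slope /= eqxx.
rewrite /prop_for /continuous_at; set L := slope _ _ _; have -> : L = 'D_e f x by exact: E0.
apply/cvgrPdist_lt => eps eps0.
have : \forall y \near x, derivable f y e /\ `|'D_e f x - 'D_e f y| < eps.
  near=> y; split; first by near: y.
  by near: y; move/cvgrPdist_lt: Dc => /(_ _ eps0).
move=> /nbhs_ballP[r /= r0 hr].
have : \forall z \near ((x, 0) : V * R), ball x (r / 2) z.1 /\ `|z.2| * `|e| < r / 2.
  near=> z; split.
    near: z; have : (fst : V * R -> V) z @[z --> ((x, 0) : V * R)] --> x by exact: cvg_fst.
    by apply; apply: nbhsx_ballx; rewrite divr_gt0.
  near: z.
  have c : (`|z.2| * `|e|) @[z --> ((x, 0) : V * R)] --> (`|0 : R| * `|e|).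
    apply: cvgM; last exact: cvg_cst.
    by apply: cvg_norm; exact: cvg_snd.
  move/cvgrPdist_lt : c => /(_ _ (divr_gt0 r0 (ltr0Sn _ 1))).
  apply: filterS => z; rewrite normr0 mul0r sub0r normrN ger0_norm ?mulr_ge0 //.
apply: filterS => -[y s] /= [By Bs].
rewrite /slope /=.
have inb xi : `|xi| <= `|s| -> ball x r (y + xi *: e).
  move=> xis; rewrite -ball_normE /= opprD addrA.
  apply: le_lt_trans (ler_normB _ _) _.
  rewrite [r]splitr; apply: ltrD; first by move: By; rewrite -ball_normE.
  rewrite normrZ; apply: le_lt_trans Bs.
  by rewrite ler_wpM2r.
case: eqP => [s0|/eqP s0].
  have := inb 0; rewrite scale0r addr0 normr0 => /(_ (normr_ge0 _)).
  by move=> /hr[].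
have [|xi xis E] := @MVT_abs (fun t => f (y + t *: e)) (fun t => 'D_e f (y + t *: e)) s.
  by move=> t ts; apply: derivable_line; have [] := hr _ (inb _ ts).
move: E; rewrite scale0r addr0 => ->.
rewrite mulrA mulVf // mul1r.
by have [] := hr _ (inb _ xis).
Unshelve. all: by end_near. Qed.

Lemma cvg_scaled (s : R -> R) (sg : R) : h^-1 * s h @[h --> 0^'] --> sg ->
  s h @[h --> 0^'] --> (0 : R).
Proof.
move=> c.
have ci : h @[h --> (0 : R)^'] --> (0 : R) by exact: nbhs_dnbhs.
have E : h * (h^-1 * s h) @[h --> (0 : R)^'] --> (0 : R).
  by rewrite -[X in _ --> X](mul0r sg); exact: (cvgM ci c).
apply: cvg_trans E; apply: near_eq_cvg.
near=> h; rewrite mulrA mulfV ?mul1r //.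
by near: h; exact: nbhs_dnbhs_neq.
Unshelve. all: by end_near. Qed.

Lemma cvg_increment (V : normedModType R) (f : V -> R) (x e : V)
    (p : R -> V) (s : R -> R) (sg : R) :
  (\forall y \near x, derivable f y e) -> {for x, continuous ('D_e f)} ->
  p h @[h --> 0^'] --> x -> h^-1 * s h @[h --> 0^'] --> sg ->
  h^-1 * (f (p h + s h *: e) - f (p h)) @[h --> 0^'] --> sg * 'D_e f x.
Proof.
move=> dn Dc cp cs; have s0 := cvg_scaled cs.
have c2 : slope f e (p h, s h) @[h --> 0^'] --> slope f e (x, 0).
  have := slope_continuous dn Dc; rewrite /prop_for /continuous_at => sc.
  by apply: (cvg_comp2 (h := fun a b => slope f e (a, b)) cp s0); apply: cvg_trans sc;
    apply: near_eq_cvg; near=> z; rewrite -surjective_pairing.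
rewrite [X in _ --> X](_ : _ = 'D_e f x) in c2; last by rewrite /slope /= eqxx.
apply: (cvg_trans _ (cvgM cs c2)).
apply: near_eq_cvg; near=> h.
rewrite /slope /=; case: eqP => [->|/eqP sh].
  by rewrite scale0r addr0 subrr !mulr0 mul0r.
by rewrite mulrA -(mulrA h^-1) mulfV // mulr1.
Unshelve. all: by end_near. Qed.

(** Moving one coordinate at a time: each step contributes its own
    directional derivative, since the base points of all the steps converge
    to [x] and the slopes are jointly continuous. *)
Lemma cvg_increments (V : normedModType R) (f : V -> R) (x : V) (I : Type)
    (e : I -> V) (s : I -> R -> R) (sg : I -> R) (r : seq I) (p : R -> V) :
  (forall i, \forall y \near x, derivable f y (e i)) ->
  (forall i, {for x, continuous ('D_(e i) f)}) ->
  (forall i, h^-1 * s i h @[h --> 0^'] --> sg i) ->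
  p h @[h --> 0^'] --> x ->
  h^-1 * (f (p h + \sum_(i <- r) s i h *: e i) - f (p h)) @[h --> 0^'] -->
  \sum_(i <- r) sg i * 'D_(e i) f x.
Proof.
move=> dn Dc cs; elim: r p => [|i r IH] p cp.
  rewrite big_nil; apply: cvg_near_cst; near=> h.
  by rewrite big_nil addr0 subrr mulr0.
rewrite big_cons.
have cp' : p h + s i h *: e i @[h --> 0^'] --> x.
  rewrite -[x]addr0 -[X in x + X](scale0r (e i)).
  by apply: cvgD => //; apply: cvgZl; exact: cvg_scaled (cs i).
apply: cvg_trans (cvgD (cvg_increment (dn i) (Dc i) cp (cs i)) (IH _ cp')).
apply: near_eq_cvg; near=> h.
rewrite /= big_cons -mulrDr; congr (_ * _).
by rewrite [p h + _]addrA addrfctE; ring.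
Unshelve. all: by end_near. Qed.

Lemma derivable_line0 (V : normedModType R) (f : V -> R) (x v : V) (l : R) :
  is_derive (0 : R) (1 : R) (fun t => f (x + t *: v)) l -> is_derive x v f l.
Proof.
move=> /is_derive1P d.
have h : h^-1 *: ((f \o shift x) (h *: v) - f x) @[h --> (0 : R)^'] --> l.
  rewrite (_ : (fun h => _) = (fun h => h^-1 *:
    ((fun t => f (x + t *: v)) (0 + h) - (fun t => f (x + t *: v)) 0))) //.
  by apply/funext => s /=; rewrite add0r [s *: v + x]addrC scale0r addr0.
split; first by apply/cvg_ex; exists l.
by apply: cvg_lim; first exact: Rhausdorff.
Qed.

End Calculus.

Section Coordinates.
Variables (R : realType) (V : normedModType R) (I : finType).
Variables (e : I -> V) (k : I -> V -> R).
Hypothesis kE : forall x, x = \sum_i k i x *: e i.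

(** Continuity of the partial derivatives replaces differentiability of [f],
    a notion that [Cn_on] does not provide. *)
Lemma curve_chain (f : V -> R) (g : R -> V) (t : R) (d : I -> R) :
  (forall i, \forall y \near g t, derivable f y (e i)) ->
  (forall i, {for g t, continuous ('D_(e i) f)}) ->
  (forall i, is_derive t 1 (fun r => k i (g r)) (d i)) ->
  is_derive t 1 (f \o g) (\sum_i d i * 'D_(e i) f (g t)).
Proof.
move=> dn Dc dk; apply/is_derive1P.
pose s i h := k i (g (t + h)) - k i (g t).
have cs i : h^-1 * s i h @[h --> 0^'] --> d i by apply/is_derive1P.
apply: cvg_trans (cvg_increments (r := index_enum I) dn Dc cs (cvg_cst (g t))).
apply: near_eq_cvg; near=> h; rewrite /=.
rewrite /= /s; congr (_ * (f _ - _)).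
under eq_bigr do rewrite scalerBl.
by rewrite sumrB -!kE addrC subrK.
Unshelve. all: by end_near. Qed.

Hypothesis kL : forall i x y (a : R), k i (x + a *: y) = k i x + a * k i y.

Lemma derive_coord (f : V -> R) (x v : V) :
  (forall i, \forall y \near x, derivable f y (e i)) ->
  (forall i, {for x, continuous ('D_(e i) f)}) ->
  'D_v f x = \sum_i k i v * 'D_(e i) f x.
Proof.
move=> dn Dc.
have d : is_derive (0 : R) (1 : R) (f \o (fun r => x + r *: v))
    (\sum_i k i v * 'D_(e i) f x).
  have E0 : x = x + 0 *: v by rewrite scale0r addr0.
  rewrite [in \sum_i _]E0; apply: curve_chain; rewrite -?E0 // => i.
  have -> : (fun r => k i (x + r *: v)) = (fun r => k i x + r * k i v).
    by apply/funext => r; rewrite kL.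
  exact: is_derive_affine.
by have [_ ->] := derivable_line0 d.
Qed.

End Coordinates.

(** * Integrals depending on a parameter *)

Section Integral.
Variable R : realType.

Definition rint (a b : R) (f : R -> R) : R :=
  \int[@lebesgue_measure R]_(x in `[a, b]) f x.

Let integrable_continuous a b (f : R -> R) : continuous f ->
  (@lebesgue_measure R).-integrable `[a, b] (EFin \o f).
Proof.
move=> cf; apply: continuous_compact_integrable; first exact: segment_compact.
exact: continuous_subspaceT.
Qed.

Lemma rintD a b (f g : R -> R) : continuous f -> continuous g ->
  rint a b (fun x => f x + g x) = rint a b f + rint a b g.
Proof. by move=> cf cg; apply: RintegralD => //; exact: integrable_continuous. Qed.

Lemma rintB a b (f g : R -> R) : continuous f -> continuous g ->
  rint a b (fun x => f x - g x) = rint a b f - rint a b g.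
Proof. by move=> cf cg; apply: RintegralB => //; exact: integrable_continuous. Qed.

Lemma rintZ a b r (f : R -> R) : continuous f ->
  rint a b (fun x => r * f x) = r * rint a b f.
Proof. by move=> cf; apply: RintegralZl => //; exact: integrable_continuous. Qed.

Lemma rint_cst a b r : a <= b -> rint a b (fun _ => r) = (b - a) * r.
Proof.
move=> ab; rewrite /rint Rintegral_cst //= lebesgue_measure_itv /= lte_fin.
case: ltP => h /=; first by rewrite mulrC.
by rewrite (le_anti (introT andP (conj ab h))) subrr mulr0 mul0r.
Qed.

Lemma rint_norm_le a b (f : R -> R) M : a <= b -> continuous f ->
  (forall x, x \in `[a, b] -> `|f x| <= M) -> `|rint a b f| <= (b - a) * M.
Proof.
move=> ab cf h; have cn : continuous (fun x => `|f x|).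
  by move=> x; apply: cvg_norm; exact: cf.
have h1 : `|rint a b f| <= rint a b (fun x => `|f x|).
  by apply: le_normr_Rintegral => //; exact: integrable_continuous.
apply: (le_trans h1).
rewrite -rint_cst //; apply: le_Rintegral => //.
- exact: integrable_continuous.
- by apply: integrable_continuous => x; exact: cvg_cst.
Qed.

Lemma rint_FTC a b (F f : R -> R) : a <= b -> continuous f ->
  (forall x : R, is_derive x (1 : R) F (f x)) -> rint a b f = F b - F a.
Proof.
rewrite le_eqVlt => /predU1P[-> _ _|ab cf dF].
  by rewrite /rint set_itv1 Rintegral_set1 subrr.
have cF : continuous F.
  by move=> x; apply: differentiable_continuous; apply/derivable1_diffP.
rewrite /rint /Rintegral (@continuous_FTC2 _ f F) //.
- exact: continuous_subspaceT.
- split; first by move=> x _; have [] := dF x.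
  + by apply: cvg_at_right_filter; exact: cF.
  + by apply: cvg_at_left_filter; exact: cF.
- by move=> x _; rewrite derive1E; have [] := dF x.
Qed.

(** Compactness of [[a, b]] makes the continuity in [t] uniform in the
    variable of integration. *)
Lemma rint_continuous (T : topologicalType) (psi : T * R -> R) (t0 : T) a b :
  a <= b ->
  (\forall t \near t0, continuous (fun s => psi (t, s))) ->
  (forall s, {for (t0, s), continuous psi}) ->
  {for t0, continuous (fun t => rint a b (fun s => psi (t, s)))}.
Proof.
move=> ab cn cj; rewrite /prop_for /continuous_at.
apply/cvgrPdist_le => eps eps0.
have ba1 : 0 < b - a + 1 by rewrite ltr_wpDl ?subr_ge0.
(* the summand 1 covers the case a = b *)
pose d := eps / (b - a + 1); have d0 : 0 < d by rewrite divr_gt0.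
have ct0 : continuous (fun s => psi (t0, s)) by exact: nbhs_singleton cn.
have unif : \forall t \near t0, `[a, b] `<=` [set s | `|psi (t0, s) - psi (t, s)| <= d].
  have /compact_near_coveringP := @segment_compact R a b.
  apply => s _.
  have c1 : \forall z \near (t0, s), `|psi (t0, s) - psi z| < d / 2.
    by move/cvgrPdist_lt: (cj s); apply; rewrite divr_gt0.
  have c2 : \forall s' \near s, `|psi (t0, s) - psi (t0, s')| < d / 2.
    by move/cvgrPdist_lt: (ct0 s); apply; rewrite divr_gt0.
  have [[U V] /= [Ut Vs] UV] := c1.
  near=> s' t; rewrite /=.
  have h1 : `|psi (t0, s) - psi (t, s')| < d / 2.
    by apply: (UV (t, s')); split => /=; [near: t|near: s'].
  have h2 : `|psi (t0, s) - psi (t0, s')| < d / 2 by near: s'.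
  rewrite (_ : _ - _ = (psi (t0, s) - psi (t, s')) - (psi (t0, s) - psi (t0, s'))); last by ring.
  by rewrite [d]splitr ltW // (le_lt_trans (ler_normB _ _)) // ltrD.
near=> t.
rewrite -rintB //; last by near: t.
apply: le_trans (@rint_norm_le _ _ _ d ab _ _) _.
- move=> s; apply: cvgB; first exact: ct0.
  have : continuous (fun s => psi (t, s)) by near: t.
  exact.
- by move=> s sI; have : `[a, b] `<=` [set s | `|psi (t0, s) - psi (t, s)| <= d];
    [near: t|exact].
- rewrite /d mulrCA ler_piMr ?(ltW eps0) //.
  by rewrite ler_pdivrMr // mul1r lerDl.
Unshelve. all: by end_near. Qed.

(** Differentiation under the integral sign is continuity, at increment [0],
    of the integral of the slopes. *)
Lemma rint_derive (V : normedModType R) (psi : V * R -> R) (x v : V) a b :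
  a <= b ->
  (\forall y \near x, forall s, derivable psi (y, s) (v, 0)) ->
  (\forall y \near x, forall s, {for (y, s), continuous psi}) ->
  (forall s, {for (x, s), continuous ('D_(v, 0) psi)}) ->
  is_derive x v (fun y => rint a b (fun s => psi (y, s)))
    (rint a b (fun s => 'D_(v, 0) psi (x, s))).
Proof.
move=> ab dn cn cD.
pose q (z : R * R) := slope psi (v, 0) ((x, z.2), z.1).
have cont_at y : (forall s, {for (y, s), continuous psi}) ->
    continuous (fun s => psi (y, s)).
  move=> h s; apply: (@cvg_comp _ _ _ (fun s => (y, s)) psi _ (nbhs (y, s))); last exact: h.
  apply: (@cvg_pair _ _ _ _ (nbhs y) (nbhs s)); [exact: cvg_cst|exact: cvg_id].
have cvgx : x + h *: v @[h --> (0 : R)] --> x.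
  rewrite -[X in _ --> X]addr0 -[X in x + X](scale0r v).
  by apply: cvgD; [exact: cvg_cst|apply: cvgZl; exact: cvg_id].
have qc : {for (0 : R), continuous (fun h => rint a b (fun s => q (h, s)))}.
  apply: rint_continuous => //.
    near=> h; rewrite /q /slope /=; case: (h == 0).
      move=> s; apply: (@cvg_comp _ _ _ (fun s => (x, s)) ('D_(v, 0) psi) _ (nbhs (x, s))).
        apply: (@cvg_pair _ _ _ _ (nbhs x) (nbhs s)); [exact: cvg_cst|exact: cvg_id].
      exact: cD.
    move=> s; apply: cvgM; first exact: cvg_cst.
    have E (s' : R) : psi ((x, s') + h *: (v, 0)) = psi (x + h *: v, s').
      by congr (psi (_, _)) => /=; rewrite scaler0 addr0.
    apply: cvgB; last by apply: cont_at; exact: nbhs_singleton cn.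
    under eq_fun do rewrite E.
    rewrite E; apply: cont_at; near: h.
    exact: (cvgx _ cn).
  move=> s; rewrite /q.
  apply: (@cvg_comp _ _ _ (fun z : R * R => ((x, z.2), z.1)) (slope psi (v, 0)) _ (nbhs ((x, s), 0))).
    apply: (@cvg_pair _ _ _ _ (nbhs (x, s)) (nbhs (0 : R))); last exact: cvg_fst.
    by apply: (@cvg_pair _ _ _ _ (nbhs x) (nbhs s)); [exact: cvg_cst|exact: cvg_snd].
  apply: slope_continuous; last exact: cD.
  have : \forall z \near (x, s), forall s0, derivable psi (z.1, s0) (v, 0).
    have c : z.1 @[z --> (x, s)] --> x by exact: cvg_fst.
    exact: c dn.
  by apply: filterS => -[y s'] /= h; exact: h.
have q0 : rint a b (fun s => q (0, s)) = rint a b (fun s => 'D_(v, 0) psi (x, s)).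
  by congr rint; apply/funext => s; rewrite /q /slope /= eqxx.
have main : h^-1 *: (((fun y => rint a b (fun s => psi (y, s))) \o shift x) (h *: v) -
    rint a b (fun s => psi (x, s))) @[h --> (0 : R)^'] -->
    rint a b (fun s => 'D_(v, 0) psi (x, s)).
  rewrite -q0.
  have c0 : rint a b (fun s => q (h, s)) @[h --> (0 : R)^'] --> rint a b (fun s => q (0, s)).
    exact: cvg_trans (cvg_app _ (@nbhs_dnbhs _ (0 : R))) qc.
  apply: cvg_trans c0; apply: near_eq_cvg; near=> h.
  have h0 : h != 0 by near: h; exact: nbhs_dnbhs_neq.
  rewrite /= -rintB; last first.
  - by apply: cont_at; exact: nbhs_singleton cn.
  - apply: cont_at; rewrite addrC; near: h; apply: nbhs_dnbhs.
    exact: (cvgx _ cn).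
  rewrite -[RHS]rintZ; last first.
    move=> s; apply: cvgB; last by apply: cont_at; exact: nbhs_singleton cn.
    apply: cont_at; rewrite addrC; near: h; apply: nbhs_dnbhs.
    exact: (cvgx _ cn).
  congr rint; apply/funext => s; rewrite /q /slope /= (negbTE h0).
  by congr (_ * (psi (_, _) - _)); rewrite /= ?scaler0 ?addr0 // addrC.
split; first by apply/cvg_ex; eexists; exact: main.
by apply: cvg_lim; first exact: Rhausdorff.
Unshelve. all: by end_near. Qed.

End Integral.

(** * Operations on functions of class C^n *)

Section SmoothOn.
Variables (R : realType) (V : normedModType R).
Implicit Types (A B : set V) (f g : V -> R).

Lemma Cn_on_cont n A f x : Cn_on A n f -> A x -> {for x, continuous f}.
Proof. by case: n => [|n] [h _]; exact: h. Qed.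

Lemma Cn_on_ext n A f g : open A -> (forall x, A x -> f x = g x) ->
  Cn_on A n f -> Cn_on A n g.
Proof.
move=> oA; elim: n f g => [|n IH] f g fg [cf h].
  split=> // x Ax; apply: (cvg_trans _ (cvg_trans (cf _ Ax) _)).
    apply: near_eq_cvg; near=> y; apply: fg; near: y.
    exact: open_nbhs_nbhs.
  by rewrite fg.
have nfg x : A x -> \forall y \near x, f y = g y.
  move=> Ax; near=> y; apply: fg; near: y; exact: open_nbhs_nbhs.
split=> [x Ax|v].
  rewrite /prop_for /continuous_at -fg //.
  by apply: cvg_trans (cf _ Ax); apply: near_eq_cvg; exact: nfg.
have [dv Dv] := h v; split=> [x Ax|].
  exact: near_eq_derivable (nfg _ Ax) (dv _ Ax).
apply: IH Dv => x Ax; apply: near_eq_derive; exact: nfg.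
Unshelve. all: by end_near. Qed.

Lemma Cn_on_sub n A B f : B `<=` A -> Cn_on A n f -> Cn_on B n f.
Proof.
move=> BA; elim: n f => [|n IH] f [cf h]; split=> //.
- by move=> x /BA; exact: cf.
- by move=> x /BA; exact: cf.
- move=> v; have [dv Dv] := h v; split; last exact: IH.
  by move=> x /BA; exact: dv.
Qed.

Lemma Cn_onW n A f : Cn_on A n.+1 f -> Cn_on A n f.
Proof.
elim: n f => [|n IH] f [cf h]; split=> //.
by move=> v; have [dv Dv] := h v; split=> //; exact: IH.
Qed.

Lemma Cn_on_cst n A (r : R) : Cn_on A n (fun=> r).
Proof.
elim: n r => [|n IH] r; (split; first by move=> x _; exact: cvg_cst) => //.
move=> v; split=> [x _|]; first exact: derivable_cst.
rewrite (_ : 'D_v _ = (fun=> 0)) //.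
by apply/funext => x; rewrite derive_cst.
Qed.

Lemma Cn_onD n A f g : open A -> Cn_on A n f -> Cn_on A n g ->
  Cn_on A n (fun x => f x + g x).
Proof.
move=> oA; elim: n f g => [|n IH] f g [cf hf] [cg hg].
  by split=> // x Ax; apply: cvgD; [exact: cf|exact: cg].
split=> [x Ax|v]; first by apply: cvgD; [exact: cf|exact: cg].
have [df Df] := hf v; have [dg Dg] := hg v; split=> [x Ax|].
  by apply: derivableD; [exact: df|exact: dg].
apply: Cn_on_ext (IH _ _ Df Dg) => // x Ax.
by rewrite [RHS]deriveD //; [exact: df|exact: dg].
Qed.

Lemma Cn_onM n A f g : open A -> Cn_on A n f -> Cn_on A n g ->
  Cn_on A n (fun x => f x * g x).
Proof.
move=> oA; elim: n f g => [|n IH] f g Hf Hg.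
  have [cf _] := Hf; have [cg _] := Hg.
  by split=> // x Ax; apply: cvgM; [exact: cf|exact: cg].
have [cf hf] := Hf; have [cg hg] := Hg.
split=> [x Ax|v]; first by apply: cvgM; [exact: cf|exact: cg].
have [df Df] := hf v; have [dg Dg] := hg v; split=> [x Ax|].
  by apply: derivableM; [exact: df|exact: dg].
have h := Cn_onD oA (IH _ _ (Cn_onW Hf) Dg) (IH _ _ (Cn_onW Hg) Df).
apply: Cn_on_ext h => // x Ax.
by rewrite [RHS]deriveM //; [exact: df|exact: dg].
Qed.

Lemma Cn_onN n A f : open A -> Cn_on A n f -> Cn_on A n (fun x => - f x).
Proof.
move=> oA cf; have := Cn_onM oA (Cn_on_cst n A (-1)) cf.
by under eq_fun do rewrite mulN1r.
Qed.

Lemma Cn_on_sum n A (I : Type) (r : seq I) (F : I -> V -> R) : open A ->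
  (forall i, Cn_on A n (F i)) -> Cn_on A n (fun x => \sum_(i <- r) F i x).
Proof.
move=> oA cF; elim: r => [|i r IH].
  by under eq_fun do rewrite big_nil; exact: Cn_on_cst.
by under eq_fun do rewrite big_cons; exact: Cn_onD.
Qed.

Lemma Cn_on_linear n A (f : V -> R) : continuous f ->
  (forall x v (a : R), f (x + a *: v) = f x + a * f v) -> Cn_on A n f.
Proof.
move=> cf fL; case: n => [|n]; (split; first by move=> x _; exact: cf) => //.
move=> v; have d x : is_derive x v f (f v).
  have h : h^-1 *: ((f \o shift x) (h *: v) - f x) @[h --> (0 : R)^'] --> f v.
    apply: cvg_near_cst; near=> h; rewrite /= [h *: v + x]addrC fL [f x + _]addrC addrK.
    rewrite [LHS]mulrA mulVf ?mul1r //; near: h; exact: nbhs_dnbhs_neq.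
  split; first by apply/cvg_ex; exists (f v).
  by apply: cvg_lim; first exact: Rhausdorff.
split=> [x _|]; first by have [] := d x.
rewrite (_ : 'D_v f = (fun=> f v)); first exact: Cn_on_cst.
by apply/funext => x; have [] := d x.
Unshelve. all: by end_near. Qed.

Lemma derive_line (f : V -> R) (x v : V) : derivable f x v ->
  is_derive (0 : R) (1 : R) (fun t => f (x + t *: v)) ('D_v f x).
Proof.
move=> d; have E0 : x + 0 *: v = x by rewrite scale0r addr0.
rewrite -[in 'D_v f x]E0; apply: derivable_line.
by rewrite E0.
Qed.

Lemma is_derive_continuous (phi : R -> R) (t l : R) :
  is_derive t (1 : R) phi l -> {for t, continuous phi}.
Proof.
by move=> [d _]; apply: differentiable_continuous; apply/derivable1_diffP.
Qed.

(** The family [phi] consists of a function and its successive derivatives,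
    so that the induction on [n] stays inside the family. *)
Lemma Cn_on_comp1 (phi : nat -> R -> R) m n A (p : V -> R) : open A ->
  (forall m t, is_derive (t : R) (1 : R) (phi m) (phi m.+1 t)) ->
  Cn_on A n p -> Cn_on A n (fun x => phi m (p x)).
Proof.
move=> oA dphi; elim: n m p => [|n IH] m p Hp; have [cp hp] := Hp.
  split=> // x Ax; apply: (@cvg_comp _ _ _ p (phi m) _ (nbhs (p x))); first exact: cp.
  exact: is_derive_continuous (dphi m (p x)).
split=> [x Ax|v].
  apply: (@cvg_comp _ _ _ p (phi m) _ (nbhs (p x))); first exact: cp.
  exact: is_derive_continuous (dphi m (p x)).
have [dp Dp] := hp v.
have d x : A x -> is_derive x v (fun x => phi m (p x)) (phi m.+1 (p x) * 'D_v p x).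
  move=> Ax; apply: derivable_line0.
  have dl := derive_line (dp _ Ax).
  apply: is_derive1_comp; rewrite scale0r addr0; exact: dphi.
split=> [x Ax|]; first by have [] := d x Ax.
apply: Cn_on_ext (Cn_onM oA (IH m.+1 _ (Cn_onW Hp)) Dp) => // x Ax.
by have [] := d x Ax.
Qed.

End SmoothOn.

Section Composition.
Variables (R : realType) (V W : normedModType R) (I : finType).
Variables (e : I -> W) (k : I -> W -> R).
Hypothesis kE : forall x, x = \sum_i k i x *: e i.

Lemma cont_coord (G : V -> W) x :
  (forall i, {for x, continuous (fun y => k i (G y))}) -> {for x, continuous G}.
Proof.
move=> h.
have -> : G = fun y => \sum_i k i (G y) *: e i by apply/funext => y; exact: kE.
apply: cvg_big => [|i _]; first exact: add_continuous.
by apply: cvgZl; exact: h.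
Qed.

(** By the chain rule, a directional derivative of [F \o G] is a sum of
    products of derivatives of coordinates of [G] with partial derivatives of
    [F] at [G], to which the induction hypothesis applies. *)
Lemma Cn_on_comp n (A : set V) (B : set W) (F : W -> R) (G : V -> W) :
  open A -> open B -> (forall x, A x -> B (G x)) ->
  (forall i, Cn_on A n (fun x => k i (G x))) -> Cn_on B n F ->
  Cn_on A n (F \o G).
Proof.
move=> oA oB AB; have cc m F0 x : (forall i, Cn_on A m (fun x => k i (G x))) ->
    Cn_on B m F0 -> A x -> {for x, continuous (F0 \o G)}.
  move=> cG HF Ax; apply: (@cvg_comp _ _ _ G F0 _ (nbhs (G x))).
    by apply: cont_coord => i; exact: Cn_on_cont (cG i) Ax.
  exact: Cn_on_cont HF (AB _ Ax).
elim: n F => [|n IH] F cG HF; first by split=> // x; exact: cc cG HF.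
split=> [x|v]; first exact: cc cG HF.
have d x : A x -> is_derive x v (F \o G)
    (\sum_i 'D_v (fun x => k i (G x)) x * 'D_(e i) F (G x)).
  move=> Ax; apply: derivable_line0.
  have E0 : G x = G (x + 0 *: v) by rewrite scale0r addr0.
  have nB : \forall y \near G x, B y by apply: open_nbhs_nbhs; split => //; exact: AB.
  have dn i : \forall y \near G x, derivable F y (e i).
    near=> y; have [_ /(_ (e i))[+ _]] := HF; apply; near: y; exact: nB.
  have Dc i : {for G x, continuous ('D_(e i) F)}.
    by have [_ /(_ (e i))[_ +]] := HF => /Cn_on_cont; apply; exact: AB.
  have dk i : derivable (fun x => k i (G x)) x v.
    by have [_ /(_ v)[+ _]] := cG i; exact.
  rewrite E0 in dn Dc; rewrite E0.
  exact: (curve_chain kE (g := fun r => G (x + r *: v)) dn Dc (fun i => derive_line (dk i))).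
split=> [x Ax|]; first by have [] := d x Ax.
apply: (@Cn_on_ext _ _ _ _ (fun x => \sum_i 'D_v (fun x => k i (G x)) x * 'D_(e i) F (G x))) => //.
  by move=> x Ax; have [] := d x Ax.
apply: Cn_on_sum => // i; apply: Cn_onM => //.
  by have [_ /(_ v)[]] := cG i.
apply: (IH ('D_(e i) F)); last by have [_ /(_ (e i))[]] := HF.
by move=> j; exact: Cn_onW.
Unshelve. all: by end_near. Qed.

End Composition.

Section ParamIntegral.
Variable R : realType.

Lemma is_derive_rint (V : normedModType R) (A : set V) (psi : V * R -> R) a b x v :
  open A -> a <= b -> Cn_on (A `*` setT) 1 psi -> A x ->
  is_derive x v (fun y => rint a b (fun s => psi (y, s)))
    (rint a b (fun s => 'D_(v, 0) psi (x, s))).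
Proof.
move=> oA ab Hpsi Ax; have nA : \forall y \near x, A y by exact: open_nbhs_nbhs.
have [_ /(_ (v, 0))[dpsi [cD _]]] := Hpsi.
apply: rint_derive => //.
- by near=> y => s; apply: dpsi; split=> //=; near: y.
- by near=> y => s; apply: (Cn_on_cont Hpsi); split=> //=; near: y.
- by move=> s; apply: cD.
Unshelve. all: by end_near. Qed.

Lemma Cn_on_rint n (V : normedModType R) (A : set V) (psi : V * R -> R) a b :
  open A -> a <= b -> Cn_on (A `*` setT) n psi ->
  Cn_on A n (fun x => rint a b (fun s => psi (x, s))).
Proof.
move=> oA ab; have cc m psi0 x : Cn_on (A `*` setT) m psi0 -> A x ->
    {for x, continuous (fun x => rint a b (fun s => psi0 (x, s)))}.
  move=> H0 Ax; apply: rint_continuous => //; last by move=> s; exact: (Cn_on_cont H0).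
  near=> y => s; apply: (@cvg_comp _ _ _ (fun s => (y, s)) psi0 _ (nbhs (y, s))).
    by apply: (@cvg_pair _ _ _ _ (nbhs y) (nbhs s)); [exact: cvg_cst|exact: cvg_id].
  apply: (Cn_on_cont H0); split=> //=; near: y; exact: open_nbhs_nbhs.
elim: n psi => [|n IH] psi Hpsi; first by split=> // x; exact: cc Hpsi.
split=> [x|v]; first exact: cc Hpsi.
have [_ /(_ (v, 0))[dpsi Dpsi]] := Hpsi.
have H1 : Cn_on (A `*` setT) 1 psi.
  by elim: n {IH Dpsi} psi Hpsi {dpsi} => // n IH psi Hpsi; apply: IH; exact: Cn_onW.
have d x : A x -> is_derive x v (fun y => rint a b (fun s => psi (y, s)))
    (rint a b (fun s => 'D_(v, 0) psi (x, s))).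
  by move=> Ax; exact: (is_derive_rint v oA ab H1 Ax).
split=> [x Ax|]; first by have [] := d x Ax.
apply: Cn_on_ext (IH _ Dpsi) => // x Ax.
by have [] := d x Ax.
Unshelve. all: by end_near. Qed.

End ParamIntegral.

Local Open Scope complex_scope.

(** * Symmetry of second derivatives; complex-valued functions *)

Section Clairaut.
Variables (R : realType) (V : normedModType R).

(** Two applications of the mean value theorem turn the second difference
    into the mixed derivative at a point that tends to [x]. *)
Lemma second_difference (A : set V) (f : V -> R) (x v w : V) :
  open A -> Cn_on A 2 f -> A x ->
  h^-1 * (h^-1 * (f (x + h *: v + h *: w) - f (x + h *: v)
     - (f (x + h *: w) - f x))) @[h --> (0 : R)^'] --> 'D_w ('D_v f) x.
Proof.
move=> oA Hf Ax; have [_ /(_ v)[dv Hv]] := Hf; have [_ /(_ w)[dw Hw]] := Hv.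
apply/cvgrPdist_lt => eps eps0.
have : \forall y \near x, A y /\ `|'D_w ('D_v f) x - 'D_w ('D_v f) y| < eps.
  near=> y; split; first by near: y; exact: open_nbhs_nbhs.
  by near: y; have [+ _] := Hw => /(_ _ Ax)/cvgrPdist_lt; exact.
move=> /nbhs_ballP[r /= r0 hr].
near=> h.
have h0 : h != 0 by near: h; exact: nbhs_dnbhs_neq.
have hs : `|h| * (`|v| + `|w|) < r.
  have : `|h| < r / (`|v| + `|w| + 1).
    by near: h; apply: dnbhs0_lt; rewrite divr_gt0 // ltr_wpDl ?addr_ge0.
  rewrite ltr_pdivlMr ?ltr_wpDl ?addr_ge0 //; apply: le_lt_trans.
  by rewrite ler_wpM2l // lerDl.
have inb (a b : R) : `|a| <= `|h| -> `|b| <= `|h| -> ball x r (x + a *: v + b *: w).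
  move=> ah bh; rewrite -ball_normE /= -addrA opprD addrA subrr add0r normrN.
  apply: le_lt_trans (ler_normD _ _) _; rewrite !normrZ.
  apply: le_lt_trans hs; rewrite mulrDr.
  by apply: lerD; rewrite ler_wpM2r.
pose phi a := f (x + a *: v + h *: w) - f (x + a *: v).
have zl : `|0 : R| <= `|h| by rewrite normr0.
have [|a ah Ea] := @MVT_abs R phi
    (fun a => 'D_v f (x + a *: v + h *: w) - 'D_v f (x + a *: v)) h.
  move=> a ah.
  have d1 : is_derive a (1 : R) (fun s => f (x + s *: v + h *: w))
      ('D_v f (x + a *: v + h *: w)).
    have -> : (fun s => f (x + s *: v + h *: w)) =
      (fun s => f (x + h *: w + s *: v)) by apply/funext => s; rewrite addrAC.
    rewrite addrAC; apply: derivable_line; rewrite addrAC.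
    by apply: dv; have [] := hr _ (inb a h ah (lexx _)).
  have d2 : is_derive a (1 : R) (fun s => f (x + s *: v)) ('D_v f (x + a *: v)).
    apply: derivable_line; apply: dv; have := hr _ (inb a 0 ah zl).
    by rewrite scale0r addr0 => -[].
  exact: is_deriveB.
have [|b bh Eb] := @MVT_abs R (fun b => 'D_v f (x + a *: v + b *: w))
    (fun b => 'D_w ('D_v f) (x + a *: v + b *: w)) h.
  move=> b bh; apply: derivable_line; apply: dw.
  by have [] := hr _ (inb a b ah bh).
move: Ea; rewrite /phi scale0r addr0 => ->.
move: Eb; rewrite scale0r addr0 => ->.
rewrite !mulKf //.
by have [] := hr _ (inb a b ah bh).
Unshelve. all: by end_near. Qed.

(** The second difference is symmetric in the two directions. *)
Lemma derive_comm (A : set V) (f : V -> R) (x v w : V) :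
  open A -> Cn_on A 2 f -> A x -> 'D_w ('D_v f) x = 'D_v ('D_w f) x.
Proof.
move=> oA Hf Ax.
have h1 := @second_difference A f x v w oA Hf Ax.
have h2 := @second_difference A f x w v oA Hf Ax.
rewrite -(cvg_lim (@Rhausdorff R) h1) -(cvg_lim (@Rhausdorff R) h2).
suff -> : (fun h => h^-1 * (h^-1 * (f (x + h *: v + h *: w) - f (x + h *: v)
     - (f (x + h *: w) - f x)))) = (fun h => h^-1 * (h^-1 *
  (f (x + h *: w + h *: v) - f (x + h *: w) - (f (x + h *: v) - f x)))) by [].
apply/funext => h; rewrite [x + h *: v + h *: w]addrAC.
by congr (_ * (_ * _)); ring.
Qed.

End Clairaut.

Section ComplexDerivative.
Variable R : realType.
Local Notation C := R[i].

Definition isdC (c : R -> C) (t : R) (d : C) : Prop :=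
  is_derive t (1 : R) (fun s => complex.Re (c s)) (complex.Re d) /\
  is_derive t (1 : R) (fun s => complex.Im (c s)) (complex.Im d).

Lemma ceq (a b : C) : complex.Re a = complex.Re b -> complex.Im a = complex.Im b -> a = b.
Proof. by case: a b => [a1 a2] [b1 b2] /= -> ->. Qed.

Lemma isdC_eq c t d d' : isdC c t d -> d = d' -> isdC c t d'.
Proof. by move=> h <-. Qed.

Lemma isdC_derive1C c t d : isdC c t d -> derive1C c t = d.
Proof.
move=> [[_ h1] [_ h2]]; rewrite /derive1C !derive1E h1 h2.
by case: d {h1 h2}.
Qed.

Lemma isdC_cst (a : C) t : isdC (fun=> a) t 0.
Proof. by split; exact: is_derive_cst. Qed.

Lemma cReD (a b : C) : complex.Re (a + b) = complex.Re a + complex.Re b.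
Proof. by case: a; case: b. Qed.
Lemma cImD (a b : C) : complex.Im (a + b) = complex.Im a + complex.Im b.
Proof. by case: a; case: b. Qed.
Lemma cReN (a : C) : complex.Re (- a) = - complex.Re a.
Proof. by case: a. Qed.
Lemma cImN (a : C) : complex.Im (- a) = - complex.Im a.
Proof. by case: a. Qed.
Lemma cReM (a b : C) : complex.Re (a * b) =
  complex.Re a * complex.Re b - complex.Im a * complex.Im b.
Proof. by case: a; case: b. Qed.
Lemma cImM (a b : C) : complex.Im (a * b) =
  complex.Re a * complex.Im b + complex.Im a * complex.Re b.
Proof. by case: a; case: b => a b c d. Qed.

Lemma isdCD c1 c2 t d1 d2 : isdC c1 t d1 -> isdC c2 t d2 ->
  isdC (fun s => c1 s + c2 s) t (d1 + d2).
Proof.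
move=> [h1 h2] [h3 h4]; split.
  by under eq_fun do rewrite cReD; rewrite cReD; exact: is_deriveD.
by under eq_fun do rewrite cImD; rewrite cImD; exact: is_deriveD.
Qed.

Lemma is_derive1M (f g : R -> R) (t df dg : R) :
  is_derive t (1 : R) f df -> is_derive t (1 : R) g dg ->
  is_derive t (1 : R) (fun s => f s * g s) (df * g t + f t * dg).
Proof.
move=> h1 h2; apply: is_derive_eq (is_deriveM h1 h2) _.
by rewrite addrC; congr (_ + _); exact: mulrC.
Qed.

Lemma isdCM c1 c2 t d1 d2 : isdC c1 t d1 -> isdC c2 t d2 ->
  isdC (fun s => c1 s * c2 s) t (d1 * c2 t + c1 t * d2).
Proof.
move=> [h1 h2] [h3 h4]; split.
  under eq_fun do rewrite cReM.
  apply: is_derive_eq (is_deriveB (is_derive1M h1 h3) (is_derive1M h2 h4)) _.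
  by rewrite cReD !cReM opprD addrACA.
under eq_fun do rewrite cImM.
apply: is_derive_eq (is_deriveD (is_derive1M h1 h4) (is_derive1M h2 h3)) _.
by rewrite cImD !cImM addrACA.
Qed.

Lemma isdCZ (a : C) c t d : isdC c t d -> isdC (fun s => a * c s) t (a * d).
Proof.
move=> h; apply: isdC_eq (isdCM (isdC_cst a t) h) _.
by rewrite mul0r add0r.
Qed.

Lemma isdC_sum (I : Type) (r : seq I) (c : I -> R -> C) t (d : I -> C) :
  (forall i, isdC (c i) t (d i)) ->
  isdC (fun s => \sum_(i <- r) c i s) t (\sum_(i <- r) d i).
Proof.
move=> h; elim: r => [|i r IH].
  by under eq_fun do rewrite big_nil; rewrite big_nil; exact: isdC_cst.
by under eq_fun do rewrite big_cons; rewrite big_cons; exact: isdCD.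
Qed.

Lemma isdC_real (f : R -> R) t d : is_derive t (1 : R) f d ->
  isdC (fun s => (f s)%:C) t d%:C.
Proof. by move=> h; split => //=; exact: is_derive_cst. Qed.

Lemma isdC_const (y : R -> C) : (forall t, isdC y t 0) -> forall t, y t = y 0.
Proof.
move=> dy t; apply: ceq; apply/eqP; rewrite -subr_eq0.
  have [|xi _ ->] := @MVT_abs R (fun s => complex.Re (y s)) (fun=> 0) t; last by rewrite mulr0.
  by move=> s _; have [] := dy s.
have [|xi _ ->] := @MVT_abs R (fun s => complex.Im (y s)) (fun=> 0) t; last by rewrite mulr0.
by move=> s _; have [] := dy s.
Qed.

End ComplexDerivative.

Section SmoothC.
Variables (R : realType) (V : normedModType R).
Local Notation C := R[i].
Implicit Types (A B : set V) (F G : V -> C) (v x : V).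

Definition smoothC (A : set V) (F : V -> C) :=
  smooth_on A (fun x => complex.Re (F x)) /\ smooth_on A (fun x => complex.Im (F x)).

Lemma smoothC_cst A (a : C) : smoothC A (fun=> a).
Proof. by split=> n; exact: Cn_on_cst. Qed.

Lemma smoothCD A F G : open A -> smoothC A F -> smoothC A G ->
  smoothC A (fun x => F x + G x).
Proof.
move=> oA [f1 f2] [g1 g2]; split=> n.
  by under eq_fun do rewrite cReD; exact: Cn_onD.
by under eq_fun do rewrite cImD; exact: Cn_onD.
Qed.

Lemma smoothCM A F G : open A -> smoothC A F -> smoothC A G ->
  smoothC A (fun x => F x * G x).
Proof.
move=> oA [f1 f2] [g1 g2]; split=> n.
  under eq_fun do rewrite cReM.
  by apply: Cn_onD => //; [|apply: Cn_onN => //]; exact: Cn_onM.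
by under eq_fun do rewrite cImM; apply: Cn_onD => //; exact: Cn_onM.
Qed.

Lemma smoothC_sum A (I : Type) (r : seq I) (F : I -> V -> C) : open A ->
  (forall i, smoothC A (F i)) -> smoothC A (fun x => \sum_(i <- r) F i x).
Proof.
move=> oA h; elim: r => [|i r IH].
  by under eq_fun do rewrite big_nil; exact: smoothC_cst.
by under eq_fun do rewrite big_cons; exact: smoothCD.
Qed.

Lemma smoothC_real A (f : V -> R) : smooth_on A f -> smoothC A (fun x => (f x)%:C).
Proof. by move=> h; split => //= n; exact: Cn_on_cst. Qed.

Lemma smoothC_sub A B F : B `<=` A -> smoothC A F -> smoothC B F.
Proof. by move=> BA [h1 h2]; split=> n; apply: (Cn_on_sub BA). Qed.

Definition DC v (F : V -> C) x : C :=
  'D_v (fun y => complex.Re (F y)) x +i* 'D_v (fun y => complex.Im (F y)) x.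

Lemma smoothC_DC A F v : smoothC A F -> smoothC A (DC v F).
Proof.
move=> [h1 h2]; split=> n.
  by have [_ /(_ v)[]] := h1 n.+1.
by have [_ /(_ v)[]] := h2 n.+1.
Qed.

End SmoothC.

(** * Left-invariant derivatives on SU(2) *)

Section Ambient.
Variable R : realType.
Local Notation C := R[i].
Local Notation V := ('M[R]_2 * 'M[R]_2)%type.
Implicit Types (c d : SU2 R -> C) (g : SU2 R) (M Y : 'M[C]_2) (x v : V).

Definition emb M : V := (map_mx (@complex.Re R) M, map_mx (@complex.Im R) M).
Definition matC x : 'M[C]_2 := \matrix_(i, j) (x.1 i j +i* x.2 i j).

Lemma matCK M : matC (emb M) = M.
Proof. by apply/matrixP => i j; rewrite !mxE; case: (M i j). Qed.

(** Real coordinates on pairs of matrices: the boolean selects the real or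
    the imaginary part, the other two components the entry. *)
Definition cdir (p : bool * 'I_2 * 'I_2) : V :=
  if p.1.1 then (delta_mx p.1.2 p.2, 0) else (0, delta_mx p.1.2 p.2).
Definition ccoord (p : bool * 'I_2 * 'I_2) x : R :=
  if p.1.1 then x.1 p.1.2 p.2 else x.2 p.1.2 p.2.

Lemma ccoordE x : x = \sum_p ccoord p x *: cdir p.
Proof.
transitivity (\sum_b \sum_i \sum_j ccoord (b, i, j) x *: cdir (b, i, j)).
  rewrite big_bool /=.
  rewrite [x in LHS](surjective_pairing x); case: x => a b /=.
  rewrite /ccoord /cdir /=.
  rewrite [a in LHS]matrix_sum_delta [b in LHS]matrix_sum_delta.
  have hf (A : 'M[R]_2) : \sum_i \sum_j A i j *: ((delta_mx i j, 0) : V) =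
      (\sum_i \sum_j A i j *: delta_mx i j, 0).
    rewrite (_ : (\sum_i \sum_j _, _) =
      \sum_i (\sum_j A i j *: delta_mx i j, 0 : 'M[R]_2)); last first.
      by elim/big_rec2: _ => // i y1 y2 _ <-; congr (_, _); rewrite addr0.
    apply: eq_bigr => i _; elim/big_rec2: _ => // j y1 y2 _ ->.
    by congr (_, _); rewrite /= ?scaler0 ?addr0.
  have hs (A : 'M[R]_2) : \sum_i \sum_j A i j *: ((0, delta_mx i j) : V) =
      (0, \sum_i \sum_j A i j *: delta_mx i j).
    rewrite (_ : (_, \sum_i \sum_j _) =
      \sum_i (0 : 'M[R]_2, \sum_j A i j *: delta_mx i j)); last first.
      by elim/big_rec2: _ => // i y1 y2 _ <-; congr (_, _); rewrite addr0.
    apply: eq_bigr => i _; elim/big_rec2: _ => // j y1 y2 _ ->.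
    by congr (_, _); rewrite /= ?scaler0 ?addr0.
  by rewrite hf hs; congr (_, _); rewrite /= ?addr0 ?add0r.
rewrite (pair_bigA _ (fun b i => \sum_j ccoord (b, i, j) x *: cdir (b, i, j))) /=.
rewrite (pair_bigA _ (fun p j => ccoord (p.1, p.2, j) x *: cdir (p.1, p.2, j))) /=.
by apply: eq_bigr => -[[b i] j] _.
Qed.

Lemma ccoordL p x v (a : R) : ccoord p (x + a *: v) = ccoord p x + a * ccoord p v.
Proof. by rewrite /ccoord; case: p.1.1; rewrite !mxE. Qed.

Lemma ccoord_continuous p : continuous (ccoord p).
Proof.
rewrite /ccoord; case: p.1.1 => x.
  apply: (@cvg_comp _ _ _ fst (fun A : 'M[R]_2 => A p.1.2 p.2) _ (nbhs x.1)).
    exact: cvg_fst.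
  exact: coord_continuous.
apply: (@cvg_comp _ _ _ snd (fun A : 'M[R]_2 => A p.1.2 p.2) _ (nbhs x.2)).
  exact: cvg_snd.
exact: coord_continuous.
Qed.

Lemma smooth_ccoord A p : smooth_on A (ccoord p).
Proof.
move=> n; apply: Cn_on_linear; first exact: ccoord_continuous.
by move=> x v a; rewrite ccoordL.
Qed.

Lemma smoothC_entry A i j : smoothC A (fun x => matC x i j).
Proof.
split=> n.
  under eq_fun do rewrite mxE /=; exact: (@smooth_ccoord A (true, i, j)).
by under eq_fun do rewrite mxE /=; exact: (@smooth_ccoord A (false, i, j)).
Qed.

Lemma smooth_ccoord_of (U : normedModType R) (B : set U) (L : U -> 'M[C]_2) p :
  (forall i j, smoothC B (fun y => L y i j)) ->
  smooth_on B (fun y => ccoord p (emb (L y))).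
Proof.
move=> h; have [h1 h2] := h p.1.2 p.2; rewrite /ccoord /emb; case: p.1.1 => /=.
  by under eq_fun do rewrite mxE.
by under eq_fun do rewrite mxE.
Qed.

Lemma smooth_coord_continuous (U : normedModType R) (G : U -> V) :
  (forall p, smooth_on setT (fun y => ccoord p (G y))) -> continuous G.
Proof.
by move=> sG y; apply: (cont_coord ccoordE) => p; apply: (Cn_on_cont (sG p 0%N)).
Qed.

Lemma smoothC_mulmx (U : normedModType R) (B : set U) (L N : U -> 'M[C]_2) : open B ->
  (forall i j, smoothC B (fun y => L y i j)) ->
  (forall i j, smoothC B (fun y => N y i j)) ->
  forall i j, smoothC B (fun y => (L y *m N y) i j).
Proof.
move=> oB sL sN i j; under eq_fun do rewrite mxE.
by apply: smoothC_sum => // k; exact: smoothCM.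
Qed.

Lemma smooth_ccoord_mul A Y p : open A ->
  smooth_on A (fun x => ccoord p (emb (matC x *m Y))).
Proof.
move=> oA; apply: smooth_ccoord_of; apply: smoothC_mulmx => // i j.
  exact: smoothC_entry.
exact: smoothC_cst.
Qed.

Lemma DC_coord A F x v : open A -> smoothC A F -> A x ->
  DC v F x = \sum_p (ccoord p v)%:C * DC (cdir p) F x.
Proof.
move=> oA [h1 h2] Ax.
have nA : \forall y \near x, A y by exact: open_nbhs_nbhs.
have D f : smooth_on A f -> 'D_v f x = \sum_p ccoord p v * 'D_(cdir p) f x.
  move=> h; apply: (derive_coord ccoordE ccoordL) => p.
    by near=> y; have [_ /(_ (cdir p))[+ _]] := h 1%N; apply; near: y.
  by have [_ /(_ (cdir p))[_ [+ _]]] := h 1%N; exact.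
rewrite /DC !D //.
rewrite (eq_bigr (fun p => (ccoord p v * 'D_(cdir p) (fun y => complex.Re (F y)) x)
  +i* (ccoord p v * 'D_(cdir p) (fun y => complex.Im (F y)) x))); last first.
  move=> p _; apply/eqP; rewrite eq_complex /=; apply/andP; split; apply/eqP; ring.
by elim/big_rec3: _ => // p y1 y2 y3 _ <-.
Unshelve. all: by end_near. Qed.

(** The witnesses of [su2_smooth], named so that derivatives on SU(2) can be
    computed with a fixed extension. *)
Definition extends (A : set V) F c :=
  [/\ open A, smoothC A F, forall g, A (emb g) & forall g, F (emb g) = c g].

Lemma su2_smoothP c : su2_smooth c <-> exists A F, extends A F c.
Proof.
split=> [[A [F [oA h1 h2 h3]]]|[A [F [oA [h1 h2] h3 h4]]]]; exists A, F.
  by split=> // g; have [] := h3 g.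
by split=> // g; split; [exact: h3|exact: h4].
Qed.

(** Derivatives along curves in SU(2) only depend on the velocity in the
    ambient space; this identifies [Lie] with a directional derivative of any
    extension. *)
Lemma extends_curve A F c (gm : R -> SU2 R) t M : extends A F c ->
  (forall i j, isdC (fun s => gm s i j) t (M i j)) ->
  isdC (fun s => c (gm s)) t (DC (emb M) F (emb (gm t))).
Proof.
move=> [oA [h1 h2] h3 h4] hg.
have hk p : is_derive t (1 : R) (fun s => ccoord p (emb (gm s))) (ccoord p (emb M)).
  have [hr hi] := hg p.1.2 p.2; rewrite /ccoord /emb; case: p.1.1 => /=.
    by under eq_fun do rewrite mxE; rewrite mxE.
  by under eq_fun do rewrite mxE; rewrite mxE.
have nA : \forall y \near emb (gm t), A y.
  by apply: open_nbhs_nbhs; split => //; exact: h3.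
have D f : smooth_on A f ->
    is_derive t (1 : R) (f \o (fun s => emb (gm s))) ('D_(emb M) f (emb (gm t))).
  move=> h.
  have dn p : \forall y \near emb (gm t), derivable f y (cdir p).
    by near=> y; have [_ /(_ (cdir p))[+ _]] := h 1%N; apply; near: y.
  have Dc p : {for emb (gm t), continuous ('D_(cdir p) f)}.
    by have [_ /(_ (cdir p))[_ [+ _]]] := h 1%N; apply; exact: h3.
  rewrite (derive_coord ccoordE ccoordL _ dn Dc).
  exact: (curve_chain ccoordE (g := fun s => emb (gm s))).
split.
  by under eq_fun do rewrite -h4; exact: (D _ h1).
by under eq_fun do rewrite -h4; exact: (D _ h2).
Unshelve. all: by end_near. Qed.

End Ambient.

Section Lie.
Variable R : realType.
Local Notation C := R[i].
Local Notation V := ('M[R]_2 * 'M[R]_2)%type.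
Implicit Types (c d : SU2 R -> C) (g : SU2 R) (M Y : 'M[C]_2).

Definition Lie Y c : SU2 R -> C :=
  fun g => derive1C (fun t => c (g * su2_exp (t%:C *: Y))%g) 0.

Lemma su2_exp_rot Y (t : R) : lie_su2 Y ->
  su2val (su2_exp (t%:C *: Y)) = (cos (t * Num.sqrt (nsq Y)))%:C *: 1 +
    (sin (t * Num.sqrt (nsq Y)) / Num.sqrt (nsq Y))%:C *: Y.
Proof.
move=> hY; have htY := lie_su2Z t hY.
rewrite su2_expE // lie_su2_expmx //.
have E : Num.sqrt (nsq (t%:C *: Y)) = `|t| * Num.sqrt (nsq Y).
  rewrite -sqrtr_sqr -sqrtrM ?sqr_ge0 //; congr Num.sqrt.
  rewrite /nsq !mxE !cReM !cImM /=; ring.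
rewrite E; have [t0|t0] := leP 0 t.
  rewrite ger0_norm //; congr (_ + _).
  rewrite scalerA -rmorphM /=; have [->|tn0] := eqVneq t 0.
    by rewrite !mul0r sin0 !mul0r.
  congr (_%:C *: _); have [->|r0] := eqVneq (Num.sqrt (nsq Y)) 0.
    by rewrite !mulr0 sin0 !mul0r.
  by field; rewrite r0.
rewrite ltr0_norm // mulNr cosN sinN; congr (_ + _).
rewrite scalerA -rmorphM /=.
congr (_%:C *: _); have [->|r0] := eqVneq (Num.sqrt (nsq Y)) 0.
  by rewrite !mulr0 sin0 !oppr0 !mul0r.
by field; rewrite r0 lt_eqF.
Qed.

Lemma exp_curve Y g (t : R) i j : lie_su2 Y ->
  isdC (fun s => (g * su2_exp (s%:C *: Y))%g i j) t
    ((su2val (g * su2_exp (t%:C *: Y))%g *m Y) i j).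
Proof.
move=> hY; set r := Num.sqrt (nsq Y).
have r2 : r ^+ 2 = nsq Y by rewrite sqr_sqrtr ?nsq_ge0.
have E s : su2val (g * su2_exp (s%:C *: Y))%g =
    (cos (s * r))%:C *: su2val g + (sin (s * r) / r)%:C *: (su2val g *m Y).
  rewrite /= su2_exp_rot // mulmxDr -!scalemxAr.
  by rewrite -[1 in LHS]/(1%:M) mulmx1.
have dcos : is_derive t (1 : R) (fun s => cos (s * r)) (- sin (t * r) * r).
  apply: is_derive1_comp; have := is_derive_affine 0 r t.
  by under eq_fun do rewrite add0r.
have dsin : is_derive t (1 : R) (fun s => sin (s * r) / r) (cos (t * r) * r / r).
  have h : is_derive t (1 : R) (fun s => sin (s * r)) (cos (t * r) * r).
    apply: is_derive1_comp; have := is_derive_affine 0 r t.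
    by under eq_fun do rewrite add0r.
  apply: is_derive_eq (is_derive1M h (is_derive_cst _ _ _)) _.
  by rewrite mulr0 addr0.
have -> : (fun s : R => (g * su2_exp (s%:C *: Y))%g i j) =
    (fun s => (cos (s * r))%:C * g i j + (sin (s * r) / r)%:C * (su2val g *m Y) i j).
  by apply/funext => s; rewrite E !mxE.
apply: isdC_eq.
  apply: isdCD; apply: isdCM; [exact: isdC_real dcos|exact: isdC_cst|
    exact: isdC_real dsin|exact: isdC_cst].
rewrite E !mulr0 !addr0 mulmxDl -!scalemxAl.
have -> : su2val g *m Y *m Y = - (r ^+ 2)%:C *: su2val g.
  rewrite -mulmxA (_ : Y *m Y = Y ^+ 2); last by rewrite expr2.
  by rewrite lie_su2_sqr // r2 -scalemxAr -[1 in LHS]/(1%:M) mulmx1.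
move Pd : (su2val g *m Y) => P; move: (su2val g) Pd => M Pd.
rewrite !mxE.
have [r0|r0] := eqVneq r 0.
  have Y0 : Y = 0 by apply: lie_su2_nsq0 => //; rewrite -r2 r0 expr0n.
  by rewrite r0 -Pd Y0 mulmx0 !mxE expr0n /= !mulr0 oppr0 !mul0r mulr0 !addr0.
rewrite mulfK // addrC mulrA -!rmorphN -!rmorphM /=.
congr (_ + _%:C * _); field.
by rewrite eq_complex /= negb_and r0.
Qed.

Lemma exp_curve0 Y g : (g * su2_exp ((0 : R)%:C *: Y))%g = g.
Proof.
have -> : (0 : R)%:C *: Y = 0 by rewrite scale0r.
apply/val_inj => /=.
have h0 : lie_su2 (0 : 'M[C]_2).
  by split; [rewrite trmx0 map_mx0 oppr0|rewrite mxtrace0].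
have := su2_exp_rot 0 h0; rewrite mul0r cos0 !scaler0 addr0 => ->.
by rewrite scale1r mulmx1.
Qed.

Lemma exp_curve_at0 Y g i j : lie_su2 Y ->
  isdC (fun s : R => (g * su2_exp (s%:C *: Y))%g i j) 0 ((su2val g *m Y) i j).
Proof.
move=> hY.
exact: (eq_rect _ (fun g' => isdC _ 0 ((su2val g' *m Y) i j))
  (exp_curve g 0 i j hY) _ (exp_curve0 Y g)).
Qed.

(** The value of the derivative is attached to the endpoint [g * exp 0] of
    the curve, which is [g]. *)
Lemma isdC_at0 Y g (c : SU2 R -> C) (d : SU2 R -> C) :
  isdC (fun s : R => c (g * su2_exp (s%:C *: Y))%g) 0
    (d (g * su2_exp ((0 : R)%:C *: Y))%g) ->
  isdC (fun s : R => c (g * su2_exp (s%:C *: Y))%g) 0 (d g).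
Proof.
move=> H; exact: (eq_rect _ (fun g' => isdC
  (fun s : R => c (g * su2_exp (s%:C *: Y))%g) 0 (d g')) H _ (exp_curve0 Y g)).
Qed.

Lemma extends_Lie_at0 A F c Y g : extends A F c -> lie_su2 Y ->
  isdC (fun s : R => c (g * su2_exp (s%:C *: Y))%g) 0
    (DC (emb (su2val g *m Y)) F (emb g)).
Proof.
move=> hF hY; apply: (@isdC_at0 Y g c (fun g' => DC (emb (su2val g *m Y)) F (emb g'))).
by apply: (extends_curve (gm := fun s : R => (g * su2_exp (s%:C *: Y))%g) hF) => i j;
  exact: exp_curve_at0.
Qed.

Lemma extends_Lie A F c Y g : extends A F c -> lie_su2 Y ->
  Lie Y c g = DC (emb (su2val g *m Y)) F (emb g).
Proof.
move=> hF hY.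
exact: isdC_derive1C (extends_Lie_at0 g hF hY).
Qed.

Lemma Lie_curve c Y (gm : R -> SU2 R) t : su2_smooth c -> lie_su2 Y ->
  (forall i j, isdC (fun s => gm s i j) t ((su2val (gm t) *m Y) i j)) ->
  isdC (fun s => c (gm s)) t (Lie Y c (gm t)).
Proof.
move=> /su2_smoothP[A [F hF]] hY h.
by rewrite (extends_Lie _ hF) //; exact: (extends_curve hF).
Qed.

Lemma Lie_exp c Y g t : su2_smooth c -> lie_su2 Y ->
  isdC (fun s => c (g * su2_exp (s%:C *: Y))%g) t (Lie Y c (g * su2_exp (t%:C *: Y))%g).
Proof.
move=> hc hY; apply: (Lie_curve (gm := fun s : R => (g * su2_exp (s%:C *: Y))%g)) => //.
by move=> i j; exact: exp_curve.
Qed.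

Lemma Lie_exp0 c Y g : su2_smooth c -> lie_su2 Y ->
  isdC (fun s => c (g * su2_exp (s%:C *: Y))%g) 0 (Lie Y c g).
Proof.
move=> /su2_smoothP[A [F hF]] hY.
by rewrite (extends_Lie _ hF) //; exact: (extends_Lie_at0 g hF hY).
Qed.

(** The derivative [Lie Y c] is the restriction of an explicit smooth
    function on the same open set, hence can be differentiated again. *)
Lemma extends_Lie_ext A F c Y : extends A F c -> lie_su2 Y ->
  extends A (fun x => \sum_p (ccoord p (emb (matC x *m Y)))%:C * DC (cdir R p) F x) (Lie Y c).
Proof.
move=> hF hY; have [oA sF Ag Fg] := hF; split=> //.
  apply: smoothC_sum => // p; apply: smoothCM => //; last exact: smoothC_DC.
  exact/smoothC_real/smooth_ccoord_mul.
move=> g; rewrite (extends_Lie _ hF) // (DC_coord _ oA sF (Ag g)).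
by rewrite matCK.
Qed.

Lemma su2_smooth_Lie c Y : lie_su2 Y -> su2_smooth c -> su2_smooth (Lie Y c).
Proof.
move=> hY /su2_smoothP[A [F hF]]; apply/su2_smoothP.
by eexists; eexists; exact: (extends_Lie_ext hF hY).
Qed.

Lemma su2_smooth_cst (a : C) : su2_smooth (fun _ : SU2 R => a).
Proof.
apply/su2_smoothP; exists setT, (fun=> a); split=> //; first exact: openT.
exact: smoothC_cst.
Qed.

Lemma su2_smooth_entry i j : su2_smooth (fun g : SU2 R => g i j).
Proof.
apply/su2_smoothP; exists setT, (fun x => matC x i j); split=> //; first exact: openT.
  exact: smoothC_entry.
by move=> g; rewrite matCK.
Qed.

Lemma su2_smoothD c d : su2_smooth c -> su2_smooth d ->
  su2_smooth (fun g => c g + d g).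
Proof.
move=> /su2_smoothP[A [F [oA sF Ag Fg]]] /su2_smoothP[B [G [oB sG Bg Gg]]].
apply/su2_smoothP; exists (A `&` B), (fun x => F x + G x).
have oAB : open (A `&` B) by exact: openI.
split=> //; last by move=> g; rewrite Fg Gg.
by apply: smoothCD => //; [apply: smoothC_sub sF|apply: smoothC_sub sG] => x [].
Qed.

Lemma su2_smoothM c d : su2_smooth c -> su2_smooth d ->
  su2_smooth (fun g => c g * d g).
Proof.
move=> /su2_smoothP[A [F [oA sF Ag Fg]]] /su2_smoothP[B [G [oB sG Bg Gg]]].
apply/su2_smoothP; exists (A `&` B), (fun x => F x * G x).
have oAB : open (A `&` B) by exact: openI.
split=> //; last by move=> g; rewrite Fg Gg.
by apply: smoothCM => //; [apply: smoothC_sub sF|apply: smoothC_sub sG] => x [].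
Qed.

Lemma su2_smoothZ (a : C) c : su2_smooth c -> su2_smooth (fun g => a * c g).
Proof. by move=> h; apply: su2_smoothM => //; exact: su2_smooth_cst. Qed.

(** The second derivatives of the extension form the term that is symmetric
    in [X] and [Y]; the remaining one is the derivative in the direction [g X
    Y]. *)
Lemma Lie2 A F c X Y g : extends A F c -> lie_su2 X -> lie_su2 Y ->
  Lie X (Lie Y c) g = DC (emb (su2val g *m X *m Y)) F (emb g) +
   \sum_p \sum_q (ccoord p (emb (su2val g *m Y)))%:C *
      ((ccoord q (emb (su2val g *m X)))%:C * DC (cdir R q) (DC (cdir R p) F) (emb g)).
Proof.
move=> hF hX hY; have [oA sF Ag Fg] := hF.
have [_ _ _ hL] := extends_Lie_ext hF hY.
rewrite (DC_coord _ oA sF (Ag g)) -big_split /=.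
apply: isdC_derive1C.
have -> : (fun s : R => Lie Y c (g * su2_exp (s%:C *: X))%g) = (fun s : R =>
   \sum_p (ccoord p (emb (su2val (g * su2_exp (s%:C *: X))%g *m Y)))%:C *
     DC (cdir R p) F (emb (g * su2_exp (s%:C *: X))%g)).
  by apply/funext => s; rewrite -hL matCK.
apply: isdC_sum => p.
have h1 : isdC (fun s : R => (ccoord p (emb (su2val (g * su2_exp (s%:C *: X))%g *m Y)))%:C)
    0 (ccoord p (emb (su2val g *m X *m Y)))%:C.
  have h i j : isdC (fun s : R => (su2val (g * su2_exp (s%:C *: X))%g *m Y) i j) 0
      ((su2val g *m X *m Y) i j).
    have -> : (fun s : R => (su2val (g * su2_exp (s%:C *: X))%g *m Y) i j) =
       (fun s => \sum_k (g * su2_exp (s%:C *: X))%g i k * Y k j).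
      by apply/funext => s; rewrite mxE.
    rewrite [X in isdC _ _ X]mxE; apply: isdC_sum => k.
    apply: isdC_eq (isdCM (exp_curve_at0 g i k hX) (isdC_cst _ _)) _.
    by rewrite mulr0 addr0.
  have [h1 h2] := h p.1.2 p.2; apply: isdC_real; rewrite /ccoord; case: p.1.1.
    by under eq_fun do rewrite mxE; rewrite mxE.
  by under eq_fun do rewrite mxE; rewrite mxE.
have h2 : isdC (fun s : R => DC (cdir R p) F (emb (g * su2_exp (s%:C *: X))%g)) 0
   (\sum_q (ccoord q (emb (su2val g *m X)))%:C * DC (cdir R q) (DC (cdir R p) F) (emb g)).
  pose cp := fun g : SU2 R => DC (cdir R p) F (emb g).
  have hcp : extends A (DC (cdir R p) F) cp by split=> //; exact: smoothC_DC.
  have := extends_Lie_at0 g hcp hX.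
  by rewrite (DC_coord _ oA _ (Ag g)) //; exact: smoothC_DC.
have h3 := isdCM h1 h2.
pose S := \sum_q (ccoord q (emb (su2val g *m X)))%:C * DC (cdir R q) (DC (cdir R p) F) (emb g).
pose cc := fun g' : SU2 R => (ccoord p (emb (su2val g' *m Y)))%:C * DC (cdir R p) F (emb g').
pose dd := fun g' : SU2 R => (ccoord p (emb (su2val g *m X *m Y)))%:C *
   DC (cdir R p) F (emb g') + (ccoord p (emb (su2val g' *m Y)))%:C * S.
rewrite -mulr_sumr; exact: (@isdC_at0 X g cc dd h3).
Qed.

(** In the difference of the two orders the second derivatives of the
    extension cancel. *)
Lemma Lie_bracket c X Y : su2_smooth c -> lie_su2 X -> lie_su2 Y ->
  lie_su2 (lie_bracket X Y) ->
  forall g, Lie X (Lie Y c) g - Lie Y (Lie X c) g = Lie (lie_bracket X Y) c g.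
Proof.
move=> /su2_smoothP[A [F hF]] hX hY hXY g; have [oA sF Ag Fg] := hF.
rewrite !(Lie2 _ hF) // (extends_Lie _ hF) //.
have -> : \sum_p \sum_q (ccoord p (emb (su2val g *m Y)))%:C *
      ((ccoord q (emb (su2val g *m X)))%:C * DC (cdir R q) (DC (cdir R p) F) (emb g)) =
  \sum_p \sum_q (ccoord p (emb (su2val g *m X)))%:C *
      ((ccoord q (emb (su2val g *m Y)))%:C * DC (cdir R q) (DC (cdir R p) F) (emb g)).
  rewrite exchange_big; apply: eq_bigr => p _; apply: eq_bigr => q _.
  have sym : DC (cdir R p) (DC (cdir R q) F) (emb g) =
      DC (cdir R q) (DC (cdir R p) F) (emb g).
    case: sF => h1 h2; rewrite /DC /=.
    have e1 := @derive_comm _ _ A _ _ (cdir R q) (cdir R p) oA (h1 2%N) (Ag g).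
    have e2 := @derive_comm _ _ A _ _ (cdir R q) (cdir R p) oA (h2 2%N) (Ag g).
    by move: e1 e2 => /= -> ->.
  by rewrite sym; exact: mulrCA.
have addKK (a b s : C) : a + s - (b + s) = a - b by ring.
rewrite addKK.
rewrite !(DC_coord _ oA sF (Ag g)) -sumrB; apply: eq_bigr => p _.
rewrite -mulrBl; congr (_ * _); rewrite -rmorphB /=; congr (_%:C).
rewrite /lie_bracket mulmxBr !mulmxA.
move: (su2val g *m X *m Y) (su2val g *m Y *m X) => M N.
by rewrite /ccoord; case: p.1.1; rewrite !mxE ?cReD ?cReN ?cImD ?cImN.
Qed.

Lemma LieM c d Y g : lie_su2 Y -> su2_smooth c -> su2_smooth d ->
  Lie Y (fun g => c g * d g) g = Lie Y c g * d g + c g * Lie Y d g.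
Proof.
move=> hY hc hd.
have h := isdCM (Lie_exp0 g hc hY) (Lie_exp0 g hd hY).
exact: isdC_derive1C (@isdC_at0 Y g _
  (fun g' => Lie Y c g * d g' + c g' * Lie Y d g) h).
Qed.

Lemma LieD c d Y g : lie_su2 Y -> su2_smooth c -> su2_smooth d ->
  Lie Y (fun g => c g + d g) g = Lie Y c g + Lie Y d g.
Proof.
move=> hY hc hd.
exact: isdC_derive1C (isdCD (Lie_exp0 g hc hY) (Lie_exp0 g hd hY)).
Qed.

Lemma Lie_cst (a : C) Y g : Lie Y (fun=> a) g = 0.
Proof. exact: isdC_derive1C (isdC_cst a 0). Qed.

End Lie.

(** * SU(2) as the unit sphere of the quaternions *)

Section Quaternion.
Variable R : realType.
Local Notation C := R[i].
Local Notation V := ('M[R]_2 * 'M[R]_2)%type.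
Implicit Types (c d : SU2 R -> C) (g : SU2 R).

Lemma mx22P (A B : 'M[C]_2) : A 0 0 = B 0 0 -> A 0 1 = B 0 1 ->
  A 1 0 = B 1 0 -> A 1 1 = B 1 1 -> A = B.
Proof.
by move=> h0 h1 h2 h3; apply/matrixP; apply: ord2P => j; move: j; apply: ord2P.
Qed.

Lemma mx22E (K : nzRingType) (a b c d : K) :
  ((mx22 a b c d 0 0 = a) * (mx22 a b c d 0 1 = b) *
   (mx22 a b c d 1 0 = c) * (mx22 a b c d 1 1 = d))%type.
Proof. by rewrite !mxE. Qed.

Lemma mulmx22 (A B : 'M[C]_2) i j : (A *m B) i j = A i 0 * B 0 j + A i 1 * B 1 j.
Proof. by rewrite mxE sum_ord2. Qed.

(** The quaternion [x + y i + u j + v k] as a matrix; su(2) consists of the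
    imaginary ones and SU(2) of those of norm 1. *)
Definition quat (x y u v : R) : 'M[C]_2 :=
  mx22 (x +i* y) (u +i* v) ((- u) +i* v) (x -i* y).

Definition imq (y u v : R) : 'M[C]_2 := quat 0 y u v.
Definition qi := imq 1 0 0.
Definition qj := imq 0 1 0.
Definition qk := imq 0 0 1.

Lemma smooth_quat (U : normedModType R) (A : set U) (X Y P Q : U -> R) : open A ->
  smooth_on A X -> smooth_on A Y -> smooth_on A P -> smooth_on A Q ->
  forall i j, smoothC A (fun x => quat (X x) (Y x) (P x) (Q x) i j).
Proof.
move=> oA sX sY sU sZ i; move: i; apply: ord2P => j; move: j; apply: ord2P;
  under eq_fun do rewrite mx22E; split => //=; by move=> n; exact: Cn_onN.
Qed.

Lemma lie_imq y u v : lie_su2 (imq y u v).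
Proof.
split.
  by apply: mx22P; rewrite !mxE /=; apply: ceq => /=; ring.
rewrite /mxtrace sum_ord2 !mx22E; apply: ceq => /=; ring.
Qed.

Lemma imqE y u v : imq y u v = y%:C *: qi + u%:C *: qj + v%:C *: qk.
Proof.
apply: mx22P; rewrite !mxE /=; apply: ceq => /=; ring.
Qed.

Lemma nsq_imq y u v : nsq (imq y u v) = y ^+ 2 + u ^+ 2 + v ^+ 2.
Proof. by rewrite /nsq !mx22E. Qed.

Lemma quat_mul x y u v x' y' u' v' :
  quat x y u v *m quat x' y' u' v' =
  quat (x * x' - y * y' - u * u' - v * v') (x * y' + y * x' + u * v' - v * u')
       (x * u' + u * x' + v * y' - y * v') (x * v' + v * x' + y * u' - u * y').
Proof.
apply: mx22P; rewrite mulmx22 !mx22E; apply: ceq => /=; ring.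
Qed.

Lemma lie_bracket_imq y u v y' u' v' :
  lie_bracket (imq y u v) (imq y' u' v') =
  imq (2 * (u * v' - v * u')) (2 * (v * y' - y * v')) (2 * (y * u' - u * y')).
Proof.
rewrite /lie_bracket !quat_mul; apply: mx22P; rewrite !mxE /=; apply: ceq => /=; ring.
Qed.

Lemma su2_quat g : exists x y u v : R,
  x ^+ 2 + y ^+ 2 + u ^+ 2 + v ^+ 2 = 1 /\ su2val g = quat x y u v.
Proof.
have alg (a b c d : C) : a * c^* + b * d^* = 0 -> a * a^* + b * b^* = 1 ->
    a * d - b * c = 1 -> d = a^* /\ c = - b^*.
  move=> U01 U00 D.
  have {}U01 : a^* * c + b^* * d = 0.
    have := congr1 (fun z : C => z^*) U01.
    by rewrite rmorphD !rmorphM /= !conjcK oppr0; exact.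
  split.
    have -> : d = a^* * (a * d - b * c) + (a^* * c + b^* * d) * b
       - (a * a^* + b * b^* - 1) * d by ring.
    by rewrite D U01 U00 subrr !mul0r mulr1 addr0 subr0.
  have -> : c = - b^* * (a * d - b * c) + (a^* * c + b^* * d) * a
       - (a * a^* + b * b^* - 1) * c by ring.
  by rewrite D U01 U00 subrr !mul0r mulr1 addr0 subr0.
have /unitarymxP U := su2_unitary g; have D := su2_det g.
move: (su2val g) U D => M; rewrite det2.
move=> /matrixP U D.
have U00 := U 0 0; have U01 := U 0 1; rewrite !mulmx22 !mxE /= in U00 U01.
have [dE cE] := alg _ _ _ _ U01 U00 D.
exists (complex.Re (M 0 0)), (complex.Im (M 0 0)), (complex.Re (M 0 1)), (complex.Im (M 0 1)); split.
  move: U00; case: (M 0 0) => x y; case: (M 0 1) => u v /= /(congr1 (@complex.Re R)) /=.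
  by rewrite !mulrN !opprK => <-; ring.
apply: mx22P; rewrite !mx22E ?dE ?cE; apply: ceq => //=; by case: (M _ _) => u v //=; rewrite opprK.
Qed.

Definition su2_of (x y u v : R) : SU2 R :=
  insubd (1%g : SU2 R) (quat x y u v).

Lemma su2_ofE (x y u v : R) : x ^+ 2 + y ^+ 2 + u ^+ 2 + v ^+ 2 = 1 ->
  su2val (su2_of x y u v) = quat x y u v.
Proof.
move=> e; rewrite /su2_of /insubd; case: insubP => [g _ <- //|].
by move/negP; case; exact: su2_mk_subproof e.
Qed.

Lemma su2_exp_imq y u v (t : R) : y ^+ 2 + u ^+ 2 + v ^+ 2 = 1 ->
  su2val (su2_exp (t%:C *: imq y u v)) =
  quat (cos t) (sin t * y) (sin t * u) (sin t * v).
Proof.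
move=> e; rewrite su2_exp_rot; last exact: lie_imq.
rewrite nsq_imq e sqrtr1 mulr1 divr1.
apply: mx22P; rewrite !mxE /=; apply: ceq => /=; ring.
Qed.

(** One-parameter subgroups through imaginary units cover SU(2). *)
Lemma su2_polar g : exists y u v t : R, y ^+ 2 + u ^+ 2 + v ^+ 2 = 1 /\
  g = su2_exp (t%:C *: imq y u v).
Proof.
have [x [y [u [v [e gE]]]]] := su2_quat g.
have x1 : -1 <= x <= 1.
  rewrite -ler_norml -(@ler_pXn2r _ 2) ?nnegrE //.
  by rewrite real_normK ?num_real // expr1n -e -!addrA lerDl !addr_ge0 ?sqr_ge0.
pose t := acos x; have ct : cos t = x by rewrite acosK // in_itv.
have st : sin t ^+ 2 = y ^+ 2 + u ^+ 2 + v ^+ 2.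
  have := cos2Dsin2 t; rewrite ct -e -!addrA => /addrI ->; by rewrite !addrA.
have [s0|s0] := eqVneq (sin t) 0.
  move: st; rewrite s0 expr0n /= => /esym/eqP.
  rewrite paddr_eq0 ?addr_ge0 ?sqr_ge0 // paddr_eq0 ?sqr_ge0 // !sqrf_eq0.
  move=> /andP[/andP[/eqP y0 /eqP u0] /eqP v0].
  exists 1, 0, 0, t; split; first by rewrite expr1n expr0n /= !addr0.
  apply/val_inj; rewrite /= su2_exp_imq ?expr1n ?expr0n /= ?addr0 //.
  by rewrite gE y0 u0 v0 ct s0 !mul0r.
exists (y / sin t), (u / sin t), (v / sin t), t.
have e1 : (y / sin t) ^+ 2 + (u / sin t) ^+ 2 + (v / sin t) ^+ 2 = 1.
  rewrite !exprMn -!mulrDl -st exprVn mulfV // sqrf_eq0 //.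
split=> //; apply/val_inj; rewrite /= su2_exp_imq // gE ct.
by rewrite ![sin t * _]mulrC !mulfVK.
Qed.

Lemma Lie_imq c y u v g : su2_smooth c ->
  Lie (imq y u v) c g = y%:C * Lie qi c g + u%:C * Lie qj c g + v%:C * Lie qk c g.
Proof.
move=> /su2_smoothP[A [F hF]]; have [oA sF Ag Fg] := hF.
have L := lie_imq.
rewrite (extends_Lie g hF (L y u v)) (extends_Lie g hF (L 1 0 0)).
rewrite (extends_Lie g hF (L 0 1 0)) (extends_Lie g hF (L 0 0 1)).
rewrite !(DC_coord (emb _) oA sF (Ag g)).
rewrite !mulr_sumr -!big_split /=; apply: eq_bigr => p _.
move: (DC (cdir R p) F (emb g)) => z.
rewrite !mulrA -!mulrDl; congr (_ * _); rewrite -!rmorphM -!rmorphD; congr (_%:C).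
rewrite imqE !mulmxDr -!scalemxAr.
move: (su2val g *m qi) (su2val g *m qj) (su2val g *m qk) => M N P.
by rewrite /ccoord; case: p.1.1; rewrite !mxE ?cReD ?cImD ?cReM ?cImM /= ?mul0r ?subr0 ?addr0.
Qed.

Lemma lie_qi : lie_su2 qi. Proof. exact: lie_imq. Qed.
Lemma lie_qj : lie_su2 qj. Proof. exact: lie_imq. Qed.
Lemma lie_qk : lie_su2 qk. Proof. exact: lie_imq. Qed.

Let Lie_comm c y u v y' u' v' g : su2_smooth c ->
  Lie (imq y u v) (Lie (imq y' u' v') c) g - Lie (imq y' u' v') (Lie (imq y u v) c) g =
    (2 * (u * v' - v * u'))%:C * Lie qi c g +
    (2 * (v * y' - y * v'))%:C * Lie qj c g +
    (2 * (y * u' - u * y'))%:C * Lie qk c g.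
Proof.
move=> sc; rewrite (Lie_bracket sc (lie_imq y u v) (lie_imq y' u' v')); last first.
  by rewrite lie_bracket_imq; exact: lie_imq.
by rewrite lie_bracket_imq Lie_imq.
Qed.

Lemma Lie_qij c g : su2_smooth c ->
  Lie qi (Lie qj c) g = Lie qj (Lie qi c) g + 2 * Lie qk c g.
Proof.
move=> sc; have := Lie_comm 1 0 0 0 1 0 g sc.
have -> : 2 * (0 * 0 - 0 * 1) = 0 :> R by ring.
have -> : 2 * (0 * 0 - 1 * 0) = 0 :> R by ring.
have -> : 2 * (1 * 1 - 0 * 0) = 2 :> R by ring.
have fin (x y z : C) : 0%:C * x + 0%:C * y + 2%:C * z = 2 * z.
  by rewrite (rmorph_nat (real_complex R) 2) !mul0r !add0r.
by rewrite fin => /eqP; rewrite subr_eq addrC => /eqP.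
Qed.

Lemma Lie_qjk c g : su2_smooth c ->
  Lie qj (Lie qk c) g = Lie qk (Lie qj c) g + 2 * Lie qi c g.
Proof.
move=> sc; have := Lie_comm 0 1 0 0 0 1 g sc.
have -> : 2 * (0 * 0 - 0 * 1) = 0 :> R by ring.
have -> : 2 * (0 * 0 - 1 * 0) = 0 :> R by ring.
have -> : 2 * (1 * 1 - 0 * 0) = 2 :> R by ring.
have fin (x y z : C) : 2%:C * x + 0%:C * y + 0%:C * z = 2 * x.
  by rewrite (rmorph_nat (real_complex R) 2) !mul0r !addr0.
by rewrite fin => /eqP; rewrite subr_eq addrC => /eqP.
Qed.

Lemma Lie_qki c g : su2_smooth c ->
  Lie qk (Lie qi c) g = Lie qi (Lie qk c) g + 2 * Lie qj c g.
Proof.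
move=> sc; have := Lie_comm 0 0 1 1 0 0 g sc.
have -> : 2 * (0 * 0 - 1 * 0) = 0 :> R by ring.
have -> : 2 * (0 * 0 - 0 * 1) = 0 :> R by ring.
have -> : 2 * (1 * 1 - 0 * 0) = 2 :> R by ring.
have fin (x y z : C) : 0%:C * x + 2%:C * y + 0%:C * z = 2 * y.
  by rewrite (rmorph_nat (real_complex R) 2) !mul0r addr0 add0r.
by rewrite fin => /eqP; rewrite subr_eq addrC => /eqP.
Qed.

Lemma su2_const c : su2_smooth c -> (forall g, Lie qi c g = 0) ->
  (forall g, Lie qj c g = 0) -> (forall g, Lie qk c g = 0) ->
  forall g, c g = c 1%g.
Proof.
move=> sc hi hj hk g; have [y [u [v [t [e ->]]]]] := su2_polar g.
pose f s := c (1 * su2_exp (s%:C *: imq y u v))%g.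
have d s : isdC f s 0.
  have := Lie_exp 1%g s sc (lie_imq y u v).
  by rewrite Lie_imq // hi hj hk !mulr0 !addr0.
have f0 : f 0 = c 1%g by rewrite /f exp_curve0.
have <- : f t = c (su2_exp (t%:C *: imq y u v)) by rewrite /f mul1g.
by rewrite -f0 (isdC_const d).
Qed.

Definition sphere3 : set 'rV[R]_4 := [set w | \sum_i w 0 i ^+ 2 = 1].

(** The embedding of quaternions into the ambient space, on all of [R^4], so
    that compactness and continuity are available before restricting to the
    sphere. *)
Definition qrow (w : 'rV[R]_4) : V :=
  emb (quat (w 0 0) (w 0 1) (w 0 (inord 2)) (w 0 (inord 3))).

Lemma sphere3_compact : compact sphere3.
Proof.
pose B := [set w : 'rV[R]_4 | forall i, `[(-1 : R), 1]%classic (w ord0 i)].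
have cB : compact B by apply: (@rV_compact R 4 (fun=> `[(-1 : R), 1]%classic)) => i; exact: segment_compact.
have -> : sphere3 = B `&` sphere3.
  apply/seteqP; split=> [w hw|w []//]; split=> // i; rewrite /= in_itv /=.
  rewrite -ler_norml -(@ler_pXn2r _ 2) ?nnegrE // real_normK ?num_real // expr1n.
  rewrite -hw (bigD1 i) //= lerDl; apply: sumr_ge0 => j _; exact: sqr_ge0.
apply: compact_closedI => //.
rewrite (_ : sphere3 = (fun w : 'rV[R]_4 => \sum_i w 0 i ^+ 2) @^-1` [set 1]) //.
apply: closed_comp; last exact: closed_eq.
have ci i : continuous (fun w : 'rV[R]_4 => w 0 i ^+ 2).
  by move=> w; apply: (@continuousM R _ (fun w : 'rV[R]_4 => w 0 i) (fun w : 'rV[R]_4 => w 0 i));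
    exact: coord_continuous.
move=> w _; apply: continuous_big => [|i _]; first exact: add_continuous.
exact: ci.
Qed.

Lemma qrow_continuous : continuous qrow.
Proof.
have sc k : smooth_on setT (fun w : 'rV[R]_4 => w 0 k).
  move=> n; apply: Cn_on_linear; first by move=> w; exact: coord_continuous.
  by move=> w v a; rewrite !mxE.
apply: smooth_coord_continuous => p; apply: smooth_ccoord_of.
by apply: smooth_quat => //; exact: openT.
Qed.

Lemma qrowP w : sphere3 w -> exists g, qrow w = emb (su2val g).
Proof.
rewrite /sphere3 /= => e.
exists (su2_of (w 0 0) (w 0 1) (w 0 (inord 2)) (w 0 (inord 3))).
rewrite su2_ofE //; rewrite -[RHS]e !big_ord_recl big_ord0 addr0 !addrA.
by congr (w 0 _ ^+ 2 + w 0 _ ^+ 2 + w 0 _ ^+ 2 + w 0 _ ^+ 2); apply: val_inj => //=;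
  rewrite ?inordK.
Qed.

Lemma qrow_surj g : exists2 w, sphere3 w & qrow w = emb (su2val g).
Proof.
have [x [y [u [v [e gE]]]]] := su2_quat g.
pose w : 'rV[R]_4 := \row_(i < 4) nth 0 [:: x; y; u; v] i.
exists w; last by rewrite /qrow gE !mxE /= !inordK.
by rewrite /sphere3 /= -[RHS]e !big_ord_recl big_ord0 addr0 !addrA !mxE.
Qed.

(** SU(2) is the image of the compact sphere of unit quaternions. *)
Lemma su2_max (c : SU2 R -> C) : su2_smooth c -> exists g0, forall g,
  complex.Re (c g) ^+ 2 + complex.Im (c g) ^+ 2 <=
  complex.Re (c g0) ^+ 2 + complex.Im (c g0) ^+ 2.
Proof.
move=> /su2_smoothP[A [F [oA [s1 s2] Ag Fg]]].
pose f w := complex.Re (F (qrow w)) ^+ 2 + complex.Im (F (qrow w)) ^+ 2.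
have [w0 ws _] := qrow_surj 1%g.
have [||m mS hm] := @compact_EVT_max _ R f sphere3 _ sphere3_compact.
- by exists w0.
- apply: continuous_in_subspaceT => w; rewrite inE => wS.
  have [g gE] := qrowP wS.
  have cf (h : V -> R) : smooth_on A h -> {for w, continuous (fun w => h (qrow w))}.
    move=> hs; apply: (@cvg_comp _ _ _ qrow h _ (nbhs (qrow w))).
      exact: qrow_continuous.
    by apply: (Cn_on_cont (hs 0%N)); rewrite gE.
  have c2 (h : V -> R) : smooth_on A h -> {for w, continuous (fun w => h (qrow w) ^+ 2)}.
    move=> hs; exact: (@continuousM R _ _ _ w (cf _ hs) (cf _ hs)).
  exact: (@continuousD _ _ _ _ _ w (c2 _ s1) (c2 _ s2)).
rewrite inE in mS; have [g0 g0E] := qrowP mS.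
exists g0 => g; have [w wS wE] := qrow_surj g.
have := hm w; rewrite inE => /(_ wS); rewrite /f g0E wE !Fg; exact.
Qed.

End Quaternion.

(** * The action of sl(2) and the maximum principle *)

(** Locked, so that comparing terms never unfolds the exponential. *)
HB.lock Definition Li (R : realType) (c : SU2 R -> R[i]) : SU2 R -> R[i] := Lie (qi R) c.
HB.lock Definition Lj (R : realType) (c : SU2 R -> R[i]) : SU2 R -> R[i] := Lie (qj R) c.
HB.lock Definition Lk (R : realType) (c : SU2 R -> R[i]) : SU2 R -> R[i] := Lie (qk R) c.

Section Sl2.
Variable R : realType.
Local Notation C := R[i].
Local Notation S := (@su2_smooth R).
Implicit Types (c d : SU2 R -> C) (g : SU2 R) (w : C * C * C).

Lemma LieZ Y (a : C) c g : lie_su2 Y -> S c ->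
  Lie Y (fun g => a * c g) g = a * Lie Y c g.
Proof.
move=> hY sc.
have h := LieM g hY (su2_smooth_cst a) sc; rewrite Lie_cst mul0r add0r in h.
exact: h.
Qed.

Lemma Lie_lin3 Y (a1 a2 a3 : C) c1 c2 c3 g : lie_su2 Y -> S c1 -> S c2 -> S c3 ->
  Lie Y (fun g => a1 * c1 g + a2 * c2 g + a3 * c3 g) g =
  a1 * Lie Y c1 g + a2 * Lie Y c2 g + a3 * Lie Y c3 g.
Proof.
move=> hY s1 s2 s3.
have z1 := su2_smoothZ a1 s1; have z2 := su2_smoothZ a2 s2.
have z3 := su2_smoothZ a3 s3.
have e1 := LieD g hY (su2_smoothD z1 z2) z3; have e2 := LieD g hY z1 z2.
rewrite e2 in e1.
by rewrite e1 (LieZ a1 g hY s1) (LieZ a2 g hY s2) (LieZ a3 g hY s3).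
Qed.

Lemma smooth_Li c : S c -> S (Li c).
Proof. by rewrite Li.unlock; exact: su2_smooth_Lie (lie_qi R). Qed.
Lemma smooth_Lj c : S c -> S (Lj c).
Proof. by rewrite Lj.unlock; exact: su2_smooth_Lie (lie_qj R). Qed.
Lemma smooth_Lk c : S c -> S (Lk c).
Proof. by rewrite Lk.unlock; exact: su2_smooth_Lie (lie_qk R). Qed.

Lemma Lij c g : S c -> Li (Lj c) g = Lj (Li c) g + 2 * Lk c g.
Proof. by move=> sc; rewrite Li.unlock Lj.unlock Lk.unlock; exact: Lie_qij. Qed.
Lemma Ljk c g : S c -> Lj (Lk c) g = Lk (Lj c) g + 2 * Li c g.
Proof. by move=> sc; rewrite Li.unlock Lj.unlock Lk.unlock; exact: Lie_qjk. Qed.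
Lemma Lki c g : S c -> Lk (Li c) g = Li (Lk c) g + 2 * Lj c g.
Proof. by move=> sc; rewrite Li.unlock Lj.unlock Lk.unlock; exact: Lie_qki. Qed.

(** The action of the element of the complexified Lie algebra with
    coordinates [w] in the basis [qi], [qj], [qk]. *)
Definition der w c : SU2 R -> C := fun g =>
  w.1.1 * Li c g + w.1.2 * Lj c g + w.2 * Lk c g.

Lemma smooth_der w c : S c -> S (der w c).
Proof.
move=> sc; apply: su2_smoothD; [apply: su2_smoothD|]; apply: su2_smoothZ;
  by [exact: smooth_Li|exact: smooth_Lj|exact: smooth_Lk].
Qed.

Lemma derD w c d : S c -> S d ->
  der w (fun g => c g + d g) = (fun g => der w c g + der w d g).
Proof.
move=> sc sd; apply/funext => g; rewrite /der.
have -> : Li (fun g => c g + d g) g = Li c g + Li d g.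
  by rewrite Li.unlock; exact: LieD (lie_qi R) sc sd.
have -> : Lj (fun g => c g + d g) g = Lj c g + Lj d g.
  by rewrite Lj.unlock; exact: LieD (lie_qj R) sc sd.
have -> : Lk (fun g => c g + d g) g = Lk c g + Lk d g.
  by rewrite Lk.unlock; exact: LieD (lie_qk R) sc sd.
ring.
Qed.

Lemma derM w c d : S c -> S d ->
  der w (fun g => c g * d g) = (fun g => der w c g * d g + c g * der w d g).
Proof.
move=> sc sd; apply/funext => g; rewrite /der.
have -> : Li (fun g => c g * d g) g = Li c g * d g + c g * Li d g.
  by rewrite Li.unlock; exact: LieM (lie_qi R) sc sd.
have -> : Lj (fun g => c g * d g) g = Lj c g * d g + c g * Lj d g.
  by rewrite Lj.unlock; exact: LieM (lie_qj R) sc sd.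
have -> : Lk (fun g => c g * d g) g = Lk c g * d g + c g * Lk d g.
  by rewrite Lk.unlock; exact: LieM (lie_qk R) sc sd.
ring.
Qed.

Lemma der_cst w (a : C) : der w (fun=> a) = (fun=> 0).
Proof.
apply/funext => g; rewrite /der Li.unlock Lj.unlock Lk.unlock.
by rewrite !Lie_cst !mulr0 !addr0.
Qed.

Lemma derZ w (a : C) c : S c ->
  der w (fun g => a * c g) = (fun g => a * der w c g).
Proof.
move=> sc; rewrite derM //; last exact: su2_smooth_cst.
by apply/funext => g; rewrite der_cst mul0r add0r.
Qed.

Lemma der_sum w (I : Type) (r : seq I) (c : I -> SU2 R -> C) :
  (forall i, S (c i)) ->
  S (fun g => \sum_(i <- r) c i g) /\
  der w (fun g => \sum_(i <- r) c i g) = (fun g => \sum_(i <- r) der w (c i) g).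
Proof.
move=> sc; elim: r => [|i r [IH1 IH2]].
  have -> : (fun g => \sum_(i <- [::]) c i g) = (fun=> 0).
    by apply/funext => g; rewrite big_nil.
  by split; [exact: su2_smooth_cst|rewrite der_cst; apply/funext => g; rewrite big_nil].
have -> : (fun g => \sum_(i <- i :: r) c i g) = (fun g => c i g + \sum_(i <- r) c i g).
  by apply/funext => g; rewrite big_cons.
split; first exact: su2_smoothD.
by rewrite derD // IH2; apply/funext => g; rewrite big_cons.
Qed.

Lemma der_der w w' c g : S c -> der w (der w' c) g =
  w.1.1 * (w'.1.1 * Li (Li c) g + w'.1.2 * Li (Lj c) g + w'.2 * Li (Lk c) g) +
  w.1.2 * (w'.1.1 * Lj (Li c) g + w'.1.2 * Lj (Lj c) g + w'.2 * Lj (Lk c) g) +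
  w.2 * (w'.1.1 * Lk (Li c) g + w'.1.2 * Lk (Lj c) g + w'.2 * Lk (Lk c) g).
Proof.
case: w' => [[a1 a2] a3] sc; rewrite {1}/der /=.
congr (_ * _ + _ * _ + _ * _).
- have U f : Lie (qi R) f = Li f by rewrite Li.unlock.
  have h := Lie_lin3 a1 a2 a3 g (lie_qi R) (smooth_Li sc) (smooth_Lj sc) (smooth_Lk sc).
  by rewrite !U in h; exact: h.
- have U f : Lie (qj R) f = Lj f by rewrite Lj.unlock.
  have h := Lie_lin3 a1 a2 a3 g (lie_qj R) (smooth_Li sc) (smooth_Lj sc) (smooth_Lk sc).
  by rewrite !U in h; exact: h.
- have U f : Lie (qk R) f = Lk f by rewrite Lk.unlock.
  have h := Lie_lin3 a1 a2 a3 g (lie_qk R) (smooth_Li sc) (smooth_Lj sc) (smooth_Lk sc).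
  by rewrite !U in h; exact: h.
Qed.

Lemma der_comm w w' c g : S c ->
  der w (der w' c) g - der w' (der w c) g =
  der (2 * (w.1.2 * w'.2 - w.2 * w'.1.2), 2 * (w.2 * w'.1.1 - w.1.1 * w'.2),
       2 * (w.1.1 * w'.1.2 - w.1.2 * w'.1.1)) c g.
Proof.
move=> sc; rewrite !der_der // (Lij g sc) (Ljk g sc) (Lki g sc) /der /=.
ring.
Qed.

(** The vectors acting as [rz], [lw] and [wt] are the upper and lower
    triangular nilpotent matrices and the diagonal matrix [(1, -1)]: the
    standard triple of sl(2). *)
Definition rz := der (0, 2^-1, - ('i / 2)).
Definition lw := der (0, - 2^-1, - ('i / 2)).
Definition wt := der (- 'i, 0, 0).

Lemma i2 : 'i * 'i = -1 :> C. Proof. by rewrite -expr2 sqr_i. Qed.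

Lemma comm_rl c g : S c -> rz (lw c) g - lw (rz c) g = wt c g.
Proof.
move=> sc; rewrite /rz /lw /wt der_comm //=; congr der; congr (_, _, _); last by ring.
  by field.
by ring.
Qed.

Lemma comm_wr c g : S c -> wt (rz c) g - rz (wt c) g = 2 * rz c g.
Proof.
move=> sc; rewrite /rz /wt der_comm //= /der /=.
have -> : 2 * (- 'i * 2^-1 - 0 * 0) = 2 * (- ('i / 2)) :> C by ring.
have -> : 2 * (0 * 0 - - 'i * - ('i / 2)) = 2 * 2^-1 :> C.
  have -> : 2 * (0 * 0 - - 'i * - ('i / 2)) = - 2 * ('i * 'i) / 2 :> C by ring.
  by rewrite i2; ring.
ring.
Qed.

Lemma comm_wl c g : S c -> wt (lw c) g - lw (wt c) g = - 2 * lw c g.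
Proof.
move=> sc; rewrite /lw /wt der_comm //= /der /=.
have -> : 2 * (- 'i * - 2^-1 - 0 * 0) = - 2 * (- ('i / 2)) :> C by ring.
have -> : 2 * (0 * 0 - - 'i * - ('i / 2)) = - 2 * (- 2^-1) :> C.
  have -> : 2 * (0 * 0 - - 'i * - ('i / 2)) = - 2 * ('i * 'i) / 2 :> C by ring.
  by rewrite i2; ring.
ring.
Qed.

(** Smooth functions of weight [z] for the right action of the torus. *)
Definition W (z : C) c := S c /\ wt c = (fun g => z * c g).

Lemma W_rz z c : W z c -> W (z + 2) (rz c).
Proof.
move=> [sc wc]; split; first exact: smooth_der.
apply/funext => g; have := comm_wr g sc; rewrite wc.
by rewrite /rz derZ // => /eqP; rewrite subr_eq => /eqP ->; ring.
Qed.

Lemma W_lw z c : W z c -> W (z - 2) (lw c).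
Proof.
move=> [sc wc]; split; first exact: smooth_der.
apply/funext => g; have := comm_wl g sc; rewrite wc.
by rewrite /lw derZ // => /eqP; rewrite subr_eq => /eqP ->; ring.
Qed.

Lemma second_derivative_max (phi phi1 : R -> R) l :
  (forall t, is_derive (t : R) (1 : R) phi (phi1 t)) ->
  is_derive (0 : R) (1 : R) phi1 l -> (forall t, phi t <= phi 0) -> l <= 0.
Proof.
move=> d1 d2 mx; rewrite leNgt; apply/negP => l0.
have p0 : phi1 0 = 0.
  have i0 : (0 : R) \in `]-1, 1[ by rewrite in_itv /=; lra.
  have lt11 : (-1 : R) <= 1 by lra.
  have [_ h] := @derive1_at_max R phi (-1) 1 0 lt11
    (fun t _ => @ex_derive _ _ _ _ _ _ _ (d1 t)) i0 (fun t _ => mx t).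
  by have [_ <-] := d1 0; rewrite h.
have /is_derive1P := d2; rewrite p0 => /cvgrPdist_lt /(_ _ l0).
move=> /nbhs_ballP[r /= r0 hr].
pose t := r / 2; have t0 : 0 < t by rewrite divr_gt0.
have [|s sI] := @MVT R phi phi1 0 t t0 (fun s _ => d1 s).
  by apply: continuous_subspaceT => s; exact: (is_derive_continuous (d1 s)).
rewrite subr0 => E.
move: sI; rewrite in_itv /= => /andP[s0 st].
have : ball (0 : R) r s.
  rewrite /ball /= sub0r normrN gtr0_norm // (lt_trans st) // /t; lra.
move=> /hr /(_ (lt0r_neq0 s0)); rewrite add0r subr0 => hs.
have : 0 < s^-1 * phi1 s by move: hs; rewrite ltr_norml /GRing.scale /=; lra.
rewrite pmulr_rgt0 ?invr_gt0 // => ps.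
have := mx t; rewrite -subr_le0 E leNgt; move/negP; apply.
exact: mulr_gt0.
Qed.

(** Half the second derivative of [|c|^2] along a one-parameter subgroup is
    [Re (conj c * c'') + |c'|^2], and it is nonpositive at a maximum. *)
Lemma maximum_Lie2 c (Y : 'M[C]_2) g0 : S c -> lie_su2 Y ->
  (forall g, complex.Re (c g) ^+ 2 + complex.Im (c g) ^+ 2 <=
    complex.Re (c g0) ^+ 2 + complex.Im (c g0) ^+ 2) ->
  complex.Re ((c g0)^* * Lie Y (Lie Y c) g0) <= 0.
Proof.
move=> sc hY mx; have sL := su2_smooth_Lie hY sc.
pose gm s := (g0 * su2_exp (s%:C *: Y))%g.
pose p s := complex.Re (c (gm s)); pose q s := complex.Im (c (gm s)).
pose p1 s := complex.Re (Lie Y c (gm s)); pose q1 s := complex.Im (Lie Y c (gm s)).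
have dp s : is_derive (s : R) (1 : R) p (p1 s) by have [] := Lie_exp g0 s sc hY.
have dq s : is_derive (s : R) (1 : R) q (q1 s) by have [] := Lie_exp g0 s sc hY.
have [dp1' dq1'] := Lie_exp0 g0 sL hY.
set r := complex.Re (Lie Y (Lie Y c) g0) in dp1'.
set u := complex.Im (Lie Y (Lie Y c) g0) in dq1'.
have dp1 : is_derive (0 : R) (1 : R) p1 r by exact: dp1'.
have dq1 : is_derive (0 : R) (1 : R) q1 u by exact: dq1'.
have g00 : gm 0 = g0 by exact: exp_curve0.
have D : is_derive (0 : R) (1 : R)
    (fun s => (p1 s * p s + p s * p1 s) + (q1 s * q s + q s * q1 s))
    ((r * p 0 + p1 0 * p1 0) + (p1 0 * p1 0 + p 0 * r) +
     ((u * q 0 + q1 0 * q1 0) + (q1 0 * q1 0 + q 0 * u))).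
  exact: (is_deriveD (is_deriveD (is_derive1M dp1 (dp 0)) (is_derive1M (dp 0) dp1))
     (is_deriveD (is_derive1M dq1 (dq 0)) (is_derive1M (dq 0) dq1))).
have d s : is_derive (s : R) (1 : R) (fun s => p s * p s + q s * q s)
    (p1 s * p s + p s * p1 s + (q1 s * q s + q s * q1 s)).
  exact: (is_deriveD (is_derive1M (dp s) (dp s)) (is_derive1M (dq s) (dq s))).
have H s : p s * p s + q s * q s <= p 0 * p 0 + q 0 * q 0.
  by have := mx (gm s); rewrite !expr2 /p /q g00.
have {H d D} := second_derivative_max d D H.
have -> : complex.Re ((c g0)^* * Lie Y (Lie Y c) g0) = p 0 * r + q 0 * u.
  rewrite /p /q g00 /r /u; move: (Lie _ _ g0) => z.
  by case: (c g0) z => a b [x y] /=; ring.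
have := sqr_ge0 (p1 0); have := sqr_ge0 (q1 0); rewrite !expr2.
move: (p 0) (q 0) (p1 0) (q1 0) (r) (u) => p0 q0 p10 q10 r' u'; lra.
Qed.

(** The Casimir operator without its torus part. *)
Lemma sum_squares c g : S c ->
  Lj (Lj c) g + Lk (Lk c) g =
  - 2 * (rz (lw c) g + lw (rz c) g).
Proof.
move=> sc; rewrite /rz /lw !der_der //=.
transitivity (Lj (Lj c) g - 'i * 'i * Lk (Lk c) g); first by rewrite i2; ring.
by field.
Qed.

(** By [sum_squares] and the relation of [rz] and [lw], the operator [Lj^2 +
    Lk^2] multiplies [c] by [2 z - 4 rho]; at a maximum of [|c|] this
    contradicts [maximum_Lie2] unless the maximum is [0]. *)
Lemma max_principle z rho c : W z c -> rz (lw c) = (fun g => rho * c g) ->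
  0 < complex.Re (2 * z - 4 * rho) -> c = (fun=> 0).
Proof.
move=> [sc wc] ab pos.
have [g0 mx] := su2_max sc.
have hj := maximum_Lie2 sc (lie_qj R) mx.
have hk := maximum_Lie2 sc (lie_qk R) mx.
have e : Lj (Lj c) g0 + Lk (Lk c) g0 =
    (2 * z - 4 * rho) * c g0.
  rewrite sum_squares //; have := comm_rl g0 sc.
  rewrite ab wc => /eqP; rewrite subr_eq => /eqP h.
  have -> : lw (rz c) g0 = rho * c g0 - z * c g0 by rewrite h; ring.
  ring.
have : complex.Re ((c g0)^* * ((2 * z - 4 * rho) * c g0)) <= 0.
  rewrite -e mulrDr cReD Lj.unlock Lk.unlock.
  by have := lerD hj hk; rewrite addr0.
move: (2 * z - 4 * rho) pos => k pos.
have -> : complex.Re ((c g0)^* * (k * c g0)) =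
    complex.Re k * (complex.Re (c g0) ^+ 2 + complex.Im (c g0) ^+ 2).
  by rewrite !(cReM, cImM); case: (c g0) => a b /=; ring.
rewrite pmulr_rle0 // => le0; apply/funext => g.
have := le_trans (mx g) le0 => h; apply/eqP; rewrite eq_complex /=.
have : complex.Re (c g) ^+ 2 + complex.Im (c g) ^+ 2 == 0.
  by rewrite eq_le h addr_ge0 ?sqr_ge0.
by rewrite paddr_eq0 ?sqr_ge0 // !sqrf_eq0.
Qed.

End Sl2.

(** * Ladders of eigenfunctions *)

Section Ladder.
Variable R : realType.
Local Notation C := R[i].
Local Notation S := (@su2_smooth R).
Local Notation rz := (@rz R).
Local Notation lw := (@lw R).
Local Notation wt := (@wt R).
Implicit Types (c u v : SU2 R -> C) (g : SU2 R) (z rho : C).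

Lemma lwZ (a : C) c : S c -> lw (fun g => a * c g) = (fun g => a * lw c g).
Proof. exact: derZ. Qed.
Lemma rzZ (a : C) c : S c -> rz (fun g => a * c g) = (fun g => a * rz c g).
Proof. exact: derZ. Qed.

Lemma W_iter_lw z c k : W z c -> W (z - 2 * k%:R) (iter k lw c).
Proof.
move=> Wc; elim: k => [|k IH] /=; first by rewrite mulr0 subr0.
have := W_lw IH; rewrite -natr1; congr W; ring.
Qed.

Lemma W_iter_rz z c k : W z c -> W (z + 2 * k%:R) (iter k rz c).
Proof.
move=> Wc; elim: k => [|k IH] /=; first by rewrite mulr0 addr0.
have := W_rz IH; rewrite -natr1; congr W; ring.
Qed.

Lemma iter_der_smooth w k c : S c -> S (iter k (der w) c).
Proof. by move=> sc; elim: k => //= k IH; exact: smooth_der. Qed.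

Lemma iter_derZ w k (a : C) c : S c ->
  iter k (der w) (fun g => a * c g) = (fun g => a * iter k (der w) c g).
Proof.
by move=> sc; elim: k => //= k ->; rewrite derZ //; exact: iter_der_smooth.
Qed.

Lemma iter_derD w k c d : S c -> S d ->
  iter k (der w) (fun g => c g + d g) =
  (fun g => iter k (der w) c g + iter k (der w) d g).
Proof.
by move=> sc sd; elim: k => //= k ->; rewrite derD //; exact: iter_der_smooth.
Qed.

(** Commuting [rz] past one more [lw] adds the weight of the function reached
    so far, and these weights form an arithmetic progression. *)
Lemma rl_iter z rho u k : W z u -> rz (lw u) = (fun g => rho * u g) ->
  rz (lw (iter k lw u)) =
  (fun g => (rho + k%:R * z - k%:R * k.+1%:R) * iter k lw u g).
Proof.
move=> Wu h; elim: k => [|k IH] /=.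
  by rewrite h; apply/funext => g; rewrite !mul0r addr0 subr0.
have [sk wk] := W_iter_lw k.+1 Wu.
apply/funext => g; have := comm_rl g sk; rewrite wk /= IH.
rewrite lwZ; last by have [] := W_iter_lw k Wu.
move=> /eqP; rewrite subr_eq => /eqP ->.
rewrite -!natr1; ring.
Qed.

Lemma lw_iter_eq0 z rho u k : W z u -> rz (lw u) = (fun g => rho * u g) ->
  (forall i, (i < k)%N -> rho + i%:R * z - i%:R * i.+1%:R != 0) ->
  iter k lw u = (fun=> 0) -> u = (fun=> 0).
Proof.
move=> Wu h; elim: k => [//|k IH] ne /= e.
apply: IH => [i ik|]; first by apply: ne; rewrite ltnS ltnW.
have := rl_iter k Wu h; rewrite e /rz der_cst => /(congr1 (fun f => f _)) f0.
apply/funext => g; have /eqP := f0 g; rewrite eq_sym mulf_eq0.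
by rewrite (negbTE (ne k (ltnSn k))) => /eqP.
Qed.

Lemma rz_lw_iter z rho u k : W z u -> rz (lw u) = (fun g => rho * u g) ->
  iter k rz (iter k lw u) =
  (fun g => (\prod_(i < k) (rho + i%:R * z - i%:R * i.+1%:R)) * u g).
Proof.
move=> Wu h; elim: k => [|k IH].
  by apply/funext => g; rewrite big_ord0 mul1r.
rewrite iterSr iterS (rl_iter k Wu h) iter_derZ; last by have [] := W_iter_lw k Wu.
rewrite IH; apply/funext => g; rewrite big_ord_recr /=; ring.
Qed.

(** At weight [-n] the factors of the ladder become differences with the
    expected eigenvalues. *)
Lemma rho_ladder (n : nat) rho (k : nat) :
  rho + k%:R * (- n%:R) - k%:R * k.+1%:R = rho - (k * (k + n + 1))%:R :> C.
Proof. by rewrite !natrM !natrD -natr1; ring. Qed.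

(** After [k] lowerings the maximum principle applies as soon as [k] exceeds
    [Re rho], because the shifted eigenvalue decreases quadratically; none of
    the factors that undo the lowerings vanishes. *)
Lemma weight_eigen_eq0 (n : nat) rho u : W (- n%:R) u ->
  rz (lw u) = (fun g => rho * u g) ->
  (forall j : nat, rho != (j * (j + n + 1))%:R) -> u = (fun=> 0).
Proof.
move=> Wu h ne.
(* any integer above Re rho and at least 1 will do *)
pose k := (Num.bound `|complex.Re rho|).+1.
apply: (lw_iter_eq0 (k := k) Wu h) => [i _|]; first by rewrite rho_ladder subr_eq0.
have Wk := W_iter_lw k Wu; have hk := rl_iter k Wu h.
apply: (max_principle Wk hk).
rewrite rho_ladder.
have -> : 2 * (- n%:R - 2 * k%:R) - 4 * (rho - (k * (k + n + 1))%:R) =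
  (4 * (k * (k + n + 1))%:R - 2 * n%:R - 4 * k%:R)%:C - 4%:C * rho :> C.
  rewrite !(rmorphB, rmorphM, rmorph_nat) /=; ring.
rewrite cReD cReN cReM /= mul0r subr0.
have b : complex.Re rho < (Num.bound `|complex.Re rho|)%:R.
  exact: le_lt_trans (ler_norm _) (archi_boundP (normr_ge0 _)).
have : complex.Re rho < k%:R by rewrite (lt_trans b) // ltr_nat.
have : (1 : R) <= k%:R by rewrite ler1n.
have : (0 : R) <= n%:R by rewrite ler0n.
rewrite !natrM !natrD; move: (k%:R) (n%:R) (complex.Re rho) => K N r; nra.
Qed.

(** One more lowering reaches a function to which the maximum principle
    applies. *)
Lemma lw_extremal (n j : nat) u : W (- n%:R) u ->
  rz (lw u) = (fun g => (j * (j + n + 1))%:R * u g) ->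
  lw (iter j lw u) = (fun=> 0).
Proof.
move=> Wu h; have Wk := W_iter_lw j.+1 Wu; have hk := rl_iter j.+1 Wu h.
apply: (max_principle Wk hk); rewrite rho_ladder.
have -> : 2 * (- n%:R - 2 * j.+1%:R) - 4 * ((j * (j + n + 1))%:R - (j.+1 * (j.+1 + n + 1))%:R) =
   (2 * n + 4 * j + 4)%:R%:C :> C.
  by rewrite rmorph_nat !(natrD, natrM) -!natr1; ring.
by rewrite /= ltr0n addn_gt0 orbT.
Qed.

Lemma lr_iter (m : nat) v k : W (- m%:R) v -> lw v = (fun=> 0) ->
  lw (iter k.+1 rz v) = (fun g => (k.+1%:R * (m%:R - k%:R)) * iter k rz v g).
Proof.
move=> Wv lv; elim: k => [|k IH]; apply/funext => g.
  have [sv wv] := Wv; have := comm_rl g sv; rewrite /= lv wv /rz der_cst sub0r.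
  by move/eqP; rewrite eqr_oppLR => /eqP ->; ring.
have [sk wk] := W_iter_rz k.+1 Wv; have := comm_rl g sk; rewrite wk IH.
rewrite rzZ; last by have [] := W_iter_rz k Wv.
have solve (A L B : C) : A - L = B -> L = A - B by move=> <-; ring.
move=> /solve ->.
rewrite -[k.+2%:R]natr1 -![k.+1%:R]natr1 /=; ring.
Qed.

(** The string of a lowest weight function of weight [-m] cannot have more
    than [m+1] terms: the next one would be a nonzero eigenfunction of
    positive weight with eigenvalue [0]. *)
Lemma rz_extremal (m : nat) v : W (- m%:R) v -> lw v = (fun=> 0) ->
  iter m.+1 rz v = (fun=> 0).
Proof.
move=> Wv lv; have Wk := W_iter_rz m.+1 Wv.
apply: (max_principle (rho := 0) Wk).
  rewrite (lr_iter m Wv lv) rzZ; last by have [] := W_iter_rz m Wv.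
  by apply/funext => g; rewrite subrr mulr0 !mul0r.
rewrite mulr0 subr0.
have -> : 2 * (- m%:R + 2 * m.+1%:R) = (2 * m + 4)%:R%:C :> C.
  by rewrite rmorph_nat !(natrD, natrM) -!natr1; ring.
by rewrite /= ltr0n addn_gt0 orbT.
Qed.

Lemma lw_rz_iter (m : nat) v k : W (- m%:R) v -> lw v = (fun=> 0) ->
  iter k lw (iter k rz v) =
  (fun g => (\prod_(i < k) (i.+1%:R * (m%:R - i%:R))) * v g).
Proof.
move=> Wv lv; elim: k => [|k IH].
  by apply/funext => g; rewrite big_ord0 mul1r.
rewrite iterSr (lr_iter k Wv lv) iter_derZ; last by have [] := W_iter_rz k Wv.
rewrite IH; apply/funext => g; rewrite big_ord_recr /=; ring.
Qed.

(** The three operators span the derivatives along [qi], [qj] and [qk]. *)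
Lemma der0_const c : S c -> rz c = (fun=> 0) -> lw c = (fun=> 0) ->
  wt c = (fun=> 0) -> forall g, c g = c 1%g.
Proof.
move=> sc hr hl hw.
have er g : rz c g = 0 by rewrite hr.
have el g : lw c g = 0 by rewrite hl.
have ew g : wt c g = 0 by rewrite hw.
have i20 := i2 R.
apply: su2_const => // g.
- have : Li c g = 'i * wt c g.
    rewrite /wt /der /=; transitivity (- ('i * 'i) * Li c g); last by ring.
    by rewrite i20; ring.
  by rewrite Li.unlock => ->; rewrite ew mulr0.
- have : Lj c g = rz c g - lw c g by rewrite /rz /lw /der /=; field.
  by rewrite Lj.unlock => ->; rewrite er el subrr.
- have : Lk c g = 'i * (rz c g + lw c g).
    rewrite /rz /lw /der /=; transitivity (- ('i * 'i) * Lk c g); last by field.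
    by rewrite i20; ring.
  by rewrite Lk.unlock => ->; rewrite er el addr0 mulr0.
Qed.

Lemma Lie_entry Y i j g : lie_su2 Y ->
  Lie Y (fun g : SU2 R => g i j) g = (su2val g *m Y) i j.
Proof. by move=> hY; exact: isdC_derive1C (exp_curve_at0 g i j hY). Qed.

Lemma der_entry0 w i : der w (fun g : SU2 R => g i 0) =
  (fun g => w.1.1 * 'i * g i 0 + (w.2 * 'i - w.1.2) * g i 1).
Proof.
apply/funext => g; rewrite /der Li.unlock Lj.unlock Lk.unlock.
rewrite (Lie_entry i 0 g (lie_qi R)) (Lie_entry i 0 g (lie_qj R)) (Lie_entry i 0 g (lie_qk R)).
rewrite !mulmx22 !mx22E.
have -> : 0 +i* 1 = ('i)%R :> C by [].
have -> : (- 0) +i* 0 = 0 :> C by apply: ceq; rewrite /= ?oppr0.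
have -> : (- 1) +i* 0 = - 1 :> C by apply: ceq; rewrite /= ?oppr0.
have -> : (- 0) +i* 1 = ('i)%R :> C by apply: ceq; rewrite /= ?oppr0.
have -> : 0 +i* 0 = 0 :> C by [].
ring.
Qed.

Lemma der_entry1 w i : der w (fun g : SU2 R => g i 1) =
  (fun g => - (w.1.1 * 'i) * g i 1 + (w.2 * 'i + w.1.2) * g i 0).
Proof.
apply/funext => g; rewrite /der Li.unlock Lj.unlock Lk.unlock.
rewrite (Lie_entry i 1 g (lie_qi R)) (Lie_entry i 1 g (lie_qj R)) (Lie_entry i 1 g (lie_qk R)).
rewrite !mulmx22 !mx22E.
have -> : 0 -i* 1 = (- 'i)%R :> C by apply: ceq; rewrite /= ?oppr0.
have -> : 0 +i* 1 = ('i)%R :> C by [].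
have -> : 1 +i* 0 = 1 :> C by [].
have -> : 0 -i* 0 = 0 :> C by apply: ceq; rewrite /= ?oppr0.
have -> : 0 +i* 0 = 0 :> C by [].
ring.
Qed.

Lemma smoothX c k : S c -> S (fun g => c g ^+ k).
Proof.
move=> sc; elim: k => [|k IH]; first exact: su2_smooth_cst.
by under eq_fun do rewrite exprS; exact: su2_smoothM.
Qed.

Lemma derX w c k : S c ->
  der w (fun g => c g ^+ k) = (fun g => k%:R * c g ^+ k.-1 * der w c g).
Proof.
move=> sc; elim: k => [|k IH].
  by rewrite der_cst; apply/funext => g; rewrite !mul0r.
have -> : (fun g => c g ^+ k.+1) = (fun g => c g * c g ^+ k).
  by apply/funext => g; rewrite exprS.
rewrite derM //; last exact: smoothX.
rewrite IH; apply/funext => g; rewrite /= -natr1.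
case: k {IH} => [|k]; first by rewrite expr0; ring.
rewrite /= exprS; ring.
Qed.

End Ladder.

(** * Lowest weight functions are binary forms *)

Section Forms.
Variable R : realType.
Local Notation C := R[i].
Local Notation S := (@su2_smooth R).
Local Notation rz := (@rz R).
Local Notation lw := (@lw R).
Local Notation wt := (@wt R).
Implicit Types (c u v f : SU2 R -> C) (g : SU2 R) (z rho : C).

Let iiN1 : 'i * 'i = -1 :> C := i2 R.

Lemma rz_entry1 i : rz (fun g => g i 1) = (fun g => g i 0).
Proof.
rewrite /rz der_entry1 /=; apply/funext => g.
transitivity (- ('i * 'i) / 2 * g i 0 + 2^-1 * g i 0); first by ring.
by rewrite iiN1; field.
Qed.

Lemma rz_entry0 i : rz (fun g => g i 0) = (fun=> 0).
Proof.
rewrite /rz der_entry0 /=; apply/funext => g.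
transitivity (- ('i * 'i) / 2 * g i 1 - 2^-1 * g i 1); first by ring.
by rewrite iiN1; ring.
Qed.

Lemma lw_entry1 i : lw (fun g => g i 1) = (fun=> 0).
Proof.
rewrite /lw der_entry1 /=; apply/funext => g.
transitivity (- ('i * 'i) / 2 * g i 0 - 2^-1 * g i 0); first by ring.
by rewrite iiN1; ring.
Qed.

Lemma lw_entry0 i : lw (fun g => g i 0) = (fun g => g i 1).
Proof.
rewrite /lw der_entry0 /=; apply/funext => g.
transitivity (- ('i * 'i) / 2 * g i 1 + 2^-1 * g i 1); first by ring.
by rewrite iiN1; field.
Qed.

Lemma W_entry0 i : W 1 (fun g : SU2 R => g i 0).
Proof.
split; first exact: su2_smooth_entry.
rewrite /wt der_entry0 /=; apply/funext => g.
transitivity (- ('i * 'i) * g i 0); first by ring.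
by rewrite iiN1; ring.
Qed.

Lemma W_entry1 i : W (- 1) (fun g : SU2 R => g i 1).
Proof.
split; first exact: su2_smooth_entry.
rewrite /wt der_entry1 /=; apply/funext => g.
transitivity ('i * 'i * g i 1); first by ring.
by rewrite iiN1; ring.
Qed.

Lemma WM z z' c f : W z c -> W z' f -> W (z + z') (fun g => c g * f g).
Proof.
move=> [sc wc] [sf wf]; split; first exact: su2_smoothM.
by rewrite /wt derM // -/wt wc wf; apply/funext => g; ring.
Qed.

Lemma WZ z (a : C) c : W z c -> W z (fun g => a * c g).
Proof.
move=> [sc wc]; split; first exact: su2_smoothZ.
by rewrite /wt derZ // -/wt wc; apply/funext => g; ring.
Qed.

Lemma WD z c f : W z c -> W z f -> W z (fun g => c g + f g).
Proof.
move=> [sc wc] [sf wf]; split; first exact: su2_smoothD.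
by rewrite /wt derD // -/wt wc wf; apply/funext => g; ring.
Qed.

Lemma WX z c k : W z c -> W (k%:R * z) (fun g => c g ^+ k).
Proof.
move=> Wc; elim: k => [|k IH].
  by split; [exact: su2_smooth_cst|rewrite /wt der_cst; apply/funext => g; ring].
have -> : (fun g => c g ^+ k.+1) = (fun g => c g * c g ^+ k).
  by apply/funext => g; rewrite exprS.
by have := WM Wc IH; congr W; rewrite -natr1; ring.
Qed.

Lemma W_sum z (I : Type) (r : seq I) (F : I -> SU2 R -> C) :
  (forall i, W z (F i)) -> W z (fun g => \sum_(i <- r) F i g).
Proof.
move=> h; have [s w] := der_sum (- 'i, 0, 0) r (fun i => (h i).1).
split=> //; rewrite /wt w; apply/funext => g; rewrite mulr_sumr.
by apply: eq_bigr => i _; have [_ +] := h i; rewrite /wt => ->.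
Qed.

(** The root vector [lw] kills the entries of the second column, so functions
    of this column are the natural lowest weight functions. *)
Definition col1 g : 'cV[C]_2 := col 1 (su2val g).

Lemma form_lowest m (p : 'cV[C]_2 -> C) : Virr m p ->
  W (- m%:R) (fun g => p (col1 g)) /\ lw (fun g => p (col1 g)) = (fun=> 0).
Proof.
move=> [a pE].
have -> : (fun g => p (col1 g)) =
    (fun g => \sum_(j < m.+1) a j * (g 0 1 ^+ j * g 1 1 ^+ (m - j))).
  by apply/funext => g; rewrite pE; apply: eq_bigr => j _; rewrite !mxE mulrA.
have sX i k : S (fun g => g i 1 ^+ k) by apply: smoothX; exact: su2_smooth_entry.
have lX i k : lw (fun g => g i 1 ^+ k) = (fun=> 0).
  rewrite /lw derX; last exact: su2_smooth_entry.
  by rewrite -/lw lw_entry1; apply/funext => g; rewrite mulr0.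
split.
  apply: W_sum => j; apply: WZ.
  have jm : (j <= m)%N by rewrite -ltnS.
  have := WM (WX j (W_entry1 0)) (WX (m - j) (W_entry1 1)).
  congr W; rewrite natrB //; ring.
have sj j : S (fun g : SU2 R => a j * (g 0 1 ^+ j * g 1 1 ^+ (m - j))).
  by apply: su2_smoothZ; apply: su2_smoothM.
have [_ h] := der_sum (0, - 2^-1, - ('i / 2)) (index_enum 'I_m.+1) sj.
rewrite /lw h; apply/funext => g; apply: big1 => j _.
rewrite derZ; last by apply: su2_smoothM.
rewrite derM // -/lw; have := lX 0 j; have := lX 1 (m - j)%N; rewrite /lw => -> ->.
by rewrite mul0r mulr0 addr0 mulr0.
Qed.

Section LowestForm.
Variables (m : nat) (v : SU2 R -> C).
Hypotheses (Wv : W (- m%:R) v) (lv : lw v = (fun=> 0)).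

Let vk k := iter k rz v.
Let svk k : S (vk k). Proof. by have [] := W_iter_rz k Wv. Qed.

Section FixedPoint.
Variable z : 'cV[C]_2.

Let w0 g : C := z 0 0 * g 1 1 - z 1 0 * g 0 1.
Let w1 g : C := z 1 0 * g 0 0 - z 0 0 * g 1 0.

Let lin (a b : C) i j i' j' : S (fun g => a * g i j - b * g i' j') /\
  forall w, der w (fun g => a * g i j - b * g i' j') =
    (fun g => a * der w (fun g => g i j) g - b * der w (fun g => g i' j') g).
Proof.
have s := @su2_smooth_entry R.
have -> : (fun g : SU2 R => a * g i j - b * g i' j') =
   (fun g => a * g i j + (- b) * g i' j').
  by apply/funext => g; rewrite mulNr.
split; first by apply: su2_smoothD; exact: su2_smoothZ.
move=> w; rewrite derD; [|exact: su2_smoothZ|exact: su2_smoothZ].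
by rewrite !derZ //; apply/funext => g; rewrite mulNr.
Qed.

Let s0 : S w0. Proof. by have [] := lin (z 0 0) (z 1 0) 1 1 0 1. Qed.
Let s1 : S w1. Proof. by have [] := lin (z 1 0) (z 0 0) 0 0 1 0. Qed.

Let rw0 : rz w0 = (fun g => - w1 g).
Proof.
have [_ h] := lin (z 0 0) (z 1 0) 1 1 0 1.
rewrite /w0 /rz h -/rz; have := rz_entry1 1; have := rz_entry1 0; rewrite /rz => -> ->.
by apply/funext => g; rewrite /w1; ring.
Qed.
Let rw1 : rz w1 = (fun=> 0).
Proof.
have [_ h] := lin (z 1 0) (z 0 0) 0 0 1 0.
rewrite /w1 /rz h; have := rz_entry0 1; have := rz_entry0 0; rewrite /rz => -> ->.
by apply/funext => g; ring.
Qed.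
Let lw0 : lw w0 = (fun=> 0).
Proof.
have [_ h] := lin (z 0 0) (z 1 0) 1 1 0 1.
rewrite /w0 /lw h; have := lw_entry1 1; have := lw_entry1 0; rewrite /lw => -> ->.
by apply/funext => g; ring.
Qed.
Let lw1 : lw w1 = (fun g => - w0 g).
Proof.
have [_ h] := lin (z 1 0) (z 0 0) 0 0 1 0.
rewrite /w1 /lw h; have := lw_entry0 1; have := lw_entry0 0; rewrite /lw => -> ->.
by apply/funext => g; rewrite /w0; ring.
Qed.
Let Ww0 : W (-1) w0.
Proof.
split=> //; have [_ h] := lin (z 0 0) (z 1 0) 1 1 0 1.
rewrite /w0 /wt h; have := (W_entry1 1).2; have := (W_entry1 0).2; rewrite /wt => -> ->.
by apply/funext => g; ring.
Qed.
Let Ww1 : W 1 w1.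
Proof.
split=> //; have [_ h] := lin (z 1 0) (z 0 0) 0 0 1 0.
rewrite /w1 /wt h; have := (W_entry0 1).2; have := (W_entry0 0).2; rewrite /wt => -> ->.
by apply/funext => g; ring.
Qed.

Let T k g : C := (k`!%:R)^-1 * (w0 g ^+ k * w1 g ^+ (m - k) * vk k g).
Let G g : C := \sum_(k < m.+1) T k g.

Let sT k : S (T k).
Proof.
apply: su2_smoothZ; apply: su2_smoothM; last exact: svk.
by apply: su2_smoothM; exact: smoothX.
Qed.

Let derT w k g : der w (T k) g = (k`!%:R)^-1 *
  (k%:R * w0 g ^+ k.-1 * der w w0 g * w1 g ^+ (m - k) * vk k g +
   w0 g ^+ k * ((m - k)%:R * w1 g ^+ (m - k).-1 * der w w1 g) * vk k g +
   w0 g ^+ k * w1 g ^+ (m - k) * der w (vk k) g).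
Proof.
have sx0 : S (fun g => w0 g ^+ k) by exact: smoothX.
have sx1 : S (fun g => w1 g ^+ (m - k)) by exact: smoothX.
rewrite /T derZ; last by apply: su2_smoothM; [exact: su2_smoothM|exact: svk].
rewrite derM; [|exact: su2_smoothM|exact: svk].
by rewrite derM // !derX //; congr (_ * _); ring.
Qed.

Let facS k : ((k.+1)`!%:R)^-1 * k.+1%:R = (k`!%:R)^-1 :> C.
Proof.
by rewrite factS natrM invfM mulrC mulrA mulfV ?mul1r // pnatr_eq0.
Qed.

Let derG w : S G /\ der w G = (fun g => \sum_(0 <= k < m.+1) der w (T k) g).
Proof.
have [s h] := der_sum w (index_enum 'I_m.+1) (fun k : 'I_m.+1 => sT k).
by split=> //; rewrite h; apply/funext => g; rewrite big_mkord.
Qed.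

Let rG : rz G = (fun=> 0).
Proof.
have [_ h] := derG (0, 2^-1, - ('i / 2)); rewrite /rz h -/rz; apply/funext => g.
(* rz sends w0 to -w1 and kills w1, so each term splits in two *)
pose A k : C := (k`!%:R)^-1 * k%:R * w0 g ^+ k.-1 * w1 g ^+ (m.+1 - k) * vk k g.
have E k : (k <= m)%N -> der (0, 2^-1, - ('i / 2)) (T k) g = A k.+1 - A k.
  move=> km; rewrite derT -/rz; have := rw0; have := rw1; rewrite /rz => -> ->.
  rewrite -/rz -[rz (vk k) g]/(vk k.+1 g) /A facS subSS (subSn km) exprS /=; ring.
have -> : \sum_(0 <= k < m.+1) der (0, 2^-1, - ('i / 2)) (T k) g = A m.+1 - A 0%N.
  by apply: telescope_sumr_eq => // k /andP[_ km]; exact: E.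
have v0 : vk m.+1 g = 0 by rewrite /vk (rz_extremal Wv lv).
by rewrite /A v0 /=; ring.
Qed.

Let lG : lw G = (fun=> 0).
Proof.
have [_ h] := derG (0, - 2^-1, - ('i / 2)); rewrite /lw h -/lw; apply/funext => g.
(* lw sends w1 to -w0, kills w0, and lowers the string of v *)
pose B k : C := - ((k`!%:R)^-1 * k%:R * (m%:R + 1 - k%:R)) * w0 g ^+ k *
   w1 g ^+ (m - k) * vk k.-1 g.
have E k : (k <= m)%N -> der (0, - 2^-1, - ('i / 2)) (T k) g = B k.+1 - B k.
  move=> km; rewrite derT; have := lw0; have := lw1; rewrite /lw => -> ->.
  have -> : der (0, - 2^-1, - ('i / 2)) (vk k) g =
      k%:R * (m%:R + 1 - k%:R) * vk k.-1 g.
    case: k {km} => [|k]; first by have := lv; rewrite /lw /= => ->; ring.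
    have := lr_iter k Wv lv; rewrite /lw /vk => ->; rewrite -!natr1 /=; ring.
  rewrite /B facS subnS -[k.+1%:R]natr1 natrB // exprS /=; ring.
have -> : \sum_(0 <= k < m.+1) der (0, - 2^-1, - ('i / 2)) (T k) g = B m.+1 - B 0%N.
  by apply: telescope_sumr_eq => // k /andP[_ km]; exact: E.
by rewrite /B /= -natr1; ring.
Qed.

Let wG : wt G = (fun=> 0).
Proof.
have : W 0 G.
  apply: W_sum => k; apply: WZ; have km : (k <= m)%N by rewrite -ltnS.
  have := WM (WM (WX k Ww0) (WX (m - k) Ww1)) (W_iter_rz k Wv).
  by congr W; rewrite natrB //; ring.
by move=> [_ ->]; apply/funext => g; rewrite mul0r.
Qed.

(** The left-hand side pairs the string [rz^k v] with the monomials of degree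
    [m] in the coordinates [(w0, w1)] of [g^-1 z], which transform in the
    opposite way: it is killed by [rz] and [lw] since the sums telescope, and
    it has weight [0]. So it is constant, and the right-hand side is its
    value at [1]. *)
Lemma lowest_const g : \sum_(k < m.+1) (k`!%:R)^-1 *
    ((z 0 0 * g 1 1 - z 1 0 * g 0 1) ^+ k * (z 1 0 * g 0 0 - z 0 0 * g 1 0) ^+ (m - k) *
       iter k rz v g) =
  \sum_(k < m.+1) (k`!%:R)^-1 * iter k rz v 1%g * z 0 0 ^+ k * z 1 0 ^+ (m - k).
Proof.
rewrite -[LHS]/(G g) (der0_const _ rG lG wG); last by have [] := derG (0, 0, 0).
have [e00 e01 e10 e11] : [/\ (1%g : SU2 R) 0 0 = 1, (1%g : SU2 R) 0 1 = 0,
   (1%g : SU2 R) 1 0 = 0 & (1%g : SU2 R) 1 1 = 1] by rewrite !mxE.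
apply: eq_bigr => k _; rewrite /T /w0 /w1 e00 e01 e10 e11.
by rewrite !mulr1 !mulr0 !subr0 /vk; ring.
Qed.

End FixedPoint.

(** If [z] is the second column of [g], then [w0 = 0] and [w1 = det g = 1],
    so that the pairing of [lowest_const] reduces to [v g]. *)
Lemma lowest_form : exists2 p, Virr m p & v = (fun g => p (col1 g)).
Proof.
exists (fun z : 'cV[C]_2 => \sum_(k < m.+1) (k`!%:R)^-1 * iter k rz v 1%g * z 0 0 ^+ k * z 1 0 ^+ (m - k)).
  by exists (fun k => (k`!%:R)^-1 * iter k rz v 1%g).
apply/funext => g; rewrite -(lowest_const _ g).
have [-> ->] : col1 g 0 0 = g 0 1 /\ col1 g 1 0 = g 1 1 by rewrite !mxE.
rewrite big_ord_recl /= big1 ?addr0; last first.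
  by move=> i _; rewrite mulrC [g 0 1 * _]mulrC subrr expr0n /= !mul0r.
rewrite subn0 expr0 fact0 invr1 !mul1r.
have := su2_det g; rewrite det2 => D.
have -> : g 1 1 * g 0 0 - g 0 1 * g 1 0 = 1 by rewrite -D; ring.
by rewrite expr1n mul1r.
Qed.

End LowestForm.

End Forms.

(** * Smoothness of complex integrals *)

Section ComplexIntegral.
Variable R : realType.
Local Notation C := R[i].

Definition cint (a b : R) (f : R -> C) : C :=
  rint a b (fun s => complex.Re (f s)) +i* rint a b (fun s => complex.Im (f s)).

Definition ccont (f : R -> C) :=
  continuous (fun s => complex.Re (f s)) /\ continuous (fun s => complex.Im (f s)).

Lemma smoothC_ccont (f : R -> C) : smoothC setT f -> ccont f.
Proof. by move=> [h1 h2]; split=> t; [apply: (Cn_on_cont (h1 0%N))|apply: (Cn_on_cont (h2 0%N))]. Qed.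

Lemma cintD a b f g : ccont f -> ccont g ->
  cint a b (fun s => f s + g s) = cint a b f + cint a b g.
Proof.
move=> [f1 f2] [g1 g2]; apply: ceq; rewrite ?cReD ?cImD /=.
  by under eq_fun do rewrite cReD; exact: rintD.
by under eq_fun do rewrite cImD; exact: rintD.
Qed.

Lemma cintZ a b (k : C) f : ccont f ->
  cint a b (fun s => k * f s) = k * cint a b f.
Proof.
move=> [f1 f2]; have Z (r : R) (h : R -> R) : continuous h -> continuous (fun s => r * h s).
  by move=> ch t; apply: cvgM; [exact: cvg_cst|exact: ch].
apply: ceq; rewrite ?cReM ?cImM /=.
  by under eq_fun do rewrite cReM; rewrite rintB ?rintZ //; exact: Z.
by under eq_fun do rewrite cImM; rewrite rintD ?rintZ //; exact: Z.
Qed.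

Lemma cint_FTC a b F f : a <= b -> ccont f -> (forall t, isdC F t (f t)) ->
  cint a b f = F b - F a.
Proof.
move=> ab [f1 f2] h; apply: ceq; rewrite ?cReD ?cImD ?cReN ?cImN /=.
  exact: rint_FTC ab f1 (fun t => (h t).1).
exact: rint_FTC ab f2 (fun t => (h t).2).
Qed.

(** Iterating the first-order statement, with the directional derivative of
    the integrand as new integrand. *)
Lemma smoothC_cint (V : normedModType R) (A : set V) (psi : V * R -> C) a b :
  open A -> a <= b -> smoothC (A `*` setT) psi ->
  smoothC A (fun x => cint a b (fun s => psi (x, s))) /\
  forall x v, A x -> DC v (fun x => cint a b (fun s => psi (x, s))) x =
    cint a b (fun s => DC (v, 0) psi (x, s)).
Proof.
move=> oA ab [h1 h2]; split.
  by split=> n; [exact: (Cn_on_rint oA ab (h1 n))|exact: (Cn_on_rint oA ab (h2 n))].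
move=> x v Ax; apply: ceq => /=.
  by have [] := is_derive_rint v oA ab (h1 1%N) Ax.
by have [] := is_derive_rint v oA ab (h2 1%N) Ax.
Qed.

Lemma DC_line (V : normedModType R) (F : V -> C) x v d :
  isdC (fun t => F (x + t *: v)) 0 d -> DC v F x = d.
Proof.
move=> [h1 h2]; apply: ceq => /=.
  by have [] := derivable_line0 (f := fun y => complex.Re (F y)) h1.
by have [] := derivable_line0 (f := fun y => complex.Im (F y)) h2.
Qed.

Lemma line_DC (V : normedModType R) (A : set V) (F : V -> C) x v (t : R) : smoothC A F ->
  A (x + t *: v) -> isdC (fun s => F (x + s *: v)) t (DC v F (x + t *: v)).
Proof.
move=> [h1 h2] Ax; split.
  apply: (derivable_line (f := fun y => complex.Re (F y))).
  by have [_ /(_ v)[+ _]] := h1 1%N; exact.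
apply: (derivable_line (f := fun y => complex.Im (F y))).
by have [_ /(_ v)[+ _]] := h2 1%N; exact.
Qed.

(** Moves the base point of a derivative to [0], where directional
    derivatives are defined. *)
Lemma isdC_shift (c : R -> C) (t : R) d :
  isdC (fun s => c (t + s)) 0 d <-> isdC c t d.
Proof.
have E (f : R -> R) l : is_derive (0 : R) (1 : R) (fun s => f (t + s)) l <->
    is_derive t (1 : R) f l.
  split=> [/is_derive1P|/is_derive1P] h; apply/is_derive1P; apply: cvg_trans h;
    apply: near_eq_cvg; near=> s; by rewrite /= add0r addr0.
by split=> -[h1 h2]; split; apply/E.
Unshelve. all: by end_near. Qed.

Lemma smoothC_comp (V W : normedModType R) (I : finType) (e : I -> W) (k : I -> W -> R)
    (A : set V) (B : set W) (F : W -> C) (G : V -> W) :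
  (forall x, x = \sum_i k i x *: e i) -> open A -> open B ->
  (forall x, A x -> B (G x)) -> (forall i, smooth_on A (fun x => k i (G x))) ->
  smoothC B F -> smoothC A (F \o G).
Proof.
move=> kE oA oB AB hG [h1 h2]; split=> n.
  exact: (Cn_on_comp kE oA oB AB (fun i => hG i n) (h1 n)).
exact: (Cn_on_comp kE oA oB AB (fun i => hG i n) (h2 n)).
Qed.

Lemma smooth_on_lin (V : normedModType R) (A : set V) (f : V -> R) : continuous f ->
  (forall x v (a : R), f (x + a *: v) = f x + a * f v) -> smooth_on A f.
Proof. by move=> cf fL n; exact: Cn_on_linear. Qed.

Lemma smooth_cos (V : normedModType R) (A : set V) p : open A -> smooth_on A p ->
  smooth_on A (fun x => cos (p x)).
Proof.
move=> oA hp n.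
pose phi (m : nat) (t : R) := match (m %% 4)%N with
  | 0 => cos t | 1 => - sin t | 2 => - cos t | _ => sin t end.
apply: (@Cn_on_comp1 R V phi 0 n A p oA _ (hp n)) => m t.
rewrite /phi -[m.+1]addn1 -modnDml; move: (ltn_pmod m (isT : (0 < 4)%N)).
case: (m %% 4)%N => [|[|[|[|//]]]] _ /=.
- exact: is_derive_cos.
- exact: is_deriveN.
- by apply: (is_derive_eq (is_deriveN (is_derive_cos t))); rewrite opprK.
- exact: is_derive_sin.
Qed.

Lemma smooth_sin (V : normedModType R) (A : set V) p : open A -> smooth_on A p ->
  smooth_on A (fun x => sin (p x)).
Proof.
move=> oA hp n.
have h : smooth_on A (fun x => p x - pi / 2).
  by move=> m; apply: Cn_onD => //; exact: Cn_on_cst.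
have := smooth_cos oA h n; congr Cn_on; apply/funext => x.
by rewrite cosB cos_pihalf sin_pihalf mulr0 add0r mulr1.
Qed.

Lemma smooth_exp (V : normedModType R) (A : set V) p : open A -> smooth_on A p ->
  smooth_on A (fun x => expR (p x)).
Proof.
move=> oA hp n.
by apply: (@Cn_on_comp1 R V (fun=> expR) 0 n A p oA _ (hp n)) => _ t; exact: is_derive_expR.
Qed.

End ComplexIntegral.

(** * Polar coordinates on the 3-sphere *)

Section SphericalMean.
Variable R : realType.
Local Notation C := R[i].
Local Notation S := (@su2_smooth R).
Local Notation T := ((R * R) * R)%type.
Implicit Types (phi c : SU2 R -> C) (q : T) (th al be : R).

(** The point at distance [theta = q.1.1] from [1] in the direction of the
    unit vector with polar angle [al = q.1.2] and azimuth [be = q.2]. *)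
Definition hpol q : SU2 R :=
  su2_of (cos q.1.1) (sin q.1.1 * cos q.1.2)
    (sin q.1.1 * (sin q.1.2 * cos q.2)) (sin q.1.1 * (sin q.1.2 * sin q.2)).

Let cs (t : R) : cos t ^+ 2 = 1 - sin t ^+ 2.
Proof. by rewrite -(cos2Dsin2 t); ring. Qed.

Lemma hpolE q : su2val (hpol q) = quat (cos q.1.1) (sin q.1.1 * cos q.1.2)
    (sin q.1.1 * (sin q.1.2 * cos q.2)) (sin q.1.1 * (sin q.1.2 * sin q.2)).
Proof.
rewrite su2_ofE //; have := cs q.1.1; have := cs q.1.2; have := cs q.2.
move: (cos _) (sin _) (cos _) (sin _) (cos _) (sin _) => a b c d e f h1 h2 h3.
ring: h1 h2 h3.
Qed.

Lemma hpolE3 th al be : su2val (hpol (th, al, be)) = quat (cos th) (sin th * cos al)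
    (sin th * (sin al * cos be)) (sin th * (sin al * sin be)).
Proof. exact: hpolE. Qed.

Lemma quat_curve (gm : R -> SU2 R) (X Y U Z : R -> R) (t x y u z : R) :
  (forall s, su2val (gm s) = quat (X s) (Y s) (U s) (Z s)) ->
  is_derive t (1 : R) X x -> is_derive t (1 : R) Y y ->
  is_derive t (1 : R) U u -> is_derive t (1 : R) Z z ->
  forall i j, isdC (fun s => gm s i j) t (quat x y u z i j).
Proof.
move=> gE dX dY dU dZ i; move: i; apply: ord2P => j; move: j; apply: ord2P;
  under eq_fun do rewrite gE mx22E; rewrite mx22E; split => //=; exact: is_deriveN.
Qed.

Lemma Lie_quat_curve phi (gm : R -> SU2 R) (X Y U Z : R -> R) (t x y u z a b c : R) :
  S phi -> (forall s, su2val (gm s) = quat (X s) (Y s) (U s) (Z s)) ->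
  is_derive t (1 : R) X x -> is_derive t (1 : R) Y y ->
  is_derive t (1 : R) U u -> is_derive t (1 : R) Z z ->
  quat x y u z = quat (X t) (Y t) (U t) (Z t) *m imq a b c ->
  isdC (fun s => phi (gm s)) t (der (a%:C, b%:C, c%:C) phi (gm t)).
Proof.
move=> sp gE dX dY dU dZ E.
have h := quat_curve gE dX dY dU dZ.
have := @Lie_curve R phi (imq a b c) gm t sp (lie_imq a b c).
rewrite gE -E => /(_ h); rewrite Lie_imq // /der Li.unlock Lj.unlock Lk.unlock.
exact.
Qed.

(** Left-invariant fields realizing the coordinate fields of polar
    coordinates: [d/dtheta] is [xi], [d/dal] is [sin theta] times [fA], and
    [d/dbe] is [sin theta sin al] times [fB]. The three vectors are
    orthonormal at every point. *)
Definition xi al be : R * R * R := (cos al, sin al * cos be, sin al * sin be).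
Definition fA th al be : R * R * R :=
  (- (cos th * sin al), cos th * (cos al * cos be) + sin th * sin be,
   cos th * (cos al * sin be) - sin th * cos be).
Definition fB th al be : R * R * R :=
  (- (sin th * sin al), - (cos th * sin be) + sin th * (cos al * cos be),
   cos th * cos be + sin th * (cos al * sin be)).
Definition cv (w : R * R * R) : C * C * C := (w.1.1%:C, w.1.2%:C, w.2%:C).
Definition sv (a : C) (w : C * C * C) : C * C * C := (a * w.1.1, a * w.1.2, a * w.2).

Lemma der_sv (a : C) w c g : der (sv a w) c g = a * der w c g.
Proof. by rewrite /der /sv /=; ring. Qed.

Let der1 (f : R -> R) (a t d : R) : is_derive t (1 : R) f d ->
  is_derive t (1 : R) (fun s => a * f s) (a * d).
Proof.
move=> h; apply: is_derive_eq (is_derive1M (is_derive_cst a t (1 : R)) h) _.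
by rewrite mul0r add0r.
Qed.

Let der2 (f : R -> R) (a t d : R) : is_derive t (1 : R) f d ->
  is_derive t (1 : R) (fun s => f s * a) (d * a).
Proof.
move=> h; apply: is_derive_eq (is_derive1M h (is_derive_cst a t (1 : R))) _.
by rewrite mulr0 addr0.
Qed.

Let dcst (a t : R) : is_derive t (1 : R) (fun=> a) 0.
Proof. exact: is_derive_cst. Qed.

Lemma hpol_th phi th al be : S phi ->
  isdC (fun t => phi (hpol (t, al, be))) th
    (der (cv (xi al be)) phi (hpol (th, al, be))).
Proof.
move=> sp; apply: (Lie_quat_curve sp (fun s => hpolE3 s al be) (is_derive_cos th)
  (der2 _ (is_derive_sin th)) (der2 _ (is_derive_sin th)) (der2 _ (is_derive_sin th))).
rewrite /= quat_mul; have := cs th; have := cs al; have := cs be.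
move: (cos th) (sin th) (cos al) (sin al) (cos be) (sin be) => a b c d e f h1 h2 h3.
congr quat; ring: h1 h2 h3.
Qed.

Lemma hpol_al phi th al be : S phi ->
  isdC (fun t => phi (hpol (th, t, be))) al
    ((sin th)%:C * der (cv (fA th al be)) phi (hpol (th, al, be))).
Proof.
move=> sp; rewrite -der_sv /sv /cv /fA /= -!rmorphM.
apply: (Lie_quat_curve sp (fun s => hpolE3 th s be) (dcst _ al)
  (der1 _ (is_derive_cos al)) (der1 _ (der2 _ (is_derive_sin al)))
  (der1 _ (der2 _ (is_derive_sin al)))).
rewrite /= quat_mul; have := cs th; have := cs al; have := cs be.
move: (cos th) (sin th) (cos al) (sin al) (cos be) (sin be) => a b c d e f h1 h2 h3.
congr quat; ring: h1 h2 h3.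
Qed.

Lemma hpol_be phi th al be : S phi ->
  isdC (fun t => phi (hpol (th, al, t))) be
    ((sin th * sin al)%:C * der (cv (fB th al be)) phi (hpol (th, al, be))).
Proof.
move=> sp; rewrite -der_sv /sv /cv /fB /= -!rmorphM.
apply: (Lie_quat_curve sp (fun s => hpolE3 th al s) (dcst _ be) (dcst _ be)
  (der1 _ (der1 _ (is_derive_cos be)))
  (der1 _ (der1 _ (is_derive_sin be)))).
rewrite /= quat_mul; have := cs th; have := cs al; have := cs be.
move: (cos th) (sin th) (cos al) (sin al) (cos be) (sin be) => a b c d e f h1 h2 h3.
congr quat; ring: h1 h2 h3.
Qed.

(** The coefficients of the field move along the curve together with the
    point. *)
Lemma der_curve phi (gm : R -> SU2 R) (t : R) (a1 a2 a3 : R -> C) (d1 d2 d3 : C) Y :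
  S phi -> (forall c, S c -> isdC (fun s => c (gm s)) t (der Y c (gm t))) ->
  isdC a1 t d1 -> isdC a2 t d2 -> isdC a3 t d3 ->
  isdC (fun s => der (a1 s, a2 s, a3 s) phi (gm s)) t
    (der (d1, d2, d3) phi (gm t) + der Y (der (a1 t, a2 t, a3 t) phi) (gm t)).
Proof.
move=> sp hY h1 h2 h3.
rewrite -[der (a1 t, a2 t, a3 t) phi]/(fun g => a1 t * Li phi g + a2 t * Lj phi g + a3 t * Lk phi g).
rewrite -[fun s => der (a1 s, _, _) _ _]/(fun s => a1 s * Li phi (gm s) +
  a2 s * Lj phi (gm s) + a3 s * Lk phi (gm s)).
rewrite -[der (d1, d2, d3) phi (gm t)]/(d1 * Li phi (gm t) + d2 * Lj phi (gm t) + d3 * Lk phi (gm t)).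
have si := smooth_Li sp; have sj := smooth_Lj sp; have sk := smooth_Lk sp.
apply: isdC_eq (isdCD (isdCD (isdCM h1 (hY _ si)) (isdCM h2 (hY _ sj))) (isdCM h3 (hY _ sk))) _.
have -> : der Y (fun g => a1 t * Li phi g + a2 t * Lj phi g + a3 t * Lk phi g) (gm t) =
   a1 t * der Y (Li phi) (gm t) + a2 t * der Y (Lj phi) (gm t) + a3 t * der Y (Lk phi) (gm t).
  rewrite derD; [|by apply: su2_smoothD; exact: su2_smoothZ|exact: su2_smoothZ].
  by rewrite derD ?derZ //; exact: su2_smoothZ.
ring.
Qed.

(** The Laplace operator of the round sphere for the metric in which [qi],
    [qj], [qk] are orthonormal. *)
Definition Lap phi : SU2 R -> C := fun g =>
  Li (Li phi) g + Lj (Lj phi) g + Lk (Lk phi) g.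

(** A sum of squares does not depend on the orthonormal basis. *)
Lemma Lap_frame phi th al be g : S phi ->
  Lap phi g = der (cv (xi al be)) (der (cv (xi al be)) phi) g +
   der (cv (fA th al be)) (der (cv (fA th al be)) phi) g +
   der (cv (fB th al be)) (der (cv (fB th al be)) phi) g.
Proof.
move=> sp; rewrite !der_der // /Lap /cv /xi /fA /fB /=.
rewrite !(rmorphD, rmorphB, rmorphN, rmorphM) /=.
have csC t : (cos t)%:C ^+ 2 = 1 - (sin t)%:C ^+ 2 :> C.
  by rewrite -!rmorphXn cs rmorphB rmorph1.
have := csC th; have := csC al; have := csC be.
move: (cos th)%:C (sin th)%:C (cos al)%:C (sin al)%:C (cos be)%:C (sin be)%:C.
move: (Li (Li phi) g) (Li (Lj phi) g) (Li (Lk phi) g).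
move: (Lj (Li phi) g) (Lj (Lj phi) g) (Lj (Lk phi) g).
move: (Lk (Li phi) g) (Lk (Lj phi) g) (Lk (Lk phi) g).
move=> x1 x2 x3 x4 x5 x6 x7 x8 x9 a b c d e f h1 h2 h3.
ring: h1 h2 h3.
Qed.

Let dC (f : R -> R) (t d : R) : is_derive t (1 : R) f d ->
  isdC (fun s => (f s)%:C) t d%:C.
Proof. exact: isdC_real. Qed.

(** In this lemma and the next, the derivatives of the frame express the
    tangential second derivatives of [phi] through derivatives in [al] and
    [be], which integrate to zero, and the radial first derivative. *)
Lemma dbe_B phi th al be : S phi ->
  isdC (fun t => der (cv (fB th al t)) phi (hpol (th, al, t))) be
   (- (cos th * sin al)%:C * der (cv (xi al be)) phi (hpol (th, al, be))
    - (cos al)%:C * der (cv (fA th al be)) phi (hpol (th, al, be))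
    + (sin th * sin al)%:C *
       der (cv (fB th al be)) (der (cv (fB th al be)) phi) (hpol (th, al, be))).
Proof.
move=> sp; rewrite -[X in _ + X]der_sv.
apply: isdC_eq.
  apply: (der_curve (gm := fun t => hpol (th, al, t)) (Y := sv (sin th * sin al)%:C (cv (fB th al be))) sp).
  - by move=> c sc; rewrite der_sv; exact: hpol_be.
  - exact: dC (dcst _ be).
  - exact: dC (is_deriveD (is_deriveN (der1 (cos th) (is_derive_sin be)))
      (der1 (sin th) (der1 (cos al) (is_derive_cos be)))).
  - exact: dC (is_deriveD (der1 (cos th) (is_derive_cos be))
      (der1 (sin th) (der1 (cos al) (is_derive_sin be)))).
congr (_ + _); rewrite /der /cv /xi /fA /fB /=.
rewrite !(rmorphD, rmorphB, rmorphN, rmorphM, rmorph0) /=.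
have csC t : (cos t)%:C ^+ 2 = 1 - (sin t)%:C ^+ 2 :> C.
  by rewrite -!rmorphXn cs rmorphB rmorph1.
have := csC th; have := csC al; have := csC be.
move: (cos th)%:C (sin th)%:C (cos al)%:C (sin al)%:C (cos be)%:C (sin be)%:C.
move=> a b c d e f h1 h2 h3; ring: h1 h2 h3.
Qed.

Lemma dal_A phi th al be : S phi ->
  isdC (fun t => (sin t)%:C * der (cv (fA th t be)) phi (hpol (th, t, be))) al
   ((cos al)%:C * der (cv (fA th al be)) phi (hpol (th, al, be)) +
    (sin al)%:C * (- (cos th)%:C * der (cv (xi al be)) phi (hpol (th, al, be))
    + (sin th)%:C *
       der (cv (fA th al be)) (der (cv (fA th al be)) phi) (hpol (th, al, be)))).
Proof.
move=> sp; rewrite -[(sin th)%:C * der _ _ _]der_sv.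
apply: isdC_eq.
  apply: isdCM; first exact: dC (is_derive_sin al).
  apply: (der_curve (gm := fun t => hpol (th, t, be)) (Y := sv (sin th)%:C (cv (fA th al be))) sp).
  - by move=> c sc; rewrite der_sv; exact: hpol_al.
  - exact: dC (is_deriveN (der1 (cos th) (is_derive_sin al))).
  - exact: dC (is_deriveD (der1 (cos th) (der2 (cos be) (is_derive_cos al))) (dcst _ al)).
  - exact: dC (is_deriveB (der1 (cos th) (der2 (sin be) (is_derive_cos al))) (dcst _ al)).
congr (_ + _ * (_ + _)); rewrite /der /cv /xi /fA /fB /=.
rewrite !(rmorphD, rmorphB, rmorphN, rmorphM, rmorph0) /=; ring.
Qed.

End SphericalMean.

(** * Spherical means *)

Section Averages.
Variable R : realType.
Local Notation C := R[i].
Local Notation S := (@su2_smooth R).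
Local Notation T := ((R * R) * R)%type.
Implicit Types (phi c : SU2 R -> C) (q : T) (th al be : R).

Let oT (V : normedModType R) : open [set: V] := @openT V.

Lemma smooth_q1 : smooth_on [set: T] (fun q => q.1.1).
Proof.
apply: smooth_on_lin => // q.
by apply: (@cvg_comp _ _ _ fst fst _ (nbhs q.1)); exact: cvg_fst.
Qed.
Lemma smooth_q2 : smooth_on [set: T] (fun q => q.1.2).
Proof.
apply: smooth_on_lin => // q.
by apply: (@cvg_comp _ _ _ fst snd _ (nbhs q.1)); [exact: cvg_fst|exact: cvg_snd].
Qed.
Lemma smooth_q3 : smooth_on [set: T] (fun q => q.2).
Proof. by apply: smooth_on_lin => // q; exact: cvg_snd. Qed.

Lemma smooth_onM (V : normedModType R) (A : set V) f g : open A ->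
  smooth_on A f -> smooth_on A g -> smooth_on A (fun x => f x * g x : R).
Proof. by move=> oA hf hg n; exact: Cn_onM. Qed.

Lemma smooth_hpol_entry i j : smoothC [set: T] (fun q => su2val (hpol q) i j).
Proof.
under eq_fun do rewrite hpolE.
have s1 := smooth_sin (oT _) smooth_q1; have s2 := smooth_sin (oT _) smooth_q2.
have s3 := smooth_sin (oT _) smooth_q3; have c1 := smooth_cos (oT _) smooth_q1.
have c2 := smooth_cos (oT _) smooth_q2; have c3 := smooth_cos (oT _) smooth_q3.
apply: smooth_quat; first exact: oT; first exact: c1.
- exact: smooth_onM.
- by apply: smooth_onM => //; exact: smooth_onM.
- by apply: smooth_onM => //; exact: smooth_onM.
Qed.

Lemma smooth_hpol phi : S phi -> smoothC [set: T] (fun q => phi (hpol q)).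
Proof.
move=> /su2_smoothP[A [F [oA sF Ag Fg]]].
rewrite (_ : (fun q => phi (hpol q)) = F \o (fun q => emb (su2val (hpol q)))); last first.
  by apply/funext => q /=; rewrite Fg.
apply: (smoothC_comp (@ccoordE R) (oT _) oA) => [q _|p|//]; first exact: Ag.
by apply: smooth_ccoord_of; exact: smooth_hpol_entry.
Qed.

(** Integration over the angular variables, with [al] in [[0, pi]] and [be]
    in [[0, 2 pi]]. *)
Definition J (f : T -> C) th : C :=
  cint 0 pi (fun al => cint 0 (pi *+ 2) (fun be => f (th, al, be))).

Let pi0 : 0 <= pi :> R. Proof. exact: pi_ge0. Qed.
Let pi20 : 0 <= pi *+ 2 :> R. Proof. by rewrite mulrn_wge0 // pi_ge0. Qed.

Lemma smoothC_setX (V W : normedModType R) (f : V * W -> C) :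
  smoothC setT f -> smoothC (setT `*` setT) f.
Proof. exact: smoothC_sub. Qed.

Lemma J_inner f : smoothC setT f ->
  smoothC setT (fun x : R * R => cint 0 (pi *+ 2) (fun be => f (x, be))).
Proof.
by move=> sf; have [] := smoothC_cint (oT _) pi20 (smoothC_setX sf).
Qed.

Lemma J_smooth f : smoothC setT f -> smoothC setT (J f).
Proof.
move=> sf; have [] := smoothC_cint (oT _) pi0 (smoothC_setX (J_inner sf)).
by [].
Qed.

(** Only the radial coordinate is left after integration over the sphere. *)
Lemma J_derive f f' : smoothC setT f ->
  (forall th al be, isdC (fun t => f (t, al, be)) th (f' (th, al, be))) ->
  forall th, isdC (J f) th (J f' th).
Proof.
move=> sf df th.
have [_ D1] := smoothC_cint (oT _) pi20 (smoothC_setX sf).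
have [sJ D2] := smoothC_cint (oT _) pi0 (smoothC_setX (J_inner sf)).
have := @line_DC R R setT (J f) (0 : R) (1 : R) th sJ I.
have E (t : R) : (0 : R) + t *: (1 : R) = t by rewrite add0r [LHS]mulr1.
rewrite E; under eq_fun do rewrite E.
move=> h; apply: isdC_eq h _.
rewrite D2 //; congr cint; apply/funext => al.
rewrite D1 //; congr cint; apply/funext => be.
apply: DC_line.
have -> : (fun s => f ((th, al, be) + s *: ((1 : R, 0 : R), 0 : R))) =
   (fun s => (fun t => f (t, al, be)) (th + s)).
  2: exact: (isdC_shift (fun t => f (t, al, be)) th _).2.
by apply/funext => s; congr (f (_, _, _)); rewrite /= ?add0r ?scaler0 ?addr0 // [s *: (1 : R)]mulr1.
Qed.

Lemma cc_slice1 (V : normedModType R) (f : V * R -> C) x : smoothC setT f ->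
  ccont (fun s => f (x, s)).
Proof.
have pc (s : R) : (x, h) @[h --> s] --> (x, s).
  by apply: (@cvg_pair _ _ _ _ (nbhs x) (nbhs s)); [exact: cvg_cst|exact: cvg_id].
move=> [h1 h2]; split=> s.
  apply: (@cvg_comp _ _ _ (fun s => (x, s)) (fun z => complex.Re (f z)) _ (nbhs (x, s))).
    exact: pc.
  exact: (Cn_on_cont (h1 0%N)).
apply: (@cvg_comp _ _ _ (fun s => (x, s)) (fun z => complex.Im (f z)) _ (nbhs (x, s))).
  exact: pc.
exact: (Cn_on_cont (h2 0%N)).
Qed.

Lemma JD f g th : smoothC setT f -> smoothC setT g ->
  J (fun q => f q + g q) th = J f th + J g th.
Proof.
move=> sf sg; rewrite /J -cintD.
- congr cint; apply/funext => al.
  by rewrite (cintD _ _ (cc_slice1 (th, al) sf) (cc_slice1 (th, al) sg)).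
- exact: cc_slice1 th (J_inner sf).
- exact: cc_slice1 th (J_inner sg).
Qed.

Lemma JZ (a : C) f th : smoothC setT f ->
  J (fun q => a * f q) th = a * J f th.
Proof.
move=> sf; rewrite /J -cintZ; last exact: cc_slice1 th (J_inner sf).
congr cint; apply/funext => al.
by rewrite (cintZ _ _ a (cc_slice1 (th, al) sf)).
Qed.

Lemma cint0 a b : a <= b -> cint a b (fun=> 0) = 0 :> C.
Proof.
move=> ab; apply: ceq => /=; by rewrite rint_cst // mulr0.
Qed.

Lemma J_exact_be f G th : smoothC setT f ->
  (forall th al be, isdC (fun t => G (th, al, t)) be (f (th, al, be))) ->
  (forall th al, G (th, al, pi *+ 2) = G (th, al, 0)) -> J f th = 0.
Proof.
move=> sf dG per; rewrite /J -(cint0 pi0); congr cint; apply/funext => al.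
rewrite (cint_FTC pi20 (cc_slice1 (th, al) sf) (dG th al)).
by rewrite per subrr.
Qed.

(** Applied to functions [G] that contain the factor [sin al] of the measure,
    and so vanish at both poles. *)
Lemma J_exact_al f G th : smoothC setT f -> smoothC setT G ->
  (forall th al be, isdC (fun t => G (th, t, be)) al (f (th, al, be))) ->
  (forall th be, G (th, 0, be) = 0) -> (forall th be, G (th, pi, be) = 0) ->
  J f th = 0.
Proof.
move=> sf sG dG G0 Gpi.
have [sJ D1] := smoothC_cint (oT _) pi20 (smoothC_setX sG).
pose N al := cint 0 (pi *+ 2) (fun be => G (th, al, be)).
have dN al : isdC N al (cint 0 (pi *+ 2) (fun be => f (th, al, be))).
  have := @line_DC R (R * R)%type setT _ (th, 0 : R) (0 : R, 1 : R) al sJ I.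
  have E (t : R) : (th, 0 : R) + t *: (0 : R, 1 : R) = (th, t) :> R * R.
    by congr (_, _); rewrite /= ?scaler0 ?addr0 ?add0r // [t *: (1 : R)]mulr1.
  rewrite E; under eq_fun do rewrite E.
  move=> h; apply: isdC_eq h _; rewrite D1 //; congr cint; apply/funext => be.
  apply: DC_line.
  have -> : (fun s => G ((th, al, be) + s *: ((0 : R, 1 : R), 0 : R))) =
     (fun s => (fun t => G (th, t, be)) (al + s)).
    2: exact: (isdC_shift (fun t => G (th, t, be)) al _).2.
  by apply/funext => s; congr (G (_, _, _)); rewrite /= ?add0r ?scaler0 ?addr0 // [s *: (1 : R)]mulr1.
rewrite /J (cint_FTC pi0 (cc_slice1 th (J_inner sf)) dN) /N.
have -> : (fun be => G (th, pi, be)) = (fun=> 0) by apply/funext => be.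
have -> : (fun be => G (th, 0, be)) = (fun=> 0) by apply/funext => be.
by rewrite subrr.
Qed.

Lemma J_lin (p r : C) (L M N fa fb : T -> C) th :
  smoothC setT L -> smoothC setT M -> smoothC setT N -> smoothC setT fa -> smoothC setT fb ->
  J fa th = 0 -> J fb th = 0 ->
  (forall al be, p * L (th, al, be) =
     p * M (th, al, be) + r * N (th, al, be) + fa (th, al, be) + fb (th, al, be)) ->
  p * J L th = p * J M th + r * J N th.
Proof.
move=> sL sM' sN' sa sb Ja Jb E.
have Z (a : C) F : smoothC setT F -> smoothC [set: T] (fun q => a * F q).
  by move=> sF; apply: smoothCM sF; [exact: oT|exact: smoothC_cst].
have s2 := smoothCD (oT _) (Z p M sM') (Z r N sN').
have s3 := smoothCD (oT _) s2 sa.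
have e1 := etrans (JD th (Z p M sM') (Z r N sN')) (congr2 +%R (JZ p th sM') (JZ r th sN')).
have e2 := etrans (JD th s2 sa) (congr2 +%R e1 Ja).
have e3 := etrans (JD th s3 sb) (congr2 +%R e2 Jb).
apply: etrans (esym (JZ p th sL)) _; apply: etrans (_ : _ = _) (etrans e3 _).
  by rewrite /J; congr cint; apply/funext => al; congr cint; apply/funext => be; exact: E.
by rewrite !addr0.
Qed.

Let sC1 : smoothC [set: T] (fun q => (cos q.1.1)%:C).
Proof. by apply: smoothC_real; apply: smooth_cos smooth_q1; exact: oT. Qed.
Let sC2 : smoothC [set: T] (fun q => (cos q.1.2)%:C).
Proof. by apply: smoothC_real; apply: smooth_cos smooth_q2; exact: oT. Qed.
Let sC3 : smoothC [set: T] (fun q => (cos q.2)%:C).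
Proof. by apply: smoothC_real; apply: smooth_cos smooth_q3; exact: oT. Qed.
Let sS1 : smoothC [set: T] (fun q => (sin q.1.1)%:C).
Proof. by apply: smoothC_real; apply: smooth_sin smooth_q1; exact: oT. Qed.
Let sS2 : smoothC [set: T] (fun q => (sin q.1.2)%:C).
Proof. by apply: smoothC_real; apply: smooth_sin smooth_q2; exact: oT. Qed.
Let sS3 : smoothC [set: T] (fun q => (sin q.2)%:C).
Proof. by apply: smoothC_real; apply: smooth_sin smooth_q3; exact: oT. Qed.

Let sM F G : smoothC [set: T] F -> smoothC [set: T] G -> smoothC [set: T] (fun q => F q * G q).
Proof. by move=> hF hG; apply: smoothCM => //; exact: oT. Qed.
Let sD F G : smoothC [set: T] F -> smoothC [set: T] G -> smoothC [set: T] (fun q => F q + G q).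
Proof. by move=> hF hG; apply: smoothCD => //; exact: oT. Qed.
Let sN F : smoothC [set: T] F -> smoothC [set: T] (fun q => - F q).
Proof.
move=> hF; rewrite (_ : (fun q => - F q) = (fun q => -1 * F q)).
  by apply: sM => //; exact: smoothC_cst.
by apply/funext => q; rewrite mulN1r.
Qed.

Let sder (w : T -> C * C * C) phi : S phi ->
  smoothC [set: T] (fun q => (w q).1.1) -> smoothC [set: T] (fun q => (w q).1.2) ->
  smoothC [set: T] (fun q => (w q).2) -> smoothC [set: T] (fun q => der (w q) phi (hpol q)).
Proof.
move=> sp h1 h2 h3; apply: sD; [apply: sD|]; apply: sM => //; apply: smooth_hpol.
- exact: smooth_Li.
- exact: smooth_Lj.
- exact: smooth_Lk.
Qed.

Let dsplit (w : T -> C * C * C) phi : S phi ->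
  smoothC [set: T] (fun q => (w q).1.1) -> smoothC [set: T] (fun q => (w q).1.2) ->
  smoothC [set: T] (fun q => (w q).2) ->
  smoothC [set: T] (fun q => der (w q) (der (w q) phi) (hpol q)).
Proof.
move=> sp h1 h2 h3; under eq_fun do rewrite der_der //.
have si := smooth_Li sp; have sj := smooth_Lj sp; have sk := smooth_Lk sp.
have sL c : S c -> [/\ smoothC [set: T] (fun q => Li c (hpol q)),
   smoothC [set: T] (fun q => Lj c (hpol q)) & smoothC [set: T] (fun q => Lk c (hpol q))].
  by move=> sc; split; apply: smooth_hpol; [exact: smooth_Li|exact: smooth_Lj|exact: smooth_Lk].
have [a1 a2 a3] := sL _ si; have [b1 b2 b3] := sL _ sj; have [c1 c2 c3] := sL _ sk.
by repeat (apply: sD || apply: sM).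
Qed.

Let Xi q := cv (xi q.1.2 q.2).
Let A q := cv (fA q.1.1 q.1.2 q.2).
Let B q := cv (fB q.1.1 q.1.2 q.2).

Let sXi : [/\ smoothC [set: T] (fun q => (Xi q).1.1), smoothC [set: T] (fun q => (Xi q).1.2) &
  smoothC [set: T] (fun q => (Xi q).2)].
Proof.
rewrite /Xi /cv /xi /=; split; first exact: sC2.
  by under eq_fun do rewrite rmorphM /=; exact: sM.
by under eq_fun do rewrite rmorphM /=; exact: sM.
Qed.
Let sA : [/\ smoothC [set: T] (fun q => (A q).1.1), smoothC [set: T] (fun q => (A q).1.2) &
  smoothC [set: T] (fun q => (A q).2)].
Proof.
rewrite /A /cv /fA /=; split.
- by under eq_fun do rewrite !(rmorphN, rmorphM, rmorphD) /=; repeat (apply: sN || apply: sM).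
- by under eq_fun do rewrite !(rmorphN, rmorphM, rmorphD) /=;
    repeat (apply: sD || apply: sN || apply: sM).
- by under eq_fun do rewrite !(rmorphB, rmorphN, rmorphM, rmorphD) /=;
    repeat (apply: sD || apply: sN || apply: sM).
Qed.
Let sB : [/\ smoothC [set: T] (fun q => (B q).1.1), smoothC [set: T] (fun q => (B q).1.2) &
  smoothC [set: T] (fun q => (B q).2)].
Proof.
rewrite /B /cv /fB /=; split.
- by under eq_fun do rewrite !(rmorphN, rmorphM, rmorphD) /=; repeat (apply: sN || apply: sM).
- by under eq_fun do rewrite !(rmorphN, rmorphM, rmorphD) /=;
    repeat (apply: sD || apply: sN || apply: sM).
- by under eq_fun do rewrite !(rmorphB, rmorphN, rmorphM, rmorphD) /=;
    repeat (apply: sD || apply: sN || apply: sM).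
Qed.

(** Integral over the sphere of radius [theta]; the total mass of the measure
    is [4 pi]. *)
Definition Mean c th : C := J (fun q => (sin q.1.2)%:C * c (hpol q)) th.

Section Fixed.
Variable phi : SU2 R -> C.
Hypothesis sp : S phi.

Let D1 q := der (Xi q) phi (hpol q).
Let D2 q := der (Xi q) (der (Xi q) phi) (hpol q).
Let DA q := der (A q) phi (hpol q).
Let DAA q := der (A q) (der (A q) phi) (hpol q).
Let DB q := der (B q) phi (hpol q).
Let DBB q := der (B q) (der (B q) phi) (hpol q).

Let sD1 : smoothC setT D1. Proof. by have [h1 h2 h3] := sXi; exact: sder. Qed.
Let sD2 : smoothC setT D2. Proof. by have [h1 h2 h3] := sXi; exact: dsplit. Qed.
Let sDA : smoothC setT DA. Proof. by have [h1 h2 h3] := sA; exact: sder. Qed.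
Let sDAA : smoothC setT DAA. Proof. by have [h1 h2 h3] := sA; exact: dsplit. Qed.
Let sDB : smoothC setT DB. Proof. by have [h1 h2 h3] := sB; exact: sder. Qed.
Let sDBB : smoothC setT DBB. Proof. by have [h1 h2 h3] := sB; exact: dsplit. Qed.

Definition Mean1 th := J (fun q => (sin q.1.2)%:C * D1 q) th.
Definition Mean2 th := J (fun q => (sin q.1.2)%:C * D2 q) th.

Lemma Mean_derive th : isdC (Mean phi) th (Mean1 th).
Proof.
apply: J_derive => [|t al be]; first by apply: sM => //; exact: smooth_hpol.
by apply: (isdCZ (sin al)%:C); exact: hpol_th.
Qed.

Lemma Mean1_derive th : isdC Mean1 th (Mean2 th).
Proof.
apply: J_derive => [|t al be]; first exact: sM.
apply: (isdCZ (sin al)%:C); rewrite /D1 /D2 /Xi /=.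
have := der_curve (gm := fun s => hpol (s, al, be)) (t := t) (Y := cv (xi al be)) sp
  (fun c sc => hpol_th t al be sc) (isdC_cst (cos al)%:C t)
  (isdC_cst (sin al * cos be)%:C t) (isdC_cst (sin al * sin be)%:C t).
by rewrite /der /= !mul0r !add0r.
Qed.

(** The Darboux equation [M_(Lap phi) = M'' + 2 cot theta M'], cleared of its
    denominator. In the frame of polar coordinates, the tangential part of
    [Lap phi] is the sum of [2 cot theta] times the radial derivative and of
    a divergence on the sphere. *)
Lemma Mean_Lap th :
  (sin th)%:C * Mean (Lap phi) th = (sin th)%:C * Mean2 th + 2 * (cos th)%:C * Mean1 th.
Proof.
pose fb q := - (cos q.1.1 * sin q.1.2)%:C * D1 q - (cos q.1.2)%:C * DA q +
  (sin q.1.1 * sin q.1.2)%:C * DBB q.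
pose fa q := (cos q.1.2)%:C * DA q + (sin q.1.2)%:C *
  (- (cos q.1.1)%:C * D1 q + (sin q.1.1)%:C * DAA q).
have sfb : smoothC setT fb.
  rewrite /fb; under eq_fun do rewrite !rmorphM /=.
  apply: (sD (F := fun q => - _ * D1 q - _ * DA q) (G := fun q => _ * DBB q)).
    apply: (sD (F := fun q => - _ * D1 q) (G := fun q => - (_ * DA q))).
      by apply: (sM (G := D1)) => //; apply: sN; exact: sM.
    by apply: sN; exact: (sM (G := DA)).
  by apply: (sM (G := DBB)) => //; exact: sM.
have sfa : smoothC setT fa.
  apply: (sD (F := fun q => _ * DA q) (G := fun q => _ * (- _ * D1 q + _ * DAA q))).
    exact: (sM (G := DA)).
  apply: sM => //; apply: (sD (F := fun q => - _ * D1 q) (G := fun q => _ * DAA q)).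
    by apply: (sM (G := D1)) => //; exact: sN.
  exact: (sM (G := DAA)).
have perB t al : DB (t, al, pi *+ 2) = DB (t, al, 0).
  rewrite /DB /B /= /fB /hpol /=.
  by rewrite mulr2n cosDpi sinDpi cospi sinpi cos0 sin0 oppr0 opprK.
have Jb : J fb th = 0.
  by apply: (@J_exact_be fb DB th sfb _ perB) => t al be; exact: dbe_B.
pose GA q := (sin q.1.2)%:C * DA q.
have sGA : smoothC setT GA by exact: sM.
have Ja : J fa th = 0.
  apply: (@J_exact_al fa GA th sfa sGA) => [t al be|t be|t be].
  - exact: dal_A.
  - by rewrite /GA sin0 mul0r.
  - by rewrite /GA sinpi mul0r.
have sL : smoothC setT (fun q => (sin q.1.2)%:C * Lap phi (hpol q)).
  have [si sj sk] := And3 (smooth_Li sp) (smooth_Lj sp) (smooth_Lk sp).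
  apply: sM => //; apply: sD; [apply: sD|]; apply: smooth_hpol;
    by [exact: smooth_Li|exact: smooth_Lj|exact: smooth_Lk].
have sm1 : smoothC setT (fun q => (sin q.1.2)%:C * D1 q) by exact: (sM (G := D1)).
have sm2 : smoothC setT (fun q => (sin q.1.2)%:C * D2 q) by exact: (sM (G := D2)).
apply: (J_lin sL sm2 sm1 sfa sfb Ja Jb) => al be.
rewrite /fa /fb /D1 /D2 /DA /DAA /DBB /Xi /A /B /=.
rewrite (Lap_frame th al be _ sp) !rmorphM /=; ring.
Qed.

End Fixed.

End Averages.

(** * Averaging over SU(2) *)

Section Translates.
Variable R : realType.
Local Notation C := R[i].
Local Notation S := (@su2_smooth R).
Local Notation V := ('M[R]_2 * 'M[R]_2)%type.
Local Notation T := ((R * R) * R)%type.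
Implicit Types (c f : SU2 R -> C) (g h : SU2 R) (q : T).

Let oT (W : normedModType R) : open [set: W] := @openT W.

Lemma open_preim (W U : topologicalType) (G : W -> U) (A : set U) :
  continuous G -> open A -> open (G @^-1` A).
Proof. by move=> /continuousP; apply. Qed.

Lemma su2_smooth_right g c : S c -> S (fun h => c (h * g)%g).
Proof.
move=> /su2_smoothP[A [F [oA sF Ag Fg]]]; apply/su2_smoothP.
pose G (x : V) := emb (matC x *m su2val g).
have sG p : smooth_on setT (fun x => ccoord p (G x)) by exact: smooth_ccoord_mul.
have oG : open (G @^-1` A) by exact: open_preim (smooth_coord_continuous sG) oA.
exists (G @^-1` A), (F \o G); split=> //.
- apply: (smoothC_comp (@ccoordE R) oG oA) => // p n.
  exact: Cn_on_sub (sG p n).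
- by move=> h; rewrite /preimage /= /G matCK; exact: (Ag (h * g)%g).
- by move=> h; rewrite /= /G matCK; exact: (Fg (h * g)%g).
Qed.

Lemma Lie_left Y c g h :
  Lie Y (fun h => c (g * h)%g) h = Lie Y c (g * h)%g.
Proof.
apply: (congr1 (fun F : R -> C => derive1C F 0)); apply/funext => t.
by rewrite mulgA.
Qed.

(** Right translation by [g] turns a left-invariant field into its conjugate
    by [g]. *)
Lemma Lie_right Y Y' c g h : S c -> lie_su2 Y -> lie_su2 Y' ->
  su2val g *m Y' = Y *m su2val g ->
  Lie Y (fun h => c (h * g)%g) h = Lie Y' c (h * g)%g.
Proof.
move=> sc hY hY' E.
have E0 : (h * su2_exp ((0 : R)%:C *: Y) * g)%g = (h * g)%g by rewrite exp_curve0.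
have := Lie_curve (gm := fun t : R => (h * su2_exp (t%:C *: Y) * g)%g) (t := 0) sc hY' _.
rewrite [X in Lie Y' c X]E0 => H; apply: isdC_derive1C; apply: H => i j.
have -> : su2val (h * su2_exp ((0 : R)%:C *: Y) * g)%g *m Y' =
    (su2val h *m Y) *m su2val g.
  by rewrite [X in su2val X]E0 /= -!mulmxA E.
have ec k := exp_curve_at0 h i k hY.
have -> : (fun s : R => (h * su2_exp (s%:C *: Y) * g)%g i j) =
   (fun s : R => \sum_k (su2val g k j) * (h * su2_exp (s%:C *: Y))%g i k).
  by apply/funext => s; rewrite /= mxE; apply: eq_bigr => k _; rewrite mulrC.
rewrite mxE; apply: isdC_eq.
  by apply: isdC_sum => k; apply: isdCZ; exact: ec.
by apply: eq_bigr => k _; rewrite mulrC.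
Qed.

Lemma Lie_right_imq (x y u v a b d a' b' d' : R) c g h : S c ->
  su2val g = quat x y u v ->
  quat x y u v *m imq a' b' d' = imq a b d *m quat x y u v ->
  Lie (imq a b d) (fun h => c (h * g)%g) h = der (a'%:C, b'%:C, d'%:C) c (h * g)%g.
Proof.
move=> sc gE E; rewrite -(gE) in E.
rewrite (Lie_right h sc (lie_imq a b d) (lie_imq a' b' d') E).
by rewrite Lie_imq // /der Li.unlock Lj.unlock Lk.unlock.
Qed.

(** Conjugation by [g] is a rotation of the imaginary quaternions, and [Lap]
    is a sum of squares over an orthonormal basis. *)
Lemma Lap_right c g h : S c -> Lap (fun h => c (h * g)%g) h = Lap c (h * g)%g.
Proof.
move=> sc; have [x [y [u [v [e gE]]]]] := su2_quat g.
have e2 : x ^+ 2 = 1 - y ^+ 2 - u ^+ 2 - v ^+ 2 by rewrite -e; ring.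
pose wi := (x ^+ 2 + y ^+ 2 - u ^+ 2 - v ^+ 2, 2 * (y * u - x * v), 2 * (y * v + x * u)).
pose wj := (2 * (y * u + x * v), x ^+ 2 - y ^+ 2 + u ^+ 2 - v ^+ 2, 2 * (u * v - x * y)).
pose wk := (2 * (y * v - x * u), 2 * (u * v + x * y), x ^+ 2 - y ^+ 2 - u ^+ 2 + v ^+ 2).
have Ri d : S d -> Li (fun h => d (h * g)%g) = fun h => der (cv wi) d (h * g)%g.
  move=> sd; apply/funext => h'; rewrite Li.unlock.
  by apply: (Lie_right_imq _ sd gE); rewrite !quat_mul; congr quat; rewrite /wi /=; ring: e2.
have Rj d : S d -> Lj (fun h => d (h * g)%g) = fun h => der (cv wj) d (h * g)%g.
  move=> sd; apply/funext => h'; rewrite Lj.unlock.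
  by apply: (Lie_right_imq _ sd gE); rewrite !quat_mul; congr quat; rewrite /wj /=; ring: e2.
have Rk d : S d -> Lk (fun h => d (h * g)%g) = fun h => der (cv wk) d (h * g)%g.
  move=> sd; apply/funext => h'; rewrite Lk.unlock.
  by apply: (Lie_right_imq _ sd gE); rewrite !quat_mul; congr quat; rewrite /wk /=; ring: e2.
rewrite /Lap (Ri _ sc) (Rj _ sc) (Rk _ sc).
rewrite (Ri _ (smooth_der _ sc)) (Rj _ (smooth_der _ sc)) (Rk _ (smooth_der _ sc)).
rewrite !der_der // /cv /wi /wj /wk /=.
rewrite !(rmorphD, rmorphB, rmorphN, rmorphM, rmorph_nat, rmorphXn) /=.
have e3 : x%:C ^+ 2 = 1 - y%:C ^+ 2 - u%:C ^+ 2 - v%:C ^+ 2 :> C.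
  by rewrite -!rmorphXn e2 !rmorphB rmorph1.
move: (h * g)%g => {}h.
move: (Li (Li c) h) (Li (Lj c) h) (Li (Lk c) h).
move: (Lj (Li c) h) (Lj (Lj c) h) (Lj (Lk c) h).
move: (Lk (Li c) h) (Lk (Lj c) h) (Lk (Lk c) h).
move: x%:C y%:C u%:C v%:C e3 => X Y U Z e3 x1 x2 x3 x4 x5 x6 x7 x8 x9.
ring: e3.
Qed.

End Translates.

Section Averaging.
Variable R : realType.
Local Notation C := R[i].
Local Notation S := (@su2_smooth R).
Local Notation V := ('M[R]_2 * 'M[R]_2)%type.
Local Notation T := ((R * R) * R)%type.
Local Notation P := (((V * R) * R) * R)%type.
Implicit Types (c f : SU2 R -> C) (g h : SU2 R) (q : T).

Let oT (W : normedModType R) : open [set: W] := @openT W.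

Lemma Cn_on_pull (U W : normedModType R) (L : U -> W) n (B : set W) (f : W -> R) :
  continuous L -> (forall x v (a : R), L (a *: v + x) = a *: L v + L x) ->
  Cn_on B n f -> Cn_on (L @^-1` B) n (f \o L).
Proof.
move=> cL lL; elim: n f => [|n IH] f Hf.
  by split=> // x Bx; apply: continuous_comp; [exact: cL|exact: (Cn_on_cont Hf)].
split=> [x Bx|v]; first by apply: continuous_comp; [exact: cL|exact: (Cn_on_cont Hf)].
have E x : (fun h : R => h^-1 *: (((f \o L) \o shift x) (h *: v) - (f \o L) x)) =
    (fun h : R => h^-1 *: ((f \o shift (L x)) (h *: L v) - f (L x))).
  by apply/funext => h; rewrite /= lL.
have [_ /(_ (L v))[hd hC]] := Hf; split.
  by move=> x Bx; have := hd _ Bx; rewrite /derivable E.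
have -> : 'D_v (f \o L) = 'D_(L v) f \o L.
  by apply/funext => x; rewrite /derive E.
exact: IH.
Qed.

Lemma smoothC_pull (U W : normedModType R) (L : U -> W) (A : set U) (F : W -> C) :
  continuous L -> (forall x v (a : R), L (a *: v + x) = a *: L v + L x) ->
  smoothC setT F -> smoothC A (F \o L).
Proof.
move=> cL lL [h1 h2].
have sub : A `<=` L @^-1` setT by [].
by split=> n; [exact: (Cn_on_sub sub (Cn_on_pull cL lL (h1 n)))|
  exact: (Cn_on_sub sub (Cn_on_pull cL lL (h2 n)))].
Qed.

(** An extension of [f] to [A] extends all its left translates to this set. *)
Definition stable_dom (A : set V) : set V :=
  [set x | forall h, A (emb (su2val h *m matC x))].

Let mulV (z : V * V) : V := emb (matC z.1 *m matC z.2).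

Lemma mulV_continuous : continuous mulV.
Proof.
apply: smooth_coord_continuous => p; apply: smooth_ccoord_of.
have c1 : continuous (fst : V * V -> V) by move=> z; exact: cvg_fst.
have c2 : continuous (snd : V * V -> V) by move=> z; exact: cvg_snd.
apply: smoothC_mulmx => [|i j|i j]; first exact: oT.
  by apply: (smoothC_pull (F := fun x : V => matC x i j) _ c1) => //; exact: smoothC_entry.
by apply: (smoothC_pull (F := fun x : V => matC x i j) _ c2) => //; exact: smoothC_entry.
Qed.

(** An intersection of open sets over a compact family is open. *)
Lemma open_stable_dom A : open A -> open (stable_dom A).
Proof.
move=> oA; rewrite openE => x Ax.
have nc := (compact_near_coveringP _).1 (@sphere3_compact R).
have := nc V (nbhs x) (fun y w => A (mulV (qrow w, y))) _ _.
have nearA : forall w, sphere3 w -> \forall w' \near w & y \near x, A (mulV (qrow w', y)).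
  move=> w sw; have [h hE] := qrowP sw.
  have cm : (mulV (qrow z.1, z.2)) @[z --> (w, x)] --> mulV (qrow w, x).
    apply: (@cvg_comp _ _ _ (fun z : 'rV[R]_4 * V => (qrow z.1, z.2)) mulV _ (nbhs (qrow w, x))); last exact: mulV_continuous.
    apply: (@cvg_pair _ _ _ _ (nbhs (qrow w)) (nbhs x)); last exact: cvg_snd.
    by apply: (@cvg_comp _ _ _ fst (@qrow R) _ (nbhs w)); [exact: cvg_fst|exact: qrow_continuous].
  apply: (cm A); apply: open_nbhs_nbhs; split=> //.
  by rewrite /mulV /= hE matCK; exact: Ax.
move=> /(_ _ nearA); apply: filterS => y H h.
by have [w sw wE] := qrow_surj h; have := H w sw; rewrite /mulV /= wE matCK.
Qed.

(** Convolution of [f] with a density on SU(2), given in polar coordinates. *)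
Definition Avg (kap : T -> C) f g : C :=
  cint 0 pi (J (fun q => kap q * f (hpol q * g)%g)).

Let px (p : P) : V := p.1.1.1.
Let pq (p : P) : T := ((p.1.1.2, p.1.2), p.2).

Let px_continuous : continuous px.
Proof.
move=> p; apply: (@cvg_comp _ _ _ (fun p : P => p.1.1) fst _ (nbhs p.1.1)); last exact: cvg_fst.
by apply: (@cvg_comp _ _ _ fst fst _ (nbhs p.1)); exact: cvg_fst.
Qed.

Let pq_continuous : continuous pq.
Proof.
move=> p; have c11 : (fun p : P => p.1.1) @ p --> p.1.1.
  by apply: (@cvg_comp _ _ _ fst fst _ (nbhs p.1)); exact: cvg_fst.
apply: (@cvg_pair _ _ _ _ (nbhs (p.1.1.2, p.1.2)) (nbhs p.2)); last exact: cvg_snd.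
apply: (@cvg_pair _ _ _ _ (nbhs p.1.1.2) (nbhs p.1.2)).
  by apply: (@cvg_comp _ _ _ (fun p : P => p.1.1) snd _ (nbhs p.1.1)); last exact: cvg_snd.
by apply: (@cvg_comp _ _ _ fst snd _ (nbhs p.1)); [exact: cvg_fst|exact: cvg_snd].
Qed.

Lemma matC_line (M N : 'M[C]_2) (t : R) : matC (emb M + t *: emb N) = M + t%:C *: N.
Proof.
apply/matrixP => i j; rewrite !mxE; apply: ceq; rewrite ?cReD ?cImD ?cReM ?cImM /=; ring.
Qed.

Lemma emb_line (M N : 'M[C]_2) (t : R) : emb (M + t%:C *: N) = emb M + t *: emb N.
Proof.
congr (_, _); apply/matrixP => i j; rewrite !mxE ?cReD ?cImD ?cReM ?cImM /=; ring.
Qed.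

(** Left translations commute with left-invariant derivatives, so both
    smoothness and the formula follow by differentiating an extension of [f]
    under the integral sign. *)
Lemma Avg_Lie kap f : smoothC setT kap -> S f ->
  S (Avg kap f) /\ forall Y g, lie_su2 Y -> Lie Y (Avg kap f) g = Avg kap (Lie Y f) g.
Proof.
move=> sk sf; have /su2_smoothP[A [F hF]] := sf; have [oA sF Ag Fg] := hF.
pose A' := stable_dom A; have oA' : open A' by exact: open_stable_dom.
pose G (p : P) := emb (su2val (hpol (pq p)) *m matC (px p)).
pose Psi p := kap (pq p) * F (G p).
have pi0 : 0 <= pi :> R by exact: pi_ge0.
have pi20 : 0 <= pi *+ 2 :> R by rewrite mulrn_wge0.
have oX (U W : normedModType R) (B : set U) : open B -> open (B `*` [set: W]).
  move=> oB; have -> : B `*` [set: W] = fst @^-1` B.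
    by apply/seteqP; split=> [z []|z Bz].
  by apply: open_preim oB => z; exact: cvg_fst.
have sG pp : smooth_on setT (fun p => ccoord pp (G p)).
  apply: smooth_ccoord_of; apply: smoothC_mulmx => [|i j|i j]; first exact: oT.
    by apply: (smoothC_pull (F := fun q : T => su2val (hpol q) i j) _ pq_continuous) => //;
      exact: smooth_hpol_entry.
  by apply: (smoothC_pull (F := fun x : V => matC x i j) _ px_continuous) => //;
    exact: smoothC_entry.
have sPsi : smoothC (((A' `*` setT) `*` setT) `*` setT) Psi.
  have oD := oX _ R _ (oX _ R _ (oX _ R _ oA')).
  apply: smoothCM => //; first exact: (smoothC_pull (F := kap) _ pq_continuous).
  apply: (smoothC_comp (@ccoordE R) oD oA) => // [p [[[Ap _] _] _]|pp n]; first exact: Ap.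
  exact: Cn_on_sub (sG pp n).
have [s2 D2] := smoothC_cint (oX _ R _ (oX _ R _ oA')) pi20 sPsi.
have [s1 D1] := smoothC_cint (oX _ R _ oA') pi0 s2.
have [s0 D0] := smoothC_cint oA' pi0 s1.
have A'g g : A' (emb (su2val g)) by move=> h; rewrite matCK; exact: (Ag (h * g)%g).
have ext : extends A' (fun x => cint 0 pi (fun th => cint 0 pi (fun al =>
    cint 0 (pi *+ 2) (fun be => Psi (x, th, al, be))))) (Avg kap f).
  split; [exact: oA'|exact: s0|exact: A'g|move=> g]; apply: (congr1 (cint 0 pi)); apply/funext => th.
  apply: (congr1 (cint 0 pi)); apply/funext => al; apply: (congr1 (cint _ _)); apply/funext => be.
  by rewrite /Psi /G /px /pq /= matCK; congr (_ * _); exact: (Fg (hpol (th, al, be) * g)%g).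
split=> [|Y g hY]; first by apply/su2_smoothP; eexists; eexists; exact: ext.
rewrite (extends_Lie g ext hY) D0 //; congr cint; apply/funext => th.
rewrite D1; last by split=> //; exact: A'g.
congr cint; apply/funext => al; rewrite D2; last by do 2!split=> //; exact: A'g.
congr cint; apply/funext => be.
apply: DC_line; set q := (th, al, be).
have -> : (fun t : R => Psi ((emb (su2val g), th, al, be) +
      t *: (emb (su2val g *m Y), 0 : R, 0 : R, 0 : R))) =
    (fun t : R => kap q * F (emb (su2val (hpol q * g)%g) + t *: emb (su2val (hpol q * g)%g *m Y))).
  apply/funext => t; rewrite /Psi /G.
  have -> : pq ((emb (su2val g), th, al, be) +
      t *: (emb (su2val g *m Y), 0 : R, 0 : R, 0 : R)) = q.
    by rewrite /pq /=; congr (_, _, _); exact: etrans (congr1 _ (mulr0 t)) (addr0 _).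
  by rewrite /px /= matC_line -emb_line mulmxDr -scalemxAr mulmxA.
apply: isdCZ.
have := @line_DC R V A F (emb (su2val (hpol q * g)%g)) (emb (su2val (hpol q * g)%g *m Y)) 0 sF.
by rewrite scale0r addr0 => /(_ (Ag _)); rewrite (extends_Lie (hpol q * g)%g hF hY).
Qed.

End Averaging.

(** * The resolvent of the Laplace operator on functions of odd weight *)

Section Resolvent.
Variable R : realType.
Local Notation C := R[i].
Local Notation S := (@su2_smooth R).
Local Notation T := ((R * R) * R)%type.
Implicit Types (c f phi : SU2 R -> C) (g h : SU2 R) (q : T) (k : R -> C).

Let oT (W : normedModType R) : open [set: W] := @openT W.
Let pi0 : 0 <= pi :> R. Proof. exact: pi_ge0. Qed.
Let pi20 : 0 <= pi *+ 2 :> R. Proof. by rewrite mulrn_wge0 // pi_ge0. Qed.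

Let Zs (d : C) (F : T -> C) : smoothC setT F -> smoothC setT (fun q => d * F q).
Proof. by move=> sF; apply: smoothCM sF; [exact: oT|exact: smoothC_cst]. Qed.

Lemma cintJD F G : smoothC setT F -> smoothC setT G ->
  cint 0 pi (J (fun q => F q + G q)) = cint 0 pi (J F) + cint 0 pi (J G) :> C.
Proof.
move=> sF sG.
have -> : J (fun q => F q + G q) = (fun th => J F th + J G th).
  by apply/funext => th; exact: JD.
exact: cintD (smoothC_ccont (J_smooth sF)) (smoothC_ccont (J_smooth sG)).
Qed.

Lemma cintJZ (a : C) F : smoothC setT F ->
  cint 0 pi (J (fun q => a * F q)) = a * cint 0 pi (J F).
Proof.
move=> sF; have -> : J (fun q => a * F q) = (fun th => a * J F th).
  by apply/funext => th; exact: JZ.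
exact: cintZ (smoothC_ccont (J_smooth sF)).
Qed.

Section Linearity.
Variable kap : T -> C.
Hypothesis sk : smoothC setT kap.

Let sq f g : S f -> smoothC setT (fun q => kap q * f (hpol q * g)%g).
Proof.
move=> sf; apply: smoothCM => //.
exact: smooth_hpol (su2_smooth_right g sf).
Qed.

Lemma Avg_lin (a b : C) c f g : S c -> S f ->
  Avg kap (fun h => a * c h + b * f h) g = a * Avg kap c g + b * Avg kap f g.
Proof.
move=> sc sf; have hc := sq g sc; have hf := sq g sf.
have e := etrans (cintJD (Zs a hc) (Zs b hf)) (congr2 +%R (cintJZ a hc) (cintJZ b hf)).
apply: etrans e; apply: (congr1 (fun F => cint 0 pi (J F))); apply/funext => q; ring.
Qed.

Lemma Avg_lin3 (a b d : C) c1 c2 c3 g : S c1 -> S c2 -> S c3 ->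
  Avg kap (fun h => a * c1 h + b * c2 h + d * c3 h) g =
  a * Avg kap c1 g + b * Avg kap c2 g + d * Avg kap c3 g.
Proof.
move=> s1 s2 s3.
have s12 := su2_smoothD (su2_smoothZ a s1) (su2_smoothZ b s2).
have e := Avg_lin 1 d g s12 s3; rewrite mul1r (Avg_lin a b g s1 s2) in e.
by rewrite -e; congr (Avg kap _ g); apply/funext => h; rewrite mul1r.
Qed.

Lemma Avg_smooth f : S f -> S (Avg kap f).
Proof. by move=> sf; have [] := Avg_Lie sk sf. Qed.

Lemma Avg_der w f : S f -> der w (Avg kap f) = Avg kap (der w f).
Proof.
move=> sf; have [_ L] := Avg_Lie sk sf; apply/funext => g.
have e1 : Li (Avg kap f) g = Avg kap (Li f) g by rewrite Li.unlock; exact: L (lie_qi R).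
have e2 : Lj (Avg kap f) g = Avg kap (Lj f) g by rewrite Lj.unlock; exact: L (lie_qj R).
have e3 : Lk (Avg kap f) g = Avg kap (Lk f) g by rewrite Lk.unlock; exact: L (lie_qk R).
rewrite {1}/der e1 e2 e3.
exact: esym (Avg_lin3 _ _ _ g (smooth_Li sf) (smooth_Lj sf) (smooth_Lk sf)).
Qed.

Lemma Avg_W z f : W z f -> W z (Avg kap f).
Proof.
move=> [sf wf]; split; first exact: Avg_smooth.
rewrite /wt Avg_der // -/(wt f) wf; apply/funext => g.
have := Avg_lin z 0 g sf sf; rewrite mul0r addr0 => <-.
by congr (Avg kap _ g); apply/funext => h; rewrite mul0r addr0.
Qed.

End Linearity.

(** [Lap] is the Casimir operator, which on functions of weight [-n] is a
    combination of [rz lw] and a scalar. *)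
Lemma Lap_weight (n : nat) f g : W (- n%:R) f ->
  4 * rz (lw f) g = (1 - (n%:R + 1) ^+ 2) * f g - Lap f g.
Proof.
move=> [sf wf].
have Lif : Li f = (fun h => - (('i)%R * n%:R) * f h).
  apply/funext => h; have : - ('i)%R * Li f h = - n%:R * f h.
    by rewrite -[RHS](congr1 (fun F => F h) wf) /wt /der /= !mul0r !addr0.
  have := i2 R => E e.
  transitivity (- (('i)%R * ('i)%R) * Li f h); first by rewrite E opprK mul1r.
  transitivity (('i)%R * (- ('i)%R * Li f h)); first by ring.
  by rewrite e; ring.
have LLi : Li (Li f) g = - n%:R ^+ 2 * f g.
  rewrite [in LHS]Lif.
  have -> : Li (fun h => - (('i)%R * n%:R) * f h) g = - (('i)%R * n%:R) * Li f g.
    by rewrite Li.unlock; exact: LieZ (lie_qi R) sf.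
  rewrite Lif; transitivity ((('i)%R * ('i)%R) * n%:R ^+ 2 * f g); first by ring.
  by rewrite i2; ring.
rewrite /Lap LLi /rz /lw der_der //= (Ljk g sf) Lif.
have E2 : ('i)%R ^+ 2 = -1 :> C by rewrite expr2 i2.
move: ('i)%R E2 => I E2; by field: E2.
Qed.

(** The volume element of polar coordinates is [sin^2 theta sin al]; only one
    factor [sin theta] is included, since the radial equation becomes one
    with constant coefficients for [sin theta] times the mean. *)
Definition kernel k q : C := k q.1.1 * ((sin q.1.1)%:C * (sin q.1.2)%:C).

Lemma smooth_kernel k : smoothC setT k -> smoothC setT (kernel k).
Proof.
move=> sk; apply: smoothCM; first exact: oT.
  have c11 : continuous (fun q : T => q.1.1).
    by move=> q; apply: (@cvg_comp _ _ _ fst fst _ (nbhs q.1)); exact: cvg_fst.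
  exact: (smoothC_pull (F := k) _ c11).
apply: smoothCM; first exact: oT.
  by apply: smoothC_real; apply: smooth_sin (@smooth_q1 R); exact: oT.
by apply: smoothC_real; apply: smooth_sin (@smooth_q2 R); exact: oT.
Qed.

Let sMean phi : S phi -> smoothC setT (fun q : T => (sin q.1.2)%:C * phi (hpol q)).
Proof.
move=> sp; apply: smoothCM (smooth_hpol sp); first exact: oT.
by apply: smoothC_real; apply: smooth_sin (@smooth_q2 R); exact: oT.
Qed.

Lemma Mean_smooth phi : S phi -> smoothC setT (Mean phi).
Proof. by move=> sp; apply: J_smooth; exact: sMean. Qed.

Lemma Avg_kernel k f g : S f ->
  Avg (kernel k) f g =
  cint 0 pi (fun th => k th * ((sin th)%:C * Mean (fun h => f (h * g)%g) th)).
Proof.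
move=> sf; rewrite /Avg; apply: (congr1 (cint 0 pi)); apply/funext => th.
rewrite mulrA; apply: etrans (JZ _ th (sMean (su2_smooth_right g sf))).
rewrite /J; apply: (congr1 (cint 0 pi)); apply/funext => al.
by apply: (congr1 (cint _ _)); apply/funext => be; rewrite /kernel /=; ring.
Qed.

Lemma cint_const (a b : R) (d : C) : a <= b -> cint a b (fun=> d) = (b - a)%:C * d.
Proof.
move=> ab; have -> : (fun=> d) = (fun t : R => (1 : R)%:C * d :> C).
  by apply/funext => t; rewrite mul1r.
rewrite (@cint_FTC _ a b (fun t => t%:C * d) _ ab); first by rewrite rmorphB; ring.
  by split=> t; exact: cvg_cst.
move=> t; apply: isdC_eq (isdCM (isdC_real (is_derive_id t (1 : R))) (isdC_cst d t)) _.
by rewrite mulr0 addr0.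
Qed.

(** The spheres of radius [0] and [pi] are reduced to the points [1] and
    [-1]. *)
Lemma Mean_const phi (d : C) th : (forall al be, phi (hpol (th, al, be)) = d) ->
  Mean phi th = (4 * pi)%:C * d.
Proof.
move=> E; rewrite /Mean /J.
transitivity (cint 0 pi (fun al : R => (sin al)%:C * ((pi *+ 2)%:C * d))).
  apply: (congr1 (cint 0 pi)); apply/funext => al.
  transitivity (cint 0 (pi *+ 2) (fun=> (sin al)%:C * d)).
    by apply: (congr1 (cint _ _)); apply/funext => be; rewrite /= E.
  by rewrite cint_const // subr0; ring.
rewrite (@cint_FTC _ 0 pi (fun al => - (cos al)%:C * ((pi *+ 2)%:C * d)) _ pi0).
- by rewrite cospi cos0 mulr2n !rmorphM !rmorphD /=; ring.
- have cs : continuous (fun al : R => sin al) by exact: continuous_sin.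
  split=> t.
    under eq_fun do rewrite cReM /= mul0r subr0.
    by apply: cvgM; [exact: cs|exact: cvg_cst].
  under eq_fun do rewrite cImM /= mul0r addr0.
  by apply: cvgM; [exact: cs|exact: cvg_cst].
- move=> al; have d1 : isdC (fun al => - (cos al)%:C : C) al (sin al)%:C.
    have := isdC_real (is_deriveN (is_derive_cos al)); rewrite opprK.
    by under eq_fun do rewrite rmorphN.
  by apply: isdC_eq (isdCM d1 (isdC_cst _ al)) _; rewrite mulr0 addr0.
Qed.

Definition mone : SU2 R := su2_of (-1) 0 0 0.

Lemma Mean_0 phi : Mean phi 0 = (4 * pi)%:C * phi 1%g.
Proof.
apply: Mean_const => al be; congr phi; apply/val_inj; rewrite /= hpolE3.
by rewrite cos0 sin0 !mul0r; apply: mx22P; rewrite !mxE /= ?oppr0.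
Qed.

Lemma Mean_pi phi : Mean phi pi = (4 * pi)%:C * phi mone.
Proof.
apply: Mean_const => al be; congr phi.
by rewrite /hpol /= cospi sinpi !mul0r.
Qed.

End Resolvent.

Section Surjectivity.
Variable R : realType.
Local Notation C := R[i].
Local Notation S := (@su2_smooth R).
Local Notation T := ((R * R) * R)%type.
Implicit Types (c f phi : SU2 R -> C) (g h : SU2 R) (k : R -> C).

Let oT (W : normedModType R) : open [set: W] := @openT W.
Let pi0 : 0 <= pi :> R. Proof. exact: pi_ge0. Qed.

Let ssin : smoothC [set: R] (fun t => (sin t)%:C : C).
Proof. apply: smoothC_real; apply: smooth_sin; first exact: oT.
by apply: smooth_on_lin => // t; exact: cvg_id. Qed.

Let sM k1 k2 : smoothC setT k1 -> smoothC setT k2 -> smoothC setT (fun t => k1 t * k2 t).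
Proof. by move=> h1 h2; apply: smoothCM => //. Qed.

(** Multiplication by [sin theta] removes the first-order term of the Darboux
    equation. *)
Lemma spherical_ode phi th : S phi ->
  let w1 t := (cos t)%:C * Mean phi t + (sin t)%:C * Mean1 phi t in
  isdC (fun t => (sin t)%:C * Mean phi t) th (w1 th) /\
  isdC w1 th ((sin th)%:C * Mean (Lap phi) th - (sin th)%:C * Mean phi th).
Proof.
move=> sp /=; have dM := Mean_derive sp th; have dM1 := Mean1_derive sp th.
have ds : isdC (fun t => (sin t)%:C) th (cos th)%:C by exact: isdC_real (is_derive_sin th).
have dc : isdC (fun t => (cos t)%:C) th (- (sin th)%:C).
  by rewrite -rmorphN; exact: isdC_real (is_derive_cos th).
split; first exact: isdCM ds dM.
apply: isdC_eq (isdCD (isdCM dc dM) (isdCM ds dM1)) _.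
move: (Mean_Lap sp th).
move: (Mean (Lap phi) th) (Mean2 phi th) (Mean1 phi th) (Mean phi th) => a b c d.
by move: (sin th)%:C (cos th)%:C => s0 c0 ->; ring.
Qed.

Lemma smooth_Lap phi : S phi -> S (Lap phi).
Proof.
move=> sp; apply: su2_smoothD; [apply: su2_smoothD|].
- exact: smooth_Li (smooth_Li sp).
- exact: smooth_Lj (smooth_Lj sp).
- exact: smooth_Lk (smooth_Lk sp).
Qed.

(** Integration by parts, twice. The function [sin theta * Mean phi] vanishes
    at [0] and [pi], and its derivative there is [4 pi] times a value of
    [phi], with opposite signs at the two ends. *)
Lemma green_kernel k k1 k2 phi : S phi -> smoothC setT k -> smoothC setT k2 ->
  (forall t, isdC k t (k1 t)) -> (forall t, isdC k1 t (k2 t)) ->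
  cint 0 pi (fun t => k t * ((sin t)%:C * Mean (Lap phi) t)) =
  cint 0 pi (fun t => k t * ((sin t)%:C * Mean phi t)) +
  cint 0 pi (fun t => k2 t * ((sin t)%:C * Mean phi t)) -
  (4 * pi)%:C * (k pi * phi (mone R) + k 0 * phi 1%g).
Proof.
move=> sp sk sk2 dk dk1; have sL := smooth_Lap sp.
have sw : smoothC setT (fun t => (sin t)%:C * Mean phi t) by exact: sM ssin (Mean_smooth sp).
have swL : smoothC setT (fun t => (sin t)%:C * Mean (Lap phi) t).
  exact: sM ssin (Mean_smooth sL).
have N (d : C) F : smoothC setT F -> smoothC setT (fun t : R => d * F t).
  by move=> sF; apply: sM sF; exact: smoothC_cst.
have c0 := smoothC_ccont (sM sk swL).
have c1 := smoothC_ccont (N (-1) _ (sM sk sw)).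
have c2 := smoothC_ccont (N (-1) _ (sM sk2 sw)).
have c3 := smoothC_ccont (smoothCD (oT _) (N (-1) _ (sM sk sw)) (N (-1) _ (sM sk2 sw))).
have c4 := smoothC_ccont (smoothCD (oT _) (sM sk swL)
  (smoothCD (oT _) (N (-1) _ (sM sk sw)) (N (-1) _ (sM sk2 sw)))).
pose w1 t := (cos t)%:C * Mean phi t + (sin t)%:C * Mean1 phi t.
have alg (x y z u v u1 v1 p q a b d : C) : x + (-1 * y + -1 * z) =
    u * ((-1 : R)%:C * (d * p) + (0 : R)%:C * a) + -1 * (u1 * ((0 : R)%:C * (d * p))) -
    (v * ((1 : R)%:C * (d * q) + (0 : R)%:C * b) + -1 * (v1 * ((0 : R)%:C * (d * q)))) ->
    x = y + z - d * (u * p + v * q).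
  rewrite rmorph0 rmorphN rmorph1 => e; apply: (addIr (-1 * y + -1 * z)).
  by rewrite e; ring.
have D t : isdC (fun t => k t * w1 t + - 1 * (k1 t * ((sin t)%:C * Mean phi t))) t
  (k t * ((sin t)%:C * Mean (Lap phi) t) + (-1 * (k t * ((sin t)%:C * Mean phi t)) +
    -1 * (k2 t * ((sin t)%:C * Mean phi t)))).
  have [dw dw1] := spherical_ode t sp.
  apply: isdC_eq (isdCD (isdCM (dk t) dw1) (isdCZ (-1) (isdCM (dk1 t) dw))) _.
  rewrite /w1; move: (Mean (Lap phi) t) (Mean1 phi t) (Mean phi t) => a b d.
  by move: (sin t)%:C (cos t)%:C (k t) (k1 t) (k2 t) => s0 c0' x y z; ring.
have := cint_FTC pi0 c4 D.
rewrite (cintD 0 pi c0 c3) (cintD 0 pi c1 c2).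
rewrite (cintZ 0 pi (-1) (smoothC_ccont (sM sk sw))).
rewrite (cintZ 0 pi (-1) (smoothC_ccont (sM sk2 sw))).
rewrite /w1 sin0 sinpi cos0 cospi Mean_0 Mean_pi; exact: alg.
Qed.

(** The boundary terms of [green_kernel] at [1] and [-1] combine, as [f] is
    odd under the central element. *)
Lemma Avg_resolvent (n : nat) (rho nu2 : C) k k1 k2 f g :
  W (- n%:R) f -> (forall h, f (mone R * h)%g = - f h) ->
  smoothC setT k -> smoothC setT k2 ->
  (forall t, isdC k t (k1 t)) -> (forall t, isdC k1 t (k2 t)) ->
  nu2 = (n%:R + 1) ^+ 2 + 4 * rho ->
  4 * (rz (lw (Avg (kernel k) f)) g - rho * Avg (kernel k) f g) =
  - ((4 * pi)%:C * (k pi - k 0) * f g +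
     (Avg (kernel k2) f g + nu2 * Avg (kernel k) f g)).
Proof.
move=> Wf odd_f sk sk2 dk dk1 nuE; have [sf wf] := Wf.
have sK := smooth_kernel sk; have sl : S (lw f) by exact: smooth_der.
have -> : rz (lw (Avg (kernel k) f)) = Avg (kernel k) (rz (lw f)).
  by rewrite /lw Avg_der // /rz Avg_der.
have e4 : 4 * Avg (kernel k) (rz (lw f)) g =
    (1 - (n%:R + 1) ^+ 2) * Avg (kernel k) f g - Avg (kernel k) (Lap f) g.
  have := Avg_lin sK (1 - (n%:R + 1) ^+ 2) (-1) g sf (smooth_Lap sf).
  rewrite mulN1r => <-; have srl : S (rz (lw f)) by exact: smooth_der.
  have := Avg_lin sK 4 0 g srl sf; rewrite mul0r addr0 => <-.
  by congr (Avg _ _ g); apply/funext => h; rewrite mul0r addr0 (Lap_weight h Wf) mulN1r.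
have eL : Avg (kernel k) (Lap f) g = Avg (kernel k) f g + Avg (kernel k2) f g +
    (4 * pi)%:C * (k pi - k 0) * f g.
  have sg := su2_smooth_right g sf.
  rewrite (Avg_kernel k g (smooth_Lap sf)) (Avg_kernel k g sf) (Avg_kernel k2 g sf).
  have -> : (fun h => Lap f (h * g)%g) = Lap (fun h => f (h * g)%g).
    by apply/funext => h; rewrite Lap_right.
  have alg (x y d u v p p1 q : C) : p = - q -> p1 = q ->
    x + y - d * (u * p + v * p1) = x + y + d * (u - v) * q by move=> -> ->; ring.
  apply: etrans (green_kernel sg sk sk2 dk dk1) _.
  by apply: alg; [exact: odd_f|congr f; exact: mul1g].
have alg (x y z m d : C) : (1 - m) * x - (x + y + d) - 4 * (rho * x) =
   - (d + (y + (m + 4 * rho) * x)) by ring.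
rewrite mulrBr e4 eL nuE; exact: alg.
Qed.

(** The function [exp (z t)] of the real variable [t]. *)
Definition cexp (z : C) (t : R) : C :=
  (expR (complex.Re z * t))%:C * (cos (complex.Im z * t) +i* sin (complex.Im z * t)).

Let dlin (a t : R) : is_derive t (1 : R) (fun s => a * s) a.
Proof.
apply: is_derive_eq (is_derive1M (is_derive_cst a t (1 : R)) (is_derive_id t (1 : R))) _.
by rewrite mulr1 mul0r add0r.
Qed.

Lemma isdC_cexp z t : isdC (cexp z) t (z * cexp z t).
Proof.
have de := is_derive1_comp (is_derive_expR (complex.Re z * t)) (dlin (complex.Re z) t).
have dc := is_derive1_comp (is_derive_cos (complex.Im z * t)) (dlin (complex.Im z) t).
have ds := is_derive1_comp (is_derive_sin (complex.Im z * t)) (dlin (complex.Im z) t).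
have dcs : isdC (fun s => cos (complex.Im z * s) +i* sin (complex.Im z * s)) t
  ((- sin (complex.Im z * t) * complex.Im z) +i* (cos (complex.Im z * t) * complex.Im z)).
  by split.
apply: isdC_eq (isdCM (isdC_real de) dcs) _.
rewrite /cexp; apply: ceq; rewrite ?cReD ?cImD ?cReM ?cImM /=; ring.
Qed.

Lemma cexp0 z : cexp z 0 = 1.
Proof. by rewrite /cexp !mulr0 expR0 cos0 sin0 mul1r. Qed.

Lemma cexp_inv z t : cexp z t * cexp (- z) t = 1.
Proof.
have : complex.Re (- z) = - complex.Re z /\ complex.Im (- z) = - complex.Im z.
  by rewrite cReN cImN.
rewrite /cexp => -[-> ->]; rewrite !mulNr cosN sinN.
rewrite mulrACA -rmorphM -expRD subrr expR0 mul1r.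
by apply: ceq; rewrite ?cReM ?cImM /= -?[RHS](cos2Dsin2 (complex.Im z * t)); ring.
Qed.

Lemma smooth_cexp z : smoothC setT (cexp z).
Proof.
have slin (a : R) : smooth_on [set: R] (fun s => a * s).
  apply: smooth_on_lin => [t|x v b]; last first.
    exact: etrans (mulrDr a x (b * v)) (congr1 _ (mulrCA a b v)).
  by apply: cvgM; [exact: cvg_cst|exact: cvg_id].
apply: smoothCM; [exact: oT|apply: smoothC_real|].
  by apply: smooth_exp; [exact: oT|exact: slin].
by split; [apply: smooth_cos|apply: smooth_sin]; [exact: oT|exact: slin|exact: oT|exact: slin].
Qed.

(** Along the torus a function of weight [z] satisfies a linear differential
    equation with constant coefficients. *)
Lemma torus_weight z c g t : W z c ->
  c (g * su2_exp (t%:C *: qi R))%g = cexp (('i)%R * z) t * c g.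
Proof.
move=> [sc wc]; pose y (s : R) := c (g * su2_exp (s%:C *: qi R))%g.
have Lic h : Li c h = ('i)%R * z * c h.
  have := congr1 (fun F => ('i)%R * F h) wc; rewrite /wt /der /= !mul0r !addr0.
  by rewrite mulrA mulrN i2 opprK mul1r mulrA.
have dy s : isdC y s (('i)%R * z * y s).
  have := Lic (g * su2_exp (s%:C *: qi R))%g; rewrite Li.unlock /y => <-.
  exact: (Lie_exp g s sc (lie_qi R)).
have dconst s : isdC (fun s => cexp (- (('i)%R * z)) s * y s) s 0.
  apply: isdC_eq (isdCM (isdC_cexp (- (('i)%R * z)) s) (dy s)) _.
  by move: (cexp _ _) (y s) => u v; ring.
have y0 : y 0 = c g by rewrite /y exp_curve0.
have := isdC_const dconst t; rewrite cexp0 mul1r y0 => <-.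
by rewrite mulrA cexp_inv mul1r.
Qed.

End Surjectivity.

Section Surjective.
Variable R : realType.
Local Notation C := R[i].
Local Notation S := (@su2_smooth R).
Implicit Types (c f : SU2 R -> C) (g h : SU2 R).

Lemma cexp_int (n : nat) (s : R) :
  cexp (('i)%R * - n%:R) s = (cos s -i* sin s) ^+ n :> C.
Proof.
have [e1 e2] : complex.Re (('i)%R * - n%:R : C) = 0 /\ complex.Im (('i)%R * - n%:R : C) = - n%:R.
  have -> : n%:R = (n%:R : R)%:C :> C by rewrite rmorph_nat.
  by rewrite cReM cImM /= !(oppr0, mulr0, mul0r, subr0, addr0, add0r, mul1r).
rewrite /cexp e1 e2 mul0r expR0 mul1r mulNr cosN sinN.
have := cos_sin_pow (- s) n; rewrite cosN sinN => ->.
by rewrite mulNrn cosN sinN -[s *+ n]mulr_natl.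
Qed.

(** The central element [-1] is [exp (pi qi)]. *)
Lemma odd_central (n : nat) f h : odd n -> W (- n%:R) f -> f (mone R * h)%g = - f h.
Proof.
move=> on Wf.
have -> : (mone R * h)%g = (h * su2_exp ((pi : R)%:C *: qi R))%g.
  have E : su2val (mone R) = - 1%:M.
    rewrite /mone su2_ofE; last by ring.
    by apply: mx22P; rewrite !mxE /=; apply: ceq => /=; ring.
  have E' : su2val (su2_exp ((pi : R)%:C *: qi R)) = - 1%:M.
    rewrite su2_exp_imq; last by ring.
    rewrite cospi sinpi.
    by apply: mx22P; rewrite !mxE /=; apply: ceq => /=; ring.
  by apply/val_inj; rewrite /= E E' mulNmx mulmxN mul1mx mulmx1.
rewrite (torus_weight h pi Wf).
rewrite cexp_int cospi sinpi oppr0 (_ : -1 +i* 0 = -1); last by apply: ceq; rewrite /= ?oppr0.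
by rewrite -signr_odd on mulN1r.
Qed.

Lemma Avg_kernel_lin (a b : C) (k k' : R -> C) f g :
  smoothC setT k -> smoothC setT k' -> S f ->
  Avg (kernel (fun t => a * k t + b * k' t)) f g =
  a * Avg (kernel k) f g + b * Avg (kernel k') f g.
Proof.
move=> sk sk' sf.
have s0 : smoothC [set: R] (fun t => (sin t)%:C * Mean (fun h => f (h * g)%g) t).
  apply: smoothCM; first exact: openT.
    apply: smoothC_real; apply: smooth_sin; first exact: openT.
    by apply: smooth_on_lin => // t; exact: cvg_id.
  exact: Mean_smooth (su2_smooth_right g sf).
have sM (d : C) F : smoothC setT F -> smoothC setT (fun t => d * (F t *
    ((sin t)%:C * Mean (fun h => f (h * g)%g) t))).
  by move=> sF; apply: smoothCM (smoothC_cst _ d) (smoothCM _ sF s0); exact: openT.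
have sM1 F : smoothC setT F -> smoothC setT (fun t => F t *
    ((sin t)%:C * Mean (fun h => f (h * g)%g) t)).
  by move=> sF; apply: smoothCM sF s0; exact: openT.
have e := etrans (cintD 0 pi (smoothC_ccont (sM a k sk)) (smoothC_ccont (sM b k' sk')))
  (congr2 +%R (cintZ 0 pi a (smoothC_ccont (sM1 k sk))) (cintZ 0 pi b (smoothC_ccont (sM1 k' sk')))).
rewrite !Avg_kernel //; apply: etrans e; apply: (congr1 (cint 0 pi)).
by apply/funext => t; rewrite mulrDl !mulrA.
Qed.

(** With [nu^2 = nu2], the kernel [exp (i nu theta)] inverts the operator
    unless it takes equal values at [0] and [pi]. In that case the
    corresponding average solves the homogeneous equation, hence vanishes,
    and this removes the term [2 i nu exp (i nu theta)] from the equation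
    satisfied by the kernel [theta exp (i nu theta)]. *)
Lemma rz_lw_surj (n : nat) rho f : odd n -> (forall j : nat, rho != (j * (j + n + 1))%:R) ->
  W (- n%:R) f ->
  exists2 u, W (- n%:R) u & forall g, rz (lw u) g - rho * u g = f g.
Proof.
move=> on nrho Wf; have odd_f h := odd_central h on Wf.
pose nu2 : C := (n%:R + 1) ^+ 2 + 4 * rho.
pose z := ('i)%R * sqrtc nu2.
have zz : z ^+ 2 = - nu2.
  by rewrite exprMn sqr_sqrtc expr2 i2 mulN1r.
have pi_n0 : (pi : R)%:C != 0 :> C.
  by rewrite fmorph_eq0 gt_eqF // pi_gt0.
have p4 : (4 * pi : R)%:C != 0 :> C.
  by rewrite fmorph_eq0 mulf_neq0 // ?pnatr_eq0 // gt_eqF // pi_gt0.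
have solve k (b : C) : smoothC setT k -> b != 0 ->
    (forall g, 4 * (rz (lw (Avg (kernel k) f)) g - rho * Avg (kernel k) f g) = b * f g) ->
    exists2 u, W (- n%:R) u & forall g, rz (lw u) g - rho * u g = f g.
  move=> sk b0 E; have WA := Avg_W (smooth_kernel sk) Wf; have [sA _] := WA.
  exists (fun g => (4 / b) * Avg (kernel k) f g); first exact: WZ.
  move=> g; rewrite lwZ // rzZ; last exact: smooth_der.
  have := E g; move: (rz _ g) (Avg _ _ g) (f g) => x y w e.
  have -> : 4 / b * x - rho * (4 / b * y) = b^-1 * (4 * (x - rho * y)) by ring.
  by rewrite e mulKf.
have de := isdC_cexp z; have se := smooth_cexp z.
have dde t : isdC (fun t => z * cexp z t) t (- nu2 * cexp z t).
  by apply: isdC_eq (isdCZ z (de t)) _; rewrite mulrA -expr2 zz.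
have smZ (a : C) : smoothC setT (fun t => a * cexp z t).
  by apply: smoothCM se; [exact: openT|exact: smoothC_cst].
have sf : S f by case: Wf.
have key g : 4 * (rz (lw (Avg (kernel (cexp z)) f)) g - rho * Avg (kernel (cexp z)) f g) =
    - ((4 * pi)%:C * (cexp z pi - 1)) * f g.
  rewrite (Avg_resolvent (rho := rho) (nu2 := nu2) g Wf odd_f se (smZ (- nu2)) de dde erefl).
  have := Avg_kernel_lin (- nu2) 0 g se se sf; rewrite mul0r addr0.
  have -> : (fun t => - nu2 * cexp z t + 0 * cexp z t) = (fun t => - nu2 * cexp z t).
    by apply/funext => t; rewrite mul0r addr0.
  by move=> ->; rewrite cexp0; move: (Avg _ _ _) => x; ring.
have [e1|ne1] := eqVneq (cexp z pi) 1; last first.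
  by apply: (solve _ _ se _ key); rewrite oppr_eq0 mulf_neq0 // subr_eq0.
have A0 : Avg (kernel (cexp z)) f = (fun=> 0).
  apply: (weight_eigen_eq0 (Avg_W (smooth_kernel se) Wf) _ nrho).
  apply/funext => g; have := key g; rewrite e1 subrr mulr0 oppr0 mul0r => /eqP.
  by rewrite mulf_eq0 pnatr_eq0 /= subr_eq0 => /eqP.
pose k t := t%:C * cexp z t.
pose k1 t := cexp z t + t%:C * (z * cexp z t).
pose k2 t := (2 * z) * cexp z t + - nu2 * (t%:C * cexp z t).
have did t : isdC (fun s : R => s%:C) t 1 by exact: isdC_real (is_derive_id t (1 : R)).
have dk t : isdC k t (k1 t).
  by apply: isdC_eq (isdCM (did t) (de t)) _; rewrite mul1r.
have dk1 t : isdC k1 t (k2 t).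
  apply: isdC_eq (isdCD (de t) (isdCM (did t) (dde t))) _; rewrite /k2.
  by move: (cexp z t) => x; ring.
have sid : smoothC [set: R] (fun t => t%:C : C).
  by apply: smoothC_real; apply: smooth_on_lin => // t; exact: cvg_id.
have sk : smoothC setT k by apply: smoothCM sid se; exact: openT.
have sk2 : smoothC setT k2.
  apply: smoothCD; first exact: openT.
    exact: smZ.
  by apply: smoothCM sk; [exact: openT|exact: smoothC_cst].
apply: (solve k (- ((4 * pi)%:C * pi%:C)) sk) => [|g].
  by rewrite oppr_eq0 mulf_neq0.
rewrite (Avg_resolvent (rho := rho) (nu2 := nu2) g Wf odd_f sk sk2 dk dk1 erefl).
have -> : Avg (kernel k2) f g = - nu2 * Avg (kernel k) f g.
  by rewrite (Avg_kernel_lin (2 * z) (- nu2) g se sk sf) A0 mulr0 add0r.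
by rewrite /k e1 rmorph0 mul0r; move: (Avg _ _ _) => x; ring.
Qed.

End Surjective.

(** * Hermite functions *)

Section HermiteFunctions.
Variable R : realType.
Local Notation C := R[i].

(** The pair of the [l]-th and [l+1]-st derivatives of the Gaussian function,
    computed by the recursion of Hermite polynomials, which reaches two steps
    back. *)
Fixpoint gauss_der2 (l : nat) (x : R) : R * R :=
  if l is m.+1 then
    let p := gauss_der2 m x in (p.2, - (2 * x) * p.2 - 2 * m.+1%:R * p.1)
  else (expR (- x ^+ 2), - (2 * x) * expR (- x ^+ 2)).
Definition gauss_der l x := (gauss_der2 l x).1.

Lemma gauss_derSS l x : gauss_der l.+2 x =
  - (2 * x) * gauss_der l.+1 x - 2 * l.+1%:R * gauss_der l x.
Proof. by []. Qed.

Lemma gauss_der1 x : gauss_der 1 x = - (2 * x) * gauss_der 0 x.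
Proof. by []. Qed.

Let dlin (t : R) : is_derive t (1 : R) (fun s : R => - (2 * s)) (- 2).
Proof.
have d2 : is_derive t (1 : R) (fun s : R => (2 : R) * s) (2 : R).
  apply: is_derive_eq (is_derive1M (is_derive_cst (2 : R) t (1 : R)) (is_derive_id t (1 : R))) _.
  by rewrite mulr1 mul0r add0r.
exact: is_deriveN.
Qed.

Let dsq (t : R) : is_derive t (1 : R) (fun s : R => s ^+ 2) (2 * t).
Proof.
apply: is_derive_eq (is_derive1M (is_derive_id t (1 : R)) (is_derive_id t (1 : R))) _; ring.
Qed.

Lemma is_derive_gauss_der l x : is_derive x (1 : R) (gauss_der l) (gauss_der l.+1 x).
Proof.
suff: is_derive x (1 : R) (gauss_der l) (gauss_der l.+1 x) /\
  is_derive x (1 : R) (gauss_der l.+1) (gauss_der l.+2 x) by case.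
have d0 : is_derive x (1 : R) (gauss_der 0) (gauss_der 1 x).
  have dn : is_derive x (1 : R) (fun s : R => - s ^+ 2) (- (2 * x)) := is_deriveN (dsq x).
  have h := is_derive1_comp (f := expR) (g := fun s : R => - s ^+ 2)
    (is_derive_expR (- x ^+ 2)) dn.
  by apply: is_derive_eq h _; rewrite gauss_der1 /gauss_der /= mulrC.
elim: l => [|l [IH1 IH2]]; split => //.
  apply: is_derive_eq (is_derive1M (dlin x) d0) _.
  rewrite gauss_derSS gauss_der1; ring.
have c t : is_derive x (1 : R) (fun=> t : R) 0 by exact: is_derive_cst.
apply: is_derive_eq
  (is_deriveB (is_derive1M (dlin x) IH2) (is_derive1M (c (2 * l.+1%:R)) IH1)) _.
rewrite [RHS]gauss_derSS -[l.+2%:R]natr1; ring.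
Qed.

Lemma hermiteE l x : hermite l x = expR (x ^+ 2 / 2) * gauss_der l x.
Proof.
rewrite /hermite; congr (_ * _); elim: l x => [//|l IH] x.
rewrite derive1nS (_ : derive1n l _ = gauss_der l); last exact/funext.
by rewrite derive1E; have [] := is_derive_gauss_der l x.
Qed.

Lemma is_derive_hermite l x :
  is_derive x (1 : R) (@hermite R l) (x * hermite l x + hermite l.+1 x).
Proof.
rewrite (_ : hermite l = fun x => expR (x ^+ 2 / 2) * gauss_der l x); last first.
  by apply/funext => y; exact: hermiteE.
have c : is_derive x (1 : R) (fun=> 2^-1 : R) 0 by exact: is_derive_cst.
have d := is_derive1_comp (f := expR) (g := fun s : R => s ^+ 2 / 2)
  (is_derive_expR (x ^+ 2 / 2)) (is_derive1M (dsq x) c).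
apply: is_derive_eq (is_derive1M d (is_derive_gauss_der l x)) _.
by rewrite !hermiteE /comp; field.
Qed.

Lemma hermite_rec l x : hermite l.+1 x = - (2 * x * hermite l x) - 2 * l%:R * hermite l.-1 x :> R.
Proof.
rewrite !hermiteE; case: l => [|l]; first by rewrite gauss_der1; ring.
by rewrite gauss_derSS /=; ring.
Qed.

Lemma gauss_der_neq0 l : exists x : R, gauss_der l x != 0.
Proof.
apply: contrapT => h; have {h} h : gauss_der l = fun=> 0.
  by apply/funext => x; apply/eqP/negPn/negP => hx; case: h; exists x.
elim: l h => [|l IH] h.
  by have /eqP := congr1 (fun f => f 0) h; rewrite /gauss_der /= gt_eqF // expR_gt0.
apply: IH; apply/funext => x.
have hS : gauss_der l.+2 x = 0.
  have [_ <-] := is_derive_gauss_der l.+1 x; rewrite h.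
  by have [_ ->] := is_derive_cst (0 : R) x (1 : R).
have := gauss_derSS l x; rewrite hS h mulr0 sub0r => /esym/eqP.
by rewrite oppr_eq0 mulf_eq0 mulf_eq0 !pnatr_eq0 /= => /eqP.
Qed.

(** If the [l]-th derivative of the Gaussian vanished identically, so would
    the next one, and by the recursion all the previous ones. *)
Lemma hermiteC_neq0 l : exists x : R, @hermiteC R l x != 0.
Proof.
have [x hx] := gauss_der_neq0 l; exists x.
by rewrite /hermiteC fmorph_eq0 hermiteE mulf_neq0 // gt_eqF // expR_gt0.
Qed.

Lemma derive_hermiteC l x : derive1C (@hermiteC R l) x =
  x%:C * @hermiteC R l x + @hermiteC R l.+1 x.
Proof.
rewrite (isdC_derive1C (isdC_real (is_derive_hermite l x))).
by rewrite rmorphD rmorphM.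
Qed.

Lemma scale_fun (U : Type) (a : C) (f : U -> C) x : (a *: f) x = a * f x.
Proof. by []. Qed.

(** Creation and annihilation operators for Hermite functions. *)
Lemma sigma_Zvec l : sigma (Zvec R) (@hermiteC R l) = (- (('i)%R / 2)) *: @hermiteC R l.+1.
Proof.
apply/funext => x; rewrite scale_fun /sigma /Zvec /= derive_hermiteC.
by move: (hermiteC _ _) (hermiteC _ _) => a b; field.
Qed.

Lemma sigma_Zbar l : sigma (Zbar R) (@hermiteC R l) = (- (('i)%R * l%:R)) *: @hermiteC R l.-1.
Proof.
apply/funext => x; rewrite scale_fun /sigma /Zbar /= derive_hermiteC.
have -> : @hermiteC R l.+1 x = - (2 * x%:C * @hermiteC R l x) - 2 * l%:R * @hermiteC R l.-1 x.
  rewrite /hermiteC hermite_rec rmorphB rmorphN !rmorphM /= !rmorph_nat; ring.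
by move: (hermiteC _ _) (hermiteC _ _) => a b; field.
Qed.

End HermiteFunctions.

(** * The Dolbeault operators in coordinates *)

Section SpinorReduction.
Variable R : realType.
Local Notation C := R[i].
Local Notation S := (@su2_smooth R).
Implicit Types (c : SU2 R -> C) (g h t : SU2 R).

Lemma lie_su2_imq (X : 'M[C]_2) : lie_su2 X -> exists y u v : R, X = imq y u v.
Proof.
move=> /lie_su2_entries[h0 h1 h2].
exists (complex.Im (X 0 0)), (complex.Re (X 0 1)), (complex.Im (X 0 1)).
apply: mx22P; rewrite ?h1 ?h2 !mx22E; apply: ceq; move: h0;
  by case: (X 0 0) => a b; case: (X 0 1) => d e /= h0; rewrite ?h0 ?oppr0 ?opprK.
Qed.

Lemma g0_imq (y u v y' u' v' : R) :
  g0 (imq y u v) (imq y' u' v') = 8 * (y * y' + u * u' + v * v').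
Proof.
have e1 : mx22 0 1 (-1) 0 = imq 0 1 0 :> 'M[C]_2.
  by apply: mx22P; rewrite !mx22E; apply: ceq => /=; rewrite ?oppr0.
have e2 : mx22 'i 0 0 (- 'i) = imq 1 0 0 :> 'M[C]_2.
  by apply: mx22P; rewrite !mx22E; apply: ceq => /=; rewrite ?oppr0.
have e3 : mx22 0 'i 'i 0 = imq 0 0 1 :> 'M[C]_2.
  by apply: mx22P; rewrite !mx22E; apply: ceq => /=; rewrite ?oppr0.
by rewrite /g0 /killing e1 e2 e3 !lie_bracket_imq !mx22E /=; ring.
Qed.

(** A root vector for [alpha] is strictly upper triangular; the lower left
    entry is its component in the opposite root space. *)
Lemma upper_root (Z : 'M[C]_2) :
  lie_bracket (qi R) Z = alpha (qi R) *: Z -> Z 1 0 = 0.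
Proof.
move=> /(congr1 (fun M : 'M[C]_2 => M 1 0)).
rewrite /alpha /lie_bracket !mxE !sum_ord2 !mx22E.
by case: (Z 1 0) (Z 0 0) (Z 1 1) => [a b] [a' b'] [a2 b2] [e1 e2]; apply: ceq => /=; lra.
Qed.

(** The frame is determined up to a rotation of its plane: orthogonality to
    the torus and orthonormality leave a rotation or a reflection, and the
    root condition on [Z] excludes the latter. *)
Lemma adapted_frame_coord (E F : 'M[C]_2) : adapted_frame E F ->
  exists p q : R, [/\ E = imq 0 p q, F = imq 0 (- q) p & 8 * (p ^+ 2 + q ^+ 2) = 1].
Proof.
move=> [[/lie_su2_imq[y [p [q ->]]] /lie_su2_imq[y' [u [v ->]]]] perp orth [_ rootZ] _].
have tq : lie_torus (qi R).
  split; first exact: lie_qi.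
  by apply/is_diag_mxP; apply: ord2P => j; move: j; apply: ord2P => // _;
    rewrite mx22E; apply: ceq; rewrite /= ?oppr0.
have [] := perp _ tq; rewrite /qi !g0_imq !(mulr1, mulr0, addr0).
have n8 : (8 : R) != 0 by rewrite pnatr_eq0.
move=> /eqP; rewrite mulf_eq0 (negbTE n8) => /eqP /= y0 /eqP.
rewrite mulf_eq0 (negbTE n8) => /eqP /= y'0.
have [+ _ _] := orth; rewrite g0_imq y0 => eE.
have := upper_root (rootZ _ tq); rewrite y0 y'0; set Z := frame_vec _ _ _.
move=> Z0; have : imq 0 p q 1 0 - ('i)%R * imq 0 u v 1 0 = 0.
  transitivity (2 * Z 1 0); last by rewrite Z0 mulr0.
  have fvE (A B : 'M[C]_2) w : frame_vec A B w 1 0 = w.1 * A 1 0 + w.2 * B 1 0.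
    by rewrite !mxE.
  rewrite /Z fvE /Zvec /=.
  by move: (imq _ _ _ _ _) (imq _ _ _ _ _) => a b; field.
rewrite !mx22E => -[/= r1 r2].
have vp : v = p by lra.
have uq : u = - q by lra.
by exists p, q; rewrite vp uq; split=> //; apply: etrans eE; ring.
Qed.

Lemma Lie_perp (a b : R) c g : S c ->
  Lie (imq 0 a b) c g = a%:C * Lj c g + b%:C * Lk c g.
Proof.
move=> sc; rewrite Lj.unlock Lk.unlock; apply: etrans (Lie_imq 0 a b g sc) _.
by rewrite rmorph0 mul0r add0r.
Qed.

Lemma rootz_sum c p q g : S c ->
  2^-1 * Lie (imq 0 p q) c g - ('i)%R / 2 * Lie (imq 0 (- q) p) c g =
  (p%:C + ('i)%R * q%:C) * rz c g.
Proof.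
move=> sc; rewrite !Lie_perp // rmorphN /rz /der /= mul0r add0r.
have E2 : ('i)%R ^+ 2 = -1 :> C by rewrite expr2 i2.
move: ('i)%R E2 => I E2; move: (Lj c g) (Lk c g) => a b.
by move: p%:C q%:C => {}p {}q; field: E2.
Qed.

Lemma lowz_sum c p q g : S c ->
  2^-1 * Lie (imq 0 p q) c g + ('i)%R / 2 * Lie (imq 0 (- q) p) c g =
  - (p%:C - ('i)%R * q%:C) * lw c g.
Proof.
move=> sc; rewrite !Lie_perp // rmorphN /lw /der /= mul0r add0r.
have E2 : ('i)%R ^+ 2 = -1 :> C by rewrite expr2 i2.
move: ('i)%R E2 => I E2; move: (Lj c g) (Lk c g) => a b.
by move: p%:C q%:C => {}p {}q; field: E2.
Qed.

Definition spi l c : SU2 R -> R -> C := fun g => c g *: hermiteC l.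

Lemma spi_inj l c d : spi l c = spi l d -> c = d.
Proof.
have [x hx] := hermiteC_neq0 R l => e; apply/funext => g.
exact: (mulIf hx) (congr1 (fun f => f g x) e).
Qed.

Lemma spi_lin l (a b : C) c d : a *: spi l c + b *: spi l d = spi l (fun g => a * c g + b * d g).
Proof.
apply/funext => g; apply/funext => x.
by rewrite -[LHS]/(a * (c g * hermiteC l x) + b * (d g * hermiteC l x))
  -[RHS]/((a * c g + b * d g) * hermiteC l x); ring.
Qed.

Lemma lderiv_spi X l c g x : S c -> lie_su2 X ->
  lderiv X (spi l c) g x = Lie X c g * hermiteC l x.
Proof.
move=> sc hX; apply: isdC_derive1C.
apply: isdC_eq (isdCM (Lie_exp0 g sc hX) (isdC_cst (hermiteC l x) 0)) _.
by rewrite mulr0 addr0.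
Qed.

Lemma sigma_scale w (a : C) f : (forall x, exists d, isdC f x d) ->
  sigma w (a *: f) = a *: sigma w f.
Proof.
move=> df; apply/funext => x; have [d dx] := df x.
rewrite scale_fun /sigma (isdC_derive1C dx) scale_fun.
by rewrite (isdC_derive1C (isdCZ a dx)); ring.
Qed.

Lemma isdC_hermiteC l x : exists d, isdC (@hermiteC R l) x d.
Proof. by eexists; exact: isdC_real (is_derive_hermite l x). Qed.

Section Frame.
Variables (p q : R).
Hypothesis pq : 8 * (p ^+ 2 + q ^+ 2) = 1.
Let E := imq 0 p q.
Let F := imq 0 (- q) p.
Let zp : C := p%:C + ('i)%R * q%:C.
Let zm : C := p%:C - ('i)%R * q%:C.

Let zz : zp * zm = 8^-1.
Proof.
have : 8 * (zp * zm) = 1.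
  have -> : 8 * (zp * zm) = 8 * (p%:C ^+ 2 - ('i)%R * ('i)%R * q%:C ^+ 2) by rewrite /zp /zm; ring.
  rewrite i2 mulN1r opprK -!rmorphXn -rmorphD.
  have -> : 8 = (8 : R)%:C by rewrite rmorph_nat.
  by rewrite -rmorphM pq.
by move=> e; apply: (mulfI (_ : 8 != 0)); rewrite ?pnatr_eq0 // e mulfV // pnatr_eq0.
Qed.

Lemma Dolb_spi l c : S c ->
  Dolb E F (spi l c) = spi l.-1 (fun g => 4 * zp * l%:R * rz c g).
Proof.
move=> sc; apply/funext => g.
have e : lderivC E F (Zvec R) (spi l c) g = (zp * rz c g) *: hermiteC l.
  apply/funext => x.
  rewrite -[LHS]/(2^-1 * lderiv E (spi l c) g x + (- (('i)%R / 2)) * lderiv F (spi l c) g x).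
  rewrite !lderiv_spi //; try exact: lie_imq.
  rewrite scale_fun -(rootz_sum p q g sc) /E /F.
  by move: (Lie _ _ _) (Lie _ _ _) => a b; ring.
rewrite /Dolb e (sigma_scale _ _ (isdC_hermiteC l)) sigma_Zbar !scalerA.
congr (_ *: _); have := i2 R; move: ('i)%R => I E2.
have E3 : I ^+ 2 = -1 by rewrite expr2.
ring: E3.
Qed.

Lemma Dolbbar_spi l c : S c ->
  Dolbbar E F (spi l c) = spi l.+1 (fun g => 2 * zm * lw c g).
Proof.
move=> sc; apply/funext => g.
have e : lderivC E F (Zbar R) (spi l c) g = (- zm * lw c g) *: hermiteC l.
  apply/funext => x.
  rewrite -[LHS]/(2^-1 * lderiv E (spi l c) g x + (('i)%R / 2) * lderiv F (spi l c) g x).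
  rewrite !lderiv_spi //; try exact: lie_imq.
  rewrite scale_fun -(lowz_sum p q g sc) /E /F.
  by move: (Lie _ _ _) (Lie _ _ _) => a b; ring.
rewrite /Dolbbar e (sigma_scale _ _ (isdC_hermiteC l)) sigma_Zvec !scalerA.
congr (_ *: _); have := i2 R; move: ('i)%R => I E2.
have E3 : I ^+ 2 = -1 by rewrite expr2.
by field: E3.
Qed.

(** The phases [zp] and [zm] of the frame only enter through [zp * zm = p^2 +
    q^2 = 1/8]. *)
Lemma Pop_spi l c : S c -> Pop E F (spi l c) =
  spi l (fun g => 2^-1 * (l.+1%:R * rz (lw c) g - l%:R * lw (rz c) g)).
Proof.
move=> sc; have sl : S (lw c) by exact: smooth_der.
have sr : S (rz c) by exact: smooth_der.
rewrite /Pop Dolbbar_spi // Dolb_spi; last exact: su2_smoothZ.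
rewrite Dolb_spi // Dolbbar_spi; last exact: su2_smoothZ.
rewrite rzZ // lwZ //; case: l => [|l].
  apply/funext => g; apply/funext => x.
  rewrite -[LHS]/(2^-1 * (4 * zp * 1%:R * (2 * zm * rz (lw c) g) * hermiteC 0 x -
    2 * zm * (4 * zp * 0%:R * lw (rz c) g) * hermiteC 1 x)).
  rewrite -[RHS]/(2^-1 * (1%:R * rz (lw c) g - 0%:R * lw (rz c) g) * hermiteC 0 x).
  transitivity (2^-1 * (8 * (zp * zm)) * rz (lw c) g * hermiteC 0 x); first by ring.
  by rewrite zz; field.
rewrite -scaleN1r /= -[X in X + _]scale1r spi_lin.
rewrite -[LHS]addr0 -[X in _ + X](scale0r (spi l.+1 c)) spi_lin; congr spi; apply/funext => g.
rewrite mul0r addr0.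
transitivity (2^-1 * (8 * (zp * zm)) * (l.+2%:R * rz (lw c) g - l.+1%:R * lw (rz c) g)).
  by ring.
by rewrite zz; field.
Qed.

(** The two products of [rz] and [lw] differ by the weight. *)
Lemma Pop_weight l c : W (- (2 * l + 1)%:R) c -> Pop E F (spi l c) =
  spi l (fun g => 2^-1 * (rz (lw c) g - l%:R * (2 * l + 1)%:R * c g)).
Proof.
move=> [sc wc]; rewrite Pop_spi //; congr spi; apply/funext => g.
have := comm_rl g sc; rewrite wc => /eqP; rewrite subr_eq => /eqP e.
by rewrite -natr1 e; ring.
Qed.

End Frame.

End SpinorReduction.

(** * Sections are functions of a given weight *)

Section Sections.
Variable R : realType.
Local Notation C := R[i].
Local Notation S := (@su2_smooth R).
Implicit Types (c : SU2 R -> C) (g h t : SU2 R).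

Lemma su2_exp_qi (s : R) : su2val (su2_exp (s%:C *: qi R)) = quat (cos s) (sin s) 0 0.
Proof. by rewrite su2_exp_imq ?mulr0 ?mulr1 //; ring. Qed.

Lemma inv00 t : su2val t^-1%g 0 0 = (su2val t 0 0)^*.
Proof. by rewrite /= !mxE. Qed.

(** A diagonal element of SU(2) is a unit quaternion [x + y i]. *)
Lemma diag_exp t : is_diag_mx (su2val t) -> exists s : R, t = su2_exp (s%:C *: qi R).
Proof.
move=> /is_diag_mxP td; have [y [u [v [r [e tE]]]]] := su2_polar t.
have := td 0 1 isT; rewrite tE su2_exp_imq // mx22E => -[su sv].
have [s0|s0] := eqVneq (sin r) 0.
  exists r; apply: val_inj.
  apply: etrans (su2_exp_imq r e) (etrans _ (esym (su2_exp_qi _))); rewrite s0.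
  by rewrite !mul0r.
have u0 : u = 0 by move/eqP: su; rewrite mulf_eq0 (negbTE s0) => /eqP.
have v0 : v = 0 by move/eqP: sv; rewrite mulf_eq0 (negbTE s0) => /eqP.
exists (y * r); apply: val_inj.
  apply: etrans (su2_exp_imq r e) (etrans _ (esym (su2_exp_qi _))); rewrite u0 v0 !mulr0.
move: e; rewrite u0 v0 expr0n /= !addr0 => /eqP; rewrite sqrf_eq1 => /orP[] /eqP ->.
  by rewrite mul1r mulr1.
by rewrite mulN1r mulrN1 cosN sinN.
Qed.

(** Differentiating the equivariance at the identity of the torus gives the
    weight; conversely the weight integrates to the action of the torus by
    [torus_weight]. The nonzero values of [h_l] allow passing from spinors to
    coefficients. *)
Lemma Gamma_spi l (phi : SU2 R -> R -> C) :
  Gamma l phi <-> exists2 c, W (- (2 * l + 1)%:R) c & phi = spi l c.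
Proof.
set n := (2 * l + 1)%N; split=> [[[c sc ->] eqv]|[c Wc ->]]; last first.
  split; first by exists c => //; case: Wc.
  move=> g t /diag_exp[s ->]; rewrite /spi /torus_act (torus_weight g s Wc) -/n inv00.
  by rewrite su2_exp_qi mx22E cexp_int scalerA.
exists c => //; split=> //; apply/funext => g.
have [x hx] := hermiteC_neq0 R l.
have E (s : R) : c (g * su2_exp (s%:C *: qi R))%g = cexp (('i)%R * - n%:R) s * c g.
  have dg : is_diag_mx (su2val (su2_exp (s%:C *: qi R))).
    rewrite su2_exp_qi; apply/is_diag_mxP; apply: ord2P => j; move: j; apply: ord2P => // _;
      by rewrite mx22E; apply: ceq; rewrite /= ?oppr0.
  have := congr1 (fun f => f x) (eqv g _ dg); rewrite /torus_act inv00 su2_exp_qi mx22E -/n.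
  rewrite cexp_int !scale_fun mulrA.
  by move/(mulIf hx).
have d1 := Lie_exp0 g sc (lie_qi R).
have d2 := isdCM (isdC_cexp (('i)%R * - n%:R) 0) (isdC_cst (c g) 0).
have e : Lie (qi R) c g = ('i)%R * - n%:R * c g.
  rewrite -(isdC_derive1C d1).
  have -> : (fun s : R => c (g * su2_exp (s%:C *: qi R))%g) =
      (fun s => cexp (('i)%R * - n%:R) s * c g) by apply/funext.
  by rewrite (isdC_derive1C d2) cexp0 mulr1 mulr0 addr0.
rewrite /wt /der Li.unlock e /= !mul0r !addr0 !mulrA.
by rewrite mulNr i2 opprK mul1r.
Qed.

End Sections.

(** * Eigenspaces and binary forms *)

Section Transport.
Variables (K : fieldType) (U1 U2 : lmodType K) (W1 : set U1) (W2 : set U2) (s : U2 -> U1).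
Hypothesis sub2 : is_subspace W2.
Hypothesis slin : forall a u v, W2 u -> W2 v -> s (a *: u + v) = a *: s u + s v.
Hypothesis sbij : set_bij W2 W1 s.

Let sfun u : W2 u -> W1 (s u). Proof. by have [h _ _] := sbij; exact: h. Qed.
Let sinj u v : W2 u -> W2 v -> s u = s v -> u = v.
Proof. by have [_ h _] := sbij => hu hv; apply: h; rewrite inE. Qed.
Let ssurj u : W1 u -> exists2 v, W2 v & s v = u.
Proof. by have [_ _ h] := sbij; exact: h. Qed.

(** An isomorphism may be given in the direction in which it has a formula;
    its inverse is chosen. *)
Lemma rep_iso_inverse (G : Type) (act1 : G -> U1 -> U1) (act2 : G -> U2 -> U2) :
  invariant_under act2 W2 -> (forall g p, W2 p -> s (act2 g p) = act1 g (s p)) ->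
  rep_iso act1 W1 act2 W2.
Proof.
move=> inv2 eqv; have [W20 W2D] := sub2.
have /choice[f fP] : forall u, exists p, W1 u -> W2 p /\ s p = u.
  move=> u; have [/ssurj[p Wp <-]|nW] := pselect (W1 u); first by exists p.
  by exists 0.
have f2 u : W1 u -> W2 (f u) by move=> /fP[].
have sf u : W1 u -> s (f u) = u by move=> /fP[].
have fs p : W2 p -> f (s p) = p.
  by move=> Wp; apply: sinj; rewrite ?sf //; [exact/f2/sfun|exact: sfun].
have inv1 : invariant_under act1 W1.
  by move=> g u /ssurj[p Wp <-]; rewrite -eqv //; exact/sfun/inv2.
split=> //; exists f; split.
- move=> a u v /ssurj[p Wp <-] /ssurj[q Wq <-].
  by rewrite -slin // !fs //; exact: W2D.
- split; first by move=> u; exact: f2.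
    move=> u v; rewrite !inE => /ssurj[p Wp <-] /ssurj[q Wq <-].
    by rewrite !fs // => ->.
  by move=> p Wp; exists (s p); [exact: sfun|exact: fs].
- by move=> g u /ssurj[p Wp <-]; rewrite -eqv // !fs //; exact: inv2.
Qed.

Lemma has_dim_image n : has_dim n W2 -> has_dim n W1.
Proof.
have [W20 W2D] := sub2.
have s0 : s 0 = 0.
  have := slin 1 W20 W20; rewrite !scale1r addr0 => e.
  by apply: (addrI (s 0)); rewrite addr0 -e.
move=> [b [b1 b2 b3]].
have Wb i : W2 (b i).
  have := b1 (delta_mx 0 i) I; rewrite (bigD1 i) //= big1 ?addr0.
    by rewrite mxE !eqxx scale1r.
  by move=> j ji; rewrite mxE (negbTE ji) andbF scale0r.
have sE (c : 'rV[K]_n) : \sum_(i < n) c 0 i *: s (b i) = s (\sum_(i < n) c 0 i *: b i).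
  suff [] : W2 (\sum_(i < n) c 0 i *: b i) /\
    \sum_(i < n) c 0 i *: s (b i) = s (\sum_(i < n) c 0 i *: b i) by [].
  apply: (big_ind2 (fun x y => W2 y /\ x = s y)) => [|x y z t [Wy ->] [Wt ->]|i _].
  - by rewrite s0.
  - by rewrite -[y]scale1r slin // !scale1r; split=> //; rewrite -[y]scale1r; exact: W2D.
  - split; first by rewrite -[_ *: _]addr0; exact: W2D.
    by rewrite -[c 0 i *: b i]addr0 slin // s0 addr0.
exists (fun i => s (b i)); split.
- by move=> c _; rewrite sE; apply: sfun; exact: b1.
- move=> c d _ _; rewrite !sE => /sinj e; apply: b2; rewrite ?inE //.
  by apply: e; exact: b1.
- move=> u /ssurj[p Wp <-]; have [c _ <-] := b3 _ Wp.
  by exists c => //; rewrite sE.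
Qed.

End Transport.

Section Eigenspaces.
Variable R : realType.
Local Notation C := R[i].
Local Notation S := (@su2_smooth R).
Implicit Types (c : SU2 R -> C) (g h : SU2 R) (p : 'cV[C]_2 -> C).

Lemma der_left w c g k : 
  iter k (der w) (fun h => c (g * h)%g) = (fun h => iter k (der w) c (g * h)%g).
Proof.
elim: k => //= k ->; apply/funext => h; rewrite /der Li.unlock Lj.unlock Lk.unlock.
by rewrite !Lie_left.
Qed.

Lemma iter_der0 w k : iter k (der w) (fun=> 0 : C) = (fun=> 0).
Proof. by elim: k => //= k ->; rewrite der_cst. Qed.

Section Level.
Variables l j : nat.
Let n := (2 * l + 1)%N.
Let m := (2 * (l + j) + 1)%N.

(** A form of degree [n + 2 j], seen as a lowest weight function of the same
    weight up to sign, is raised [j] times to weight [-n]. *)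
Definition eigen_coord p : SU2 R -> C := iter j (@rz R) (fun g => p (col1 g)).

Let mE : (m%:R : C) = n%:R + 2 * j%:R.
Proof. by rewrite /m mulnDr -addnA [(2 * j + 1)%N]addnC addnA natrD natrM. Qed.

Lemma eigen_coordP p : Virr m p -> W (- n%:R) (eigen_coord p) /\
  rz (lw (eigen_coord p)) = (fun g => (j * (j + n + 1))%:R * eigen_coord p g).
Proof.
move=> /form_lowest[Wp lp]; split.
  have := W_iter_rz j Wp; congr W; rewrite mE; ring.
have H i : m%:R = n%:R + 2 * i%:R :> C -> rz (lw (iter i (@rz R) (fun g => p (col1 g)))) =
    (fun g => (i * (i + n + 1))%:R * iter i (@rz R) (fun g => p (col1 g)) g).
  case: i => [|k] E; first by rewrite /= lp /rz der_cst; apply/funext => g; rewrite mul0r.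
  rewrite (lr_iter k Wp lp) rzZ; last by apply: iter_der_smooth; case: Wp.
  by apply/funext => g /=; congr (_ * _); rewrite E natrM !natrD -!natr1; ring.
exact: H.
Qed.

Lemma eigen_coord_lin (a : C) p q : Virr m p -> Virr m q ->
  eigen_coord (a *: p + q) = (fun g => a * eigen_coord p g + 1 * eigen_coord q g).
Proof.
move=> /form_lowest[[sp _] _] /form_lowest[[sq _] _].
rewrite /eigen_coord -[fun g => (a *: p + q) _]/(fun g => a * p (col1 g) + q (col1 g)).
rewrite iter_derD //; last exact: su2_smoothZ.
by rewrite iter_derZ //; apply/funext => g; rewrite mul1r.
Qed.

Lemma eigen_coord_act p g : eigen_coord (Vact g p) = (fun h => eigen_coord p (g^-1 * h)%g).
Proof.
rewrite /eigen_coord -[RHS](der_left _ (fun h => p (col1 h)) g^-1%g j).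
congr iter; apply/funext => h; rewrite /Vact; congr p.
by apply/colP => i; rewrite /col1 /= !mxE; apply: eq_bigr => k _; rewrite [col _ _ _ _]mxE.
Qed.

(** The kernel is an invariant subspace of the irreducible representation on
    forms. It is not everything: the form [z1^m] takes the value [1] at the
    second column of the identity, and lowering the raised function [j] times
    multiplies it by a product of nonzero factors. *)
Lemma eigen_coord_inj p : Virr m p -> eigen_coord p = (fun=> 0) -> p = 0.
Proof.
move=> Vp p0; have [Ws Wi _ irr] := @Virr_irreducible R m.
pose N := [set p | Virr m p /\ eigen_coord p = (fun=> 0)].
have sN : is_subspace N.
  split=> [|a u v [Vu u0] [Vv v0]].
    split; first exact: Virr0.
    have := eigen_coord_lin (-1) Vp Vp; rewrite scaleN1r addNr => ->.
    by apply/funext => g; rewrite p0 !mulr0 addr0.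
  split; first exact: VirrD.
  by rewrite eigen_coord_lin // u0 v0; apply/funext => g; rewrite !mulr0 addr0.
have iN : invariant_under (@Vact R) N.
  by move=> g u [Vu u0]; split; [exact: Virr_invariant|rewrite eigen_coord_act u0].
have [] := irr N sN iN (fun u Nu => proj1 Nu).
  by move=> N0; have : N p by []; rewrite N0.
move=> NV; pose r : 'cV[C]_2 -> C := fun z => z 0 0 ^+ 0 * z 1 0 ^+ (m - 0).
have Vr : Virr m r by exact: Virr_mono (leq0n m).
have : N r by rewrite NV.
move=> [_ e0]; have [Wr lr] := form_lowest Vr.
have := congr1 (fun f => f 1%g) (lw_rz_iter j Wr lr).
rewrite -[iter j (@rz R) _]/(eigen_coord r) e0 iter_der0.
have -> : r (col1 1%g) = 1 by rewrite /r /col1 !mxE /= expr0 expr1n mulr1.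
rewrite mulr1 => /esym/eqP; rewrite prodf_seq_eq0 => /hasP[i _ /=].
rewrite mulf_eq0 pnatr_eq0 subr_eq0 eqr_nat /= => /eqP mi.
by have := ltn_ord i; rewrite -mi /m; lia.
Qed.

End Level.
End Eigenspaces.

(** * The spectrum *)

Section Spectrum.
Variable R : realType.
Local Notation C := R[i].
Local Notation S := (@su2_smooth R).
Implicit Types (c : SU2 R -> C) (g h : SU2 R) (p : 'cV[C]_2 -> C).

(** Lower [j] times to reach a form, then raise back; the factor [K] picked
    up on the way has no vanishing term since the eigenvalues [i (i+n+1)] are
    increasing in [i]. *)
Lemma eigen_coord_surj (l j : nat) c : let n := (2 * l + 1)%N in
  W (- n%:R) c -> rz (lw c) = (fun g => (j * (j + n + 1))%:R * c g) ->
  exists2 p, Virr (2 * (l + j) + 1) p & eigen_coord j p = c.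
Proof.
move=> n Wc ec; have lv := lw_extremal Wc ec.
have Wv : W (- (2 * (l + j) + 1)%:R) (iter j (@lw R) c).
  have := W_iter_lw j Wc; congr W.
  by rewrite /n mulnDr -addnA [(2 * j + 1)%N]addnC addnA [in RHS]natrD natrM; ring.
have [p Vp vE] := lowest_form Wv lv.
pose K : C := \prod_(i < j) ((j * (j + n + 1))%:R + i%:R * - n%:R - i%:R * i.+1%:R).
have K0 : K != 0.
  rewrite prodf_seq_neq0; apply/allP => i _; rewrite rho_ladder subr_eq0 eqr_nat.
  by have := ltn_ord i; nia.
have e : eigen_coord j p = (fun g => K * c g).
  by rewrite /eigen_coord -vE (rz_lw_iter j Wc ec).
exists (K^-1 *: p); first by rewrite -[_ *: p]addr0; apply: VirrD => //; exact: Virr0.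
have := eigen_coord_lin (l := l) (j := j) (K^-1) Vp (@Virr0 R _).
rewrite addr0 => ->; apply/funext => g; rewrite e mulKf //.
have -> : eigen_coord j (0 : 'cV[C]_2 -> C) = (fun=> 0).
  by rewrite /eigen_coord -[fun g => _]/(fun=> 0 : C) iter_der0.
by rewrite mulr0 addr0.
Qed.

Lemma der_lin w (a : C) c d : S c -> S d ->
  der w (fun g => c g + a * d g) = (fun g => der w c g + a * der w d g).
Proof. by move=> sc sd; rewrite (derD w sc (su2_smoothZ a sd)) (derZ w a sd). Qed.

Section Frame.
Variables (E F : 'M[C]_2) (l : nat).
Hypothesis hEF : adapted_frame E F.
Let n := (2 * l + 1)%N.

(** On coefficients, [P - lam] is half of [rz lw - rho], where
    [rho = 2 lam + l n]. *)
Lemma Pop_shift (lam : C) c : W (- n%:R) c ->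
  Pop E F (spi l c) - lam *: spi l c =
  spi l (fun g => 2^-1 * (rz (lw c) g - (2 * lam + l%:R * n%:R) * c g)).
Proof.
move=> Wc; have [p [q [-> -> pq]]] := adapted_frame_coord hEF.
rewrite (Pop_weight pq Wc) -scaleNr -[X in X + _]scale1r spi_lin; congr spi.
by apply/funext => g; rewrite -/n; field.
Qed.

(** Completing the square: [4 j (j+n+1) + (n+1)^2 = 4 (l+j+1)^2]. *)
Lemma lam_rho j : 2 * lam R l j + l%:R * n%:R = (j * (j + n + 1))%:R.
Proof. by rewrite /lam /n !(natrM, natrD); field. Qed.

Lemma W_rz_lw c : W (- n%:R) c -> W (- n%:R) (rz (lw c)).
Proof. by move=> Wc; have := W_rz (W_lw Wc); rewrite subrK. Qed.

Lemma spi0 : spi l (fun=> 0 : C) = 0.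
Proof. by apply/funext => g; rewrite /spi scale0r. Qed.

Lemma eigen_set_bij j :
  set_bij (@Virr R (2 * (l + j) + 1)) (eigenspace_in (Gamma l) (Pop E F) (lam R l j))
    (fun p => spi l (eigen_coord j p)).
Proof.
split.
- move=> p /eigen_coordP[Wc ec]; split; first by apply/Gamma_spi; exists (eigen_coord j p).
  apply/eqP; rewrite -subr_eq0 Pop_shift // lam_rho ec.
  rewrite -[X in _ == X]spi0; apply/eqP; congr spi; apply/funext => g.
  by rewrite subrr mulr0.
- move=> p q; rewrite !inE => Vp Vq /spi_inj e; apply/eqP; rewrite -subr_eq0; apply/eqP.
  have Vn : Virr (2 * (l + j) + 1) (p - q).
    by rewrite -scaleN1r addrC; exact: VirrD.
  apply: (eigen_coord_inj Vn); rewrite -scaleN1r addrC (eigen_coord_lin _ Vq Vp) e.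
  by apply/funext => g; rewrite mulN1r mul1r addNr.
- move=> phi [/Gamma_spi[c Wc ->] /eqP]; rewrite -subr_eq0 Pop_shift // lam_rho => /eqP.
  rewrite -spi0 => /spi_inj e.
  have ec : rz (lw c) = (fun g => (j * (j + n + 1))%:R * c g).
    apply/funext => g; have /eqP := congr1 (fun f => f g) e.
    by rewrite mulf_eq0 invr_eq0 pnatr_eq0 subr_eq0 => /eqP.
  by have [p Vp <-] := eigen_coord_surj Wc ec; exists p.
Qed.

Lemma Pop_bij (lam0 : C) : (forall j, lam0 != lam R l j) ->
  set_bij (Gamma l) (Gamma l) (fun u => Pop E F u - lam0 *: u).
Proof.
move=> nlam; pose rho : C := 2 * lam0 + l%:R * n%:R.
have nrho j : rho != (j * (j + n + 1))%:R.
  rewrite -lam_rho /rho (inj_eq (addIr _)).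
  by rewrite (inj_eq (mulfI _)) ?pnatr_eq0.
have on : odd n by rewrite /n addn1 /= oddM.
have Wsub c d : W (- n%:R) c -> W (- n%:R) d -> W (- n%:R) (fun g => c g + -1 * d g).
  by move=> Wc Wd; apply: WD => //; exact: WZ.
split.
- move=> phi /Gamma_spi[c Wc ->]; rewrite Pop_shift //; apply/Gamma_spi; eexists; last by [].
  apply: WZ; have -> : (fun g => rz (lw c) g - (2 * lam0 + l%:R * n%:R) * c g) =
      (fun g => rz (lw c) g + -1 * (rho * c g)) by apply/funext => g; rewrite mulN1r.
  by apply: Wsub; [exact: W_rz_lw|exact: WZ].
- move=> phi psi; rewrite !inE => /Gamma_spi[c Wc ->] /Gamma_spi[d Wd ->].
  move=> epsi.
  have /spi_inj e := etrans (esym (Pop_shift lam0 Wc)) (etrans epsi (Pop_shift lam0 Wd)).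
  apply: (congr1 (spi l)).
  have [[sc _] [sd _]] := (Wc, Wd).
  have d0 : (fun g => c g + -1 * d g) = (fun=> 0).
    apply: (weight_eigen_eq0 (Wsub _ _ Wc Wd) _ nrho).
    apply/funext => g; have := congr1 (fun f => f g) e => /=.
    move/(mulfI (_ : 2^-1 != 0)); rewrite invr_eq0 pnatr_eq0 => /(_ isT) eg.
    rewrite /rz /lw (der_lin _ (-1) sc sd) (der_lin _ (-1) (smooth_der _ sc) (smooth_der _ sd)).
    rewrite -/(lw c) -/(lw d) -/(rz (lw c)) -/(rz (lw d)).
    move: eg; rewrite -/rho; move: (rz _ g) (rz _ g) => b a eg.
    transitivity (a - rho * c g - (b - rho * d g) + rho * (c g + -1 * d g)); first by ring.
    by rewrite eg subrr add0r.
  apply/funext => g; have /eqP := congr1 (fun f => f g) d0.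
  by rewrite mulN1r subr_eq0 => /eqP.
- move=> phi /Gamma_spi[c Wc ->].
  have [u Wu uE] := rz_lw_surj on nrho (WZ 2 Wc).
  exists (spi l u); first by apply/Gamma_spi; exists u.
  rewrite Pop_shift //; congr spi; apply/funext => g.
  by rewrite uE mulKf // pnatr_eq0.
Qed.

End Frame.
End Spectrum.

Local Close Scope complex_scope.

Theorem proposition5p4 (R : realType) (E F : 'M[R[i]]_2)
    (hEF : adapted_frame E F) (l : nat) :
  spectrum (Gamma l) (Pop E F) = [set @lam R l j | j in [set: nat]] /\
  forall j : nat,
    rep_iso (@left_translation R)
            (eigenspace_in (Gamma l) (Pop E F) (@lam R l j))
            (@Vact R) (@Virr R (2 * (l + j) + 1)) /\
    has_dim (2 * (l + j + 1)) (eigenspace_in (Gamma l) (Pop E F) (@lam R l j)).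
Proof.
have sub j : is_subspace (@Virr R (2 * (l + j) + 1)).
  by split; [exact: Virr0|exact: VirrD].
have lin j (a : R[i]) p q : Virr (2 * (l + j) + 1) p -> Virr (2 * (l + j) + 1) q ->
    spi l (eigen_coord j (a *: p + q)) =
    a *: spi l (eigen_coord j p) + spi l (eigen_coord j q).
  move=> Vp Vq; rewrite (eigen_coord_lin a Vp Vq).
  by rewrite -[X in _ = _ + X]scale1r spi_lin.
have bij j := eigen_set_bij l hEF j.
split=> [|j]; last split.
- apply/seteqP; split=> [lam0 /= nbij|_ [j _ <-] /= Pbij].
    apply: contrapT => h; apply: nbij; apply: Pop_bij => // j.
    by apply/eqP => e; apply: h; exists j.
  have [_ inj _] := Pbij; have [_ Vinj _] := bij j.
  pose r : 'cV[R[i]]_2 -> R[i] := fun z => z 0 0 ^+ 0 * z 1 0 ^+ (2 * (l + j) + 1 - 0).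
  have Vr : Virr (2 * (l + j) + 1) r by exact: Virr_mono (leq0n _).
  have V0 : Virr (2 * (l + j) + 1) (0 : 'cV[R[i]]_2 -> R[i]) by exact: Virr0.
  have [fun_ _ _] := bij j; have [G1 e1] := fun_ _ Vr; have [G0 e0] := fun_ _ V0.
  have : spi l (eigen_coord j r) = spi l (eigen_coord j 0).
    have z phi : Pop E F phi = lam R l j *: phi -> Pop E F phi - lam R l j *: phi = 0.
      by move=> ->; rewrite subrr.
    apply: inj; [by rewrite inE|by rewrite inE|exact: etrans (z _ e1) (esym (z _ e0))].
  move=> /Vinj; rewrite !inE => /(_ Vr V0) /(congr1 (fun p => p (col1 1%g))).
  by rewrite /r /col1 !mxE /= expr0 expr1n mulr1 => /eqP; rewrite oner_eq0.
- apply: (rep_iso_inverse (sub j) (lin j) (bij j)); first exact: Virr_invariant.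
  by move=> g p Vp; rewrite eigen_coord_act.
- have -> : (2 * (l + j + 1) = (2 * (l + j) + 1).+1)%N by lia.
  exact: (has_dim_image (sub j) (lin j) (bij j) (@Virr_dim R _)).
Qed.
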